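(* Let $G$ be a locally compact group, let $A$ be a locally $C^*$-algebra and let $E$ be a full Hilbert $A$-module. Any action $g\mapsto u_g$ of $G$ on $E$ induces an action $g\mapsto \gamma_g^u$ of $G$ on the linking algebra $\mathcal{L}(E)$ of $E$ such that $$\gamma_g^u\left(L_{a,\xi,\eta,T}\right)=L_{\alpha_g^u(a),\,u_g(\xi),\,u_g(\eta),\,\beta_g^u(T)}$$ for all $g\in G$, $a\in A$, $\xi,\eta\in E$ and $T\in K(E)$, where $\alpha^u$ and $\beta^u$ are the actions of $G$ on $A$ and on $K(E)$ induced by $u$. Moreover, if $g\mapsto u_g$ is a continuous inverse limit action of $G$ on $E$, then $g\mapsto\gamma_g^u$ is a continuous inverse limit action of $G$ on $\mathcal{L}(E)$.
   Context: **Locally $C^*$-algebras.** A locally $C^*$-algebra is a complete Hausdorff complex topological $*$-algebra $A$ whose topology is determined by its continuous $C^*$-seminorms (a net $a_i\to 0$ iff $p(a_i)\to 0$ for every continuous $C^*$-seminorm $p$). $S(A)$ denotes the set of all continuous $C^*$-seminorms on $A$, directed by $p\ge q$ iff $p(a)\ge q(a)$ for all $a$. For $p\in S(A)$, $A_p=A/\ker p$ is a $C^*$-algebra, with quotient map $\pi_p:A\to A_p$, and $A\cong\varprojlim_{p} A_p$. A morphism of locally $C^*$-algebras is a continuous $*$-homomorphism; an isomorphism is a bijective map such that it and its inverse are morphisms. **Hilbert modules.** A Hilbert $A$-module is a complex vector space $E$ that is a right $A$-module (compatibly with the complex algebra structure), with an $A$-valued inner product $\langle\cdot,\cdot\rangle$,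 $\mathbb{C}$- and $A$-linear in the second variable, with $\langle\xi,\eta\rangle^*=\langle\eta,\xi\rangle$, $\langle\xi,\xi\rangle\ge 0$, and $\langle\xi,\xi\rangle=0$ iff $\xi=0$, which is complete for the topology given by the seminorms $\overline{p}_E(\xi)=\sqrt{p(\langle\xi,\xi\rangle)}$, $p\in S(A)$. $E$ is full if the linear span of $\{\langle\xi,\eta\rangle:\xi,\eta\in E\}$ is dense in $A$. For $p\in S(A)$, $E_p=E/\ker\overline{p}_E$ is a Hilbert $A_p$-module. $L(E)$ is the locally $C^*$-algebra of adjointable $A$-module maps $E\to E$, with topology given by the seminorms $\widetilde{p}_{L(E)}(T)=\|(\pi_p)_*(T)\|_{L(E_p)}$, $p\in S(A)$, where $(\pi_p)_*(T)(\xi+\ker\overline{p}_E)=T(\xi)+\ker\overline{p}_E$. For $\xi,\eta\in E$, $\theta_{\eta,\xi}\in L(E)$ is $\theta_{\eta,\xi}(\zeta)=\eta\langle\xi,\zeta\rangle$, and $K(E)$ is the closure in $L(E)$ of the linear span of all $\theta_{\eta,\xi}$; it is a closed two-sided $*$-ideal of $L(E)$. **Linking algebra.** $A\oplus E$ is a full Hilbert $A$-module with $(a\oplus\xi)b=ab\oplus\xi b$ and $\langle a\oplus\xi,b\oplus\eta\rangle=a^*b+\langle\xi,\eta\rangle$. For $a\in A$, $\xi,\eta\in E$, $T\in K(E)$, let $L_{a,\xi,\eta,T}\in L(A\oplus E)$ be $L_{a,\xi,\eta,T}(b\oplus\zeta)=(ab+\langle\xi,\zeta\rangle)\oplus(\eta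 b+T(\zeta))$. The linking algebra $\mathcal{L}(E)$ is the locally $C^*$-subalgebra of $L(A\oplus E)$ generated by all the $L_{a,\xi,\eta,T}$. **Morphisms and actions on Hilbert modules.** For a Hilbert $A$-module $E$ and a Hilbert $B$-module $F$, a morphism of Hilbert modules is a map $u:E\to F$ for which there is a morphism of locally $C^*$-algebras $\alpha:A\to B$ with $\langle u(\xi),u(\eta)\rangle=\alpha(\langle\xi,\eta\rangle)$ for all $\xi,\eta\in E$. An isomorphism is a bijective $u$ such that $u$ and $u^{-1}$ are morphisms. $\mathrm{Aut}(E)$ is the group of isomorphisms $E\to E$. An action of $G$ on $E$ is a group morphism $g\mapsto u_g$ from $G$ to $\mathrm{Aut}(E)$; it is continuous if $(g,\xi)\mapsto u_g(\xi)$ is jointly continuous $G\times E\to E$. It is an inverse limit action if $E$ can be written as an inverse limit $\varprojlim_{\lambda\in\Lambda}E_\lambda$ of Hilbert $C^*$-modules such that $u_g=\varprojlim_\lambda u_g^\lambda$ for every $g\in G$, where $g\mapsto u_g^\lambda$ is an action of $G$ on $E_\lambda$. (An inverse system of Hilbert $C^*$-modules consists of inverse systems $\{A_\lambda;\pi_{\lambda\mu}\}$ of $C^*$-algebras and $\{E_\lambda;\sigma_{\lambda\mu}\}$ of Hilbert $A_\lambda$-modules with $\sigma_{\lambda\mu}(\xi a)=\sigma_{\lambda\mu}(\xi)\pi_{\lambda\mu}(a)$ and $\langle\sigma_{\lambda\mu}(\xi),\sigma_{\lambda\mu}(\eta)\rangle=\pi_{\lambda\mu}(\langle\xi,\eta\rangle)$;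 its limit is a Hilbert module over $\varprojlim A_\lambda$. The convention is that, for an inverse limit action, one can take the inverse system $\{E_p;A_p\}_{p\in S(A)}$, after replacing $S(A)$ by a cofinal subset.) **Actions on locally $C^*$-algebras.** An action of $G$ on $A$ is a group morphism $\alpha:G\to\mathrm{Aut}(A)$, where $\mathrm{Aut}(A)$ is the group of isomorphisms of locally $C^*$-algebras $A\to A$; it is continuous if $(g,a)\mapsto\alpha_g(a)$ is jointly continuous $G\times A\to A$. A continuous action is an inverse limit action if $A$ can be written as an inverse limit $\varprojlim_\delta A_\delta$ of $C^*$-algebras with actions $\alpha^\delta$ of $G$ on $A_\delta$ such that $\alpha_g=\varprojlim_\delta\alpha_g^\delta$ for all $g\in G$. **Induced actions.** For a full Hilbert $A$-module $E$, it is known that any action $u$ of $G$ on $E$ induces an action $\alpha^u$ of $G$ on $A$ with $\alpha_g^u(\langle\xi,\eta\rangle)=\langle u_g(\xi),u_g(\eta)\rangle$, and an action $\beta^u$ of $G$ on $K(E)$ with $\beta_g^u(\theta_{\xi,\eta})=\theta_{u_g(\xi),u_g(\eta)}$, for all $g\in G$, $\xi,\eta\in E$; if $u$ is a continuous inverse limit action, so are $\alpha^u$ and $\beta^u$. *)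

(* Defs.v *)
From HB Require Import structures.
From mathcomp Require Import all_boot all_order all_algebra.
From mathcomp Require Import complex.
From mathcomp Require Import all_classical all_reals all_analysis.
Import Order.TTheory GRing.Theory Num.Theory.
Import numFieldNormedType.Exports.

Set Implicit Arguments.
Unset Strict Implicit.
Unset Printing Implicit Defensive.

Local Open Scope classical_set_scope.
Local Open Scope ring_scope.
Local Open Scope complex_scope.

HB.mixin Record Group_isTopGroup G of Group G & Topological G := {
  gmul_continuous : continuous (fun gh : G * G => (gh.1 * gh.2)%g);
  ginv_continuous : continuous (fun g : G => (g^-1)%g)
}.

#[short(type="topGroupType")]
HB.structure Definition TopGroup :=
  {G of Group_isTopGroup G & Group G & Topological G}.

Definition locally_compact_group (G : topGroupType) : Prop :=
  hausdorff_space G /\ locally_compact [set: G].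

Definition linear_span (K : nzRingType) (V : lmodType K) (X : set V) : set V :=
  [set x | exists (n : nat) (c : 'I_n -> K) (v : 'I_n -> V),
     (forall i, X (v i)) /\ x = \sum_(i < n) c i *: v i].

Definition add_cauchy (K : numDomainType) (V : preTopologicalLmodType K)
    (F : set_system V) : Prop :=
  forall U : set V, nbhs 0 U ->
    exists2 M : set V, F M & forall x y, M x -> M y -> U (x - y).

Definition add_complete (K : numDomainType) (V : preTopologicalLmodType K) :=
  forall F : set_system V, ProperFilter F -> add_cauchy F ->
    exists x : V, F --> x.

HB.mixin Record isStarAlgebra (R : realType) A of GRing.Lmodule R[i] A := {
  smul : A -> A -> A;
  star : A -> A;
  smulA : associative smul;
  smulDl : left_distributive smul +%R;
  smulDr : right_distributive smul +%R;
  smulZl : forall (c : R[i]) a b, smul (c *: a) b = c *: smul a b;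
  smulZr : forall (c : R[i]) a b, smul a (c *: b) = c *: smul a b;
  starK : involutive star;
  starD : {morph star : a b / a + b};
  starZ : forall (c : R[i]) a, star (c *: a) = c^* *: star a;
  starM : forall a b, star (smul a b) = smul (star b) (star a)
}.

#[short(type="starAlgType")]
HB.structure Definition StarAlgebra (R : realType) :=
  {A of isStarAlgebra R A & GRing.Lmodule R[i] A}.

(* No compatibility between the topology and the operations is required here:
   this is the signature shared by locally C*-algebras and the algebras L(E).
   Algebras need not have a unit. *)
#[short(type="topStarAlgType")]
HB.structure Definition TopStarAlgebra (R : realType) :=
  {A of StarAlgebra R A & PreTopologicalLmodule R[i] A}.

(* The set S(A) *)
Definition csn (R : realType) (A : topStarAlgType R) : set (A -> R) :=
  [set p | [/\ forall a b : A, p (a + b) <= p a + p b,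
               forall (c : R[i]) (a : A), p (c *: a) = Normc.normc c * p a,
               forall a b : A, p (smul a b) <= p a * p b,
               forall a : A, p (smul (star a) a) = p a ^+ 2 &
               continuous p]].

Arguments csn {R} A.

HB.mixin Record isLocCstar (R : realType) A
    of TopStarAlgebra R A & TopologicalLmodule R[i] A := {
  smul_continuous : continuous (fun ab : A * A => smul ab.1 ab.2);
  star_continuous : continuous (star : A -> A);
  lc_hausdorff : hausdorff_space A;
  lc_complete : add_complete A;
  lc_cvg0 : forall F : set_system A, Filter F ->
    (F --> (0 : A) <-> forall p : A -> R, csn A p -> p @ F --> (0 : R))
}.

#[short(type="locCstarType")]
HB.structure Definition LocCstar (R : realType) :=
  {A of isLocCstar R A & TopStarAlgebra R A & TopologicalLmodule R[i] A}.

(* A C*-algebra is a locally C*-algebra whose topology is given by a single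
   C*-norm. *)
Definition is_cstar (R : realType) (A : locCstarType R) : Prop :=
  exists n : A -> R, [/\ csn A n, forall a, n a = 0 -> a = 0 &
    forall F : set_system A, Filter F ->
      (F --> (0 : A) <-> n @ F --> (0 : R))].

(* a >= 0 *)
Definition spos (R : realType) (A : starAlgType R) (a : A) : Prop :=
  exists b : A, a = smul (star b) b.

HB.mixin Record isIpModule (R : realType) (A : locCstarType R) E
    of GRing.Lmodule R[i] E := {
  ract : E -> A -> E;
  inner : E -> E -> A;
  ractDl : forall x y a, ract (x + y) a = ract x a + ract y a;
  ractDr : forall x a b, ract x (a + b) = ract x a + ract x b;
  ractZl : forall (c : R[i]) x a, ract (c *: x) a = c *: ract x a;
  ractZr : forall (c : R[i]) x a, ract x (c *: a) = c *: ract x a;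
  ractA : forall x a b, ract (ract x a) b = ract x (smul a b);
  innerDr : forall x y z, inner x (y + z) = inner x y + inner x z;
  innerZr : forall (c : R[i]) x y, inner x (c *: y) = c *: inner x y;
  innerMr : forall x y a, inner x (ract y a) = smul (inner x y) a;
  innerC : forall x y, star (inner x y) = inner y x
}.

#[short(type="ipModType")]
HB.structure Definition IpModule (R : realType) (A : locCstarType R) :=
  {E of isIpModule R A E & GRing.Lmodule R[i] E}.

Definition pbar (R : realType) (A : locCstarType R) (E : ipModType A)
  (p : A -> R) (x : E) : R := Num.sqrt (p (inner x x)).

(* E with the topology given by the seminorms pbar p, p in S(A) *)
Definition ip_top (R : realType) (A : locCstarType R) (E : ipModType A) : Type :=
  E.

Section IpTop.
Context (R : realType) (A : locCstarType R) (E : ipModType A).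

HB.instance Definition _ := GRing.Lmodule.on (ip_top E).
HB.instance Definition _ := @isSubBaseTopological.Build (ip_top E)
  (set (ip_top E))
  [set U | exists (p : A -> R) (x : E) (e : R),
     [/\ csn A p, 0 < e & U = [set y : E | pbar p (y - x) < e]]]
  id.

End IpTop.

HB.mixin Record isHilbertModule (R : realType) (A : locCstarType R) E
    of IpModule R A E := {
  inner_pos : forall x : E, spos (inner x x);
  inner_eq0 : forall x : E, inner x x = 0 -> x = 0;
  hilbert_complete : add_complete (ip_top E)
}.

#[short(type="hilbModType")]
HB.structure Definition HilbertModule (R : realType) (A : locCstarType R) :=
  {E of isHilbertModule R A E & IpModule R A E}.

Definition full_module (R : realType) (A : locCstarType R) (E : ipModType A) :=
  closure (linear_span [set inner xy.1 xy.2 | xy in [set: E * E]]) = [set: A].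

Definition module_map (R : realType) (A : locCstarType R) (E : ipModType A)
    (f : E -> E) : Prop :=
  [/\ forall x y, f (x + y) = f x + f y,
      forall (c : R[i]) x, f (c *: x) = c *: f x &
      forall x (a : A), f (ract x a) = ract (f x) a].

(* An adjointable operator is stored with its adjoint, which is determined by
   the operator whenever the inner product is nondegenerate: see adjointable_eq
   and dsum_nondegenerate below. *)
Record adjointable (R : realType) (A : locCstarType R) (E : ipModType A) :=
  Adjointable {
    adj_fun :> E -> E;
    adj_star : E -> E;
    adj_fun_map : module_map adj_fun;
    adj_star_map : module_map adj_star;
    adjP : forall x y, inner (adj_fun x) y = inner x (adj_star y)
  }.

Section IpTheory.
Context (R : realType) (A : locCstarType R).
Implicit Types E : ipModType A.

Lemma star0 : star (0 : A) = 0.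
Proof. by rewrite -(scale0r (0 : A)) starZ rmorph0 !scale0r. Qed.

Lemma innerDl E (x y z : E) : inner (x + y) z = inner x z + inner y z.
Proof. by rewrite -innerC innerDr starD !innerC. Qed.

Lemma innerZl E (c : R[i]) (x y : E) : inner (c *: x) y = c^* *: inner x y.
Proof. by rewrite -innerC innerZr starZ innerC. Qed.

Lemma innerMl E (x y : E) (a : A) :
  inner (ract x a) y = smul (star a) (inner x y).
Proof. by rewrite -innerC innerMr starM innerC. Qed.

Lemma inner0l E (x : E) : inner 0 x = 0.
Proof. by rewrite -(scale0r (0 : E)) innerZl rmorph0 !scale0r. Qed.

Lemma inner0r E (x : E) : inner x 0 = 0.
Proof. by rewrite -(scale0r (0 : E)) innerZr scale0r. Qed.

Lemma adjPr E (T : adjointable E) x y : inner (adj_star T x) y = inner x (T y).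
Proof. by rewrite -innerC -adjP innerC. Qed.

Lemma adjointable_ext E (S T : adjointable E) :
  adj_fun S =1 adj_fun T -> adj_star S =1 adj_star T -> S = T.
Proof.
case: S T => [f f' mf mf' ff'] [g g' mg mg' gg'] /= /funext fg /funext fg'.
by rewrite -fg -fg' in mg mg' gg' *; congr Adjointable; exact: Prop_irrelevance.
Qed.

Lemma adjointable_eq E : (forall x : E, (forall y, inner x y = 0) -> x = 0) ->
  forall S T : adjointable E, adj_fun S =1 adj_fun T -> S = T.
Proof.
move=> nd S T ST; apply: adjointable_ext => // x; apply/eqP.
rewrite -subr_eq0; apply/eqP/nd => y.
by rewrite innerDl -scaleN1r innerZl rmorphN rmorph1 scaleN1r !adjPr ST subrr.
Qed.

End IpTheory.

Section AdjointableAlgebra.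
Context (R : realType) (A : locCstarType R) (E : ipModType A).
Local Notation L := (adjointable E).
Implicit Types S T : L.

HB.instance Definition _ := gen_eqMixin L.
HB.instance Definition _ := gen_choiceMixin L.

Lemma module_map0 : module_map (fun _ : E => 0).
Proof.
split=> [x y|c x|x a]; rewrite ?addr0 ?scaler0//.
by rewrite -(scale0r (0 : E)) ractZl !scale0r.
Qed.

Lemma module_mapD (f g : E -> E) :
  module_map f -> module_map g -> module_map (fun x => f x + g x).
Proof.
move=> [fD fZ fM] [gD gZ gM]; split=> [x y|c x|x a].
- by rewrite fD gD addrACA.
- by rewrite fZ gZ scalerDr.
- by rewrite fM gM ractDl.
Qed.

Lemma module_mapZ (c : R[i]) (f : E -> E) :
  module_map f -> module_map (fun x => c *: f x).
Proof.
move=> [fD fZ fM]; split=> [x y|d x|x a].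
- by rewrite fD scalerDr.
- by rewrite fZ !scalerA mulrC.
- by rewrite fM ractZl.
Qed.

Lemma module_map_comp (f g : E -> E) :
  module_map f -> module_map g -> module_map (fun x => f (g x)).
Proof.
move=> [fD fZ fM] [gD gZ gM].
by split=> [x y|c x|x a]; rewrite ?gD ?gZ ?gM ?fD ?fZ ?fM.
Qed.

Lemma adj0P (x y : E) : inner 0 y = inner x 0.
Proof. by rewrite inner0l inner0r. Qed.

Definition adj0 : L := Adjointable module_map0 module_map0 adj0P.

Lemma adjDP S T (x y : E) :
  inner (S x + T x) y = inner x (adj_star S y + adj_star T y).
Proof. by rewrite innerDl innerDr !adjP. Qed.

Definition adjD S T : L := Adjointable
  (module_mapD (adj_fun_map S) (adj_fun_map T))
  (module_mapD (adj_star_map S) (adj_star_map T)) (adjDP S T).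

Lemma adjZP (c : R[i]) T (x y : E) :
  inner (c *: T x) y = inner x (c^* *: adj_star T y).
Proof. by rewrite innerZl innerZr adjP. Qed.

Definition adjZ (c : R[i]) T : L := Adjointable
  (module_mapZ c (adj_fun_map T)) (module_mapZ c^* (adj_star_map T))
  (adjZP c T).

Lemma adjMP S T (x y : E) :
  inner (S (T x)) y = inner x (adj_star T (adj_star S y)).
Proof. by rewrite !adjP. Qed.

Definition adjM S T : L := Adjointable
  (module_map_comp (adj_fun_map S) (adj_fun_map T))
  (module_map_comp (adj_star_map T) (adj_star_map S)) (adjMP S T).

Definition adjS T : L :=
  Adjointable (adj_star_map T) (adj_fun_map T) (adjPr T).

Definition adjN T : L := adjZ (-1) T.

Lemma adjDA : associative adjD.
Proof. by move=> S T U; apply: adjointable_ext => x /=; rewrite addrA. Qed.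
Lemma adjDC : commutative adjD.
Proof. by move=> S T; apply: adjointable_ext => x /=; rewrite addrC. Qed.
Lemma adj0D : left_id adj0 adjD.
Proof. by move=> T; apply: adjointable_ext => x /=; rewrite add0r. Qed.
Lemma adjND : left_inverse adj0 adjN adjD.
Proof.
by move=> T; apply: adjointable_ext => x;
  cbn [adjD adjN adjZ adj0 adj_fun adj_star];
  rewrite ?(rmorphN, rmorph1) scaleN1r addNr.
Qed.

HB.instance Definition _ := GRing.isZmodule.Build L adjDA adjDC adj0D adjND.

Lemma adjZA (c d : R[i]) T : adjZ c (adjZ d T) = adjZ (c * d) T.
Proof.
by apply: adjointable_ext => x; cbn [adjZ adj_fun adj_star];
  rewrite scalerA ?rmorphM.
Qed.
Lemma adjZ1 : left_id (1 : R[i]) adjZ.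
Proof.
by move=> T; apply: adjointable_ext => x; cbn [adjZ adj_fun adj_star];
  rewrite ?rmorph1 scale1r.
Qed.
Lemma adjZDr : right_distributive adjZ +%R.
Proof.
by move=> c S T; apply: adjointable_ext => x; cbn [adjZ adj_fun adj_star];
  rewrite scalerDr.
Qed.
Lemma adjZDl T : {morph adjZ^~ T : c d / c + d}.
Proof.
by move=> c d; apply: adjointable_ext => x; cbn [adjZ adj_fun adj_star];
  rewrite ?rmorphD scalerDl.
Qed.

HB.instance Definition _ :=
  GRing.Zmodule_isLmodule.Build R[i] L adjZA adjZ1 adjZDr adjZDl.

Lemma adjMA : associative adjM.
Proof. by move=> S T U; apply: adjointable_ext. Qed.
Lemma adjMDl : left_distributive adjM +%R.
Proof.
move=> S T U; apply: adjointable_ext => x //=.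
by have [-> _ _] := adj_star_map U.
Qed.
Lemma adjMDr : right_distributive adjM +%R.
Proof.
move=> S T U; apply: adjointable_ext => x //=.
by have [-> _ _] := adj_fun_map S.
Qed.
Lemma adjMZl (c : R[i]) S T : adjM (c *: S) T = c *: adjM S T.
Proof.
by apply: adjointable_ext => x //=; have [_ -> _] := adj_star_map T.
Qed.
Lemma adjMZr (c : R[i]) S T : adjM S (c *: T) = c *: adjM S T.
Proof.
by apply: adjointable_ext => x //=; have [_ -> _] := adj_fun_map S.
Qed.
Lemma adjSK : involutive adjS.
Proof. by move=> T; apply: adjointable_ext. Qed.
Lemma adjSD : {morph adjS : S T / S + T}.
Proof. by move=> S T; apply: adjointable_ext. Qed.
Lemma adjSZ (c : R[i]) T : adjS (c *: T) = c^* *: adjS T.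
Proof. by apply: adjointable_ext => x //=; rewrite conjcK. Qed.
Lemma adjSM S T : adjS (adjM S T) = adjM (adjS T) (adjS S).
Proof. exact: adjointable_ext. Qed.

HB.instance Definition _ := isStarAlgebra.Build R L
  adjMA adjMDl adjMDr adjMZl adjMZr adjSK adjSD adjSZ adjSM.

(* The operator norm of the map induced by T on E_p = E / ker (pbar p), whose
   norm is the one induced by pbar p. It is finite when E is a Hilbert module,
   adjointable operators being bounded. *)
Definition ptilde (p : A -> R) (T : L) : \bar R :=
  ereal_sup [set (pbar p (T x))%:E | x in [set x : E | pbar p x <= 1]].

HB.instance Definition _ := @isSubBaseTopological.Build L (set L)
  [set U | exists (p : A -> R) (T : L) (e : R),
     [/\ csn A p, 0 < e & U = [set S : L | (ptilde p (S - T)%R < e%:E)%E]]]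
  id.

End AdjointableAlgebra.

Section Compacts.
Context (R : realType) (A : locCstarType R) (E : ipModType A).

Lemma theta_map (y x : E) : module_map (fun z => ract y (inner x z)).
Proof.
split=> [z t|c z|z a].
- by rewrite innerDr ractDr.
- by rewrite innerZr ractZr.
- by rewrite innerMr ractA.
Qed.

Lemma thetaP (y x z t : E) :
  inner (ract y (inner x z)) t = inner z (ract x (inner y t)).
Proof. by rewrite innerMl innerMr innerC. Qed.

Definition theta (y x : E) : adjointable E :=
  Adjointable (theta_map y x) (theta_map x y) (thetaP y x).

(* The ideal K(E) *)
Definition compacts : set (adjointable E) :=
  closure (linear_span [set theta yx.1 yx.2 | yx in [set: E * E]]).

End Compacts.

Definition dsum (R : realType) (A : locCstarType R) (E : ipModType A) : Type :=
  (A * E)%type.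

Section DirectSum.
Context (R : realType) (A : locCstarType R) (E : ipModType A).

HB.instance Definition _ := GRing.Lmodule.copy (dsum E) (A * E)%type.

Definition dsum_ract (x : dsum E) (a : A) : dsum E :=
  (smul x.1 a, ract x.2 a).
Definition dsum_inner (x y : dsum E) : A :=
  smul (star x.1) y.1 + inner x.2 y.2.

Lemma dsum_eq (x y : dsum E) : x.1 = y.1 -> x.2 = y.2 -> x = y.
Proof. by case: x y => [a x] [b y] /= -> ->. Qed.

Lemma dsum_ractDl (x y : dsum E) a :
  dsum_ract (x + y) a = dsum_ract x a + dsum_ract y a.
Proof. by apply: dsum_eq; rewrite /= ?smulDl ?ractDl. Qed.
Lemma dsum_ractDr (x : dsum E) a b :
  dsum_ract x (a + b) = dsum_ract x a + dsum_ract x b.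
Proof. by apply: dsum_eq; rewrite /= ?smulDr ?ractDr. Qed.
Lemma dsum_ractZl (c : R[i]) (x : dsum E) a :
  dsum_ract (c *: x) a = c *: dsum_ract x a.
Proof. by apply: dsum_eq; rewrite /= ?smulZl ?ractZl. Qed.
Lemma dsum_ractZr (c : R[i]) (x : dsum E) a :
  dsum_ract x (c *: a) = c *: dsum_ract x a.
Proof. by apply: dsum_eq; rewrite /= ?smulZr ?ractZr. Qed.
Lemma dsum_ractA (x : dsum E) a b :
  dsum_ract (dsum_ract x a) b = dsum_ract x (smul a b).
Proof. by apply: dsum_eq; rewrite /= ?smulA ?ractA. Qed.
Lemma dsum_innerDr (x y z : dsum E) :
  dsum_inner x (y + z) = dsum_inner x y + dsum_inner x z.
Proof. by rewrite /dsum_inner /= smulDr innerDr addrACA. Qed.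
Lemma dsum_innerZr (c : R[i]) (x y : dsum E) :
  dsum_inner x (c *: y) = c *: dsum_inner x y.
Proof. by rewrite /dsum_inner /= smulZr innerZr scalerDr. Qed.
Lemma dsum_innerMr (x y : dsum E) a :
  dsum_inner x (dsum_ract y a) = smul (dsum_inner x y) a.
Proof. by rewrite /dsum_inner /= smulA innerMr smulDl. Qed.
Lemma dsum_innerC (x y : dsum E) : star (dsum_inner x y) = dsum_inner y x.
Proof. by rewrite /dsum_inner starD starM starK innerC. Qed.

HB.instance Definition _ := isIpModule.Build R A (dsum E)
  dsum_ractDl dsum_ractDr dsum_ractZl dsum_ractZr dsum_ractA
  dsum_innerDr dsum_innerZr dsum_innerMr dsum_innerC.

End DirectSum.

Lemma csn_eq0 (R : realType) (A : locCstarType R) (a : A) :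
  (forall p : A -> R, csn A p -> p a = 0) -> a = 0.
Proof.
move=> pa0; apply/esym/(@lc_hausdorff R A).
have a0 : principal_filter a --> (0 : A).
  apply/lc_cvg0 => p csnp; rewrite -(pa0 p csnp) => U Ua.
  by apply/principal_filterP; exact: nbhs_singleton Ua.
move=> U V U0 Va; exists a.
split; last exact: nbhs_singleton Va.
exact: (proj1 (principal_filterP a U) (a0 U U0)).
Qed.

Lemma dsum_nondegenerate (R : realType) (A : locCstarType R)
    (E : hilbModType A) (x : dsum E) : (forall y, inner x y = 0) -> x = 0.
Proof.
case: x => a x x0.
have mul0 (b : A) : smul b 0 = 0.
  by have := smulZr (0 : R[i]) b 0; rewrite !scale0r.
apply: dsum_eq => /=.
- apply: csn_eq0 => p [_ pZ _ pC _].
  apply/eqP; rewrite -sqrf_eq0 -pC.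
  have := x0 (a, 0); rewrite /inner /= /dsum_inner /= inner0r addr0 => ->.
  by have := pZ 0 0; rewrite scale0r => ->; rewrite Normc.normc0 mul0r.
- apply: inner_eq0.
  by have := x0 (0, x); rewrite /inner /= /dsum_inner /= mul0 add0r.
Qed.

Section Linking.
Context (R : realType) (A : locCstarType R) (E : ipModType A).

Definition link_fun (a : A) (x y : E) (T : E -> E) (z : dsum E) : dsum E :=
  (smul a z.1 + inner x z.2, ract y z.1 + T z.2).

Lemma link_map (a : A) (x y : E) (T : E -> E) :
  module_map T -> module_map (link_fun a x y T).
Proof.
move=> [TD TZ TM]; split=> [z t|c z|z b].
- by apply: dsum_eq; rewrite /= ?smulDr ?innerDr ?ractDr ?TD addrACA.
- by apply: dsum_eq; rewrite /= ?smulZr ?innerZr ?ractZr ?TZ scalerDr.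
- by apply: dsum_eq; rewrite /= ?innerMr ?smulA ?smulDl ?TM ?ractDl ?ractA.
Qed.

Lemma linkP (a : A) (x y : E) (T : adjointable E) (z t : dsum E) :
  inner (link_fun a x y T z) t
  = inner z (link_fun (star a) y x (adj_star T) t).
Proof.
rewrite /inner /= /dsum_inner /= starD starM innerC !smulDl !smulDr.
by rewrite innerDl innerDr innerMl innerMr adjP !smulA addrACA.
Qed.

(* L_{a, xi, eta, T} *)
Definition linkop (a : A) (x y : E) (T : adjointable E) :
    adjointable (dsum E) :=
  Adjointable (link_map a x y (adj_fun_map T))
    (link_map (star a) y x (adj_star_map T)) (linkP a x y T).

Definition closed_star_subalgebra (B : topStarAlgType R) (D : set B) : Prop :=
  [/\ closed D,
      D 0,
      forall a b, D a -> D b -> D (a + b),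
      forall (c : R[i]) a, D a -> D (c *: a) &
      (forall a b, D a -> D b -> D (smul a b)) /\
      (forall a, D a -> D (star a))].

Definition linking : set (adjointable (dsum E)) :=
  smallest (@closed_star_subalgebra (adjointable (dsum E)))
    [set S | exists (a : A) (x y : E) (T : adjointable E),
       compacts T /\ S = linkop a x y T].

End Linking.

(* K(E) and the linking algebra are subsets D of the ambient algebra L(E) or
   L(A (+) E); maps between such subalgebras are represented by maps between
   the ambient algebras, of which only the restriction to D matters. For A
   itself D is [set: A]. *)
Definition lc_morphism (R : realType) (B B' : topStarAlgType R)
    (D : set B) (D' : set B') (f : B -> B') : Prop :=
  [/\ forall a, D a -> D' (f a),
      forall a b, D a -> D b -> f (a + b) = f a + f b,
      forall (c : R[i]) a, D a -> f (c *: a) = c *: f a,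
      forall a b, D a -> D b -> f (smul a b) = smul (f a) (f b) &
      (forall a, D a -> f (star a) = star (f a)) /\
      {within D, continuous f}].

Definition lc_isomorphism (R : realType) (B B' : topStarAlgType R)
    (D : set B) (D' : set B') (f : B -> B') : Prop :=
  lc_morphism D D' f /\
  exists h : B' -> B, [/\ lc_morphism D' D h,
    forall a, D a -> h (f a) = a & forall b, D' b -> f (h b) = b].

Definition mod_morphism (R : realType) (A B : locCstarType R)
    (E : hilbModType A) (F : hilbModType B) (u : E -> F) : Prop :=
  exists alpha : A -> B, lc_morphism [set: A] [set: B] alpha /\
    forall x y, inner (u x) (u y) = alpha (inner x y).

Definition mod_isomorphism (R : realType) (A B : locCstarType R)
    (E : hilbModType A) (F : hilbModType B) (u : E -> F) : Prop :=
  mod_morphism u /\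
  exists v : F -> E, [/\ mod_morphism v, cancel u v & cancel v u].

Section Actions.
Context (R : realType) (G : topGroupType).

Definition alg_action (B : topStarAlgType R) (D : set B) (alpha : G -> B -> B) :=
  (forall g, lc_isomorphism D D (alpha g)) /\
  (forall g h a, D a -> alpha (g * h)%g a = alpha g (alpha h a)).

Definition continuous_alg_action (B : topStarAlgType R) (D : set B)
    (alpha : G -> B -> B) :=
  alg_action D alpha /\
  {within [set: G] `*` D, continuous (fun ga : G * B => alpha ga.1 ga.2)}.

Definition mod_action (A : locCstarType R) (E : hilbModType A)
    (u : G -> E -> E) :=
  (forall g, mod_isomorphism (u g)) /\
  (forall g h x, u (g * h)%g x = u g (u h x)).

Definition continuous_mod_action (A : locCstarType R) (E : hilbModType A)
    (u : G -> E -> E) :=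
  mod_action u /\
  continuous (fun gx : G * ip_top E => u gx.1 gx.2 : ip_top E).

(* alpha is the action alpha^u; it is unique because E is full. *)
Definition induced_on_alg (A : locCstarType R) (E : hilbModType A)
    (u : G -> E -> E) (alpha : G -> A -> A) :=
  alg_action [set: A] alpha /\
  forall g (x y : E), alpha g (inner x y) = inner (u g x) (u g y).

(* beta is the action beta^u; it is unique on K(E), being continuous there. *)
Definition induced_on_compacts (A : locCstarType R) (E : hilbModType A)
    (u : G -> E -> E) (beta : G -> adjointable E -> adjointable E) :=
  alg_action (@compacts R A E) beta /\
  forall g (x y : E), beta g (theta x y) = theta (u g x) (u g y).

End Actions.

Definition directed_preorder (I : Type) (le : I -> I -> Prop) : Prop :=
  [/\ inhabited I, forall i, le i i,
      forall i j k, le i j -> le j k -> le i k &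
      forall i j, exists k, le i k /\ le j k].

Unset Implicit Arguments.

(* The connecting map sys_map l m goes from the algebra of index l to the one of
   index m; it is only meaningful when m <= l. *)
Record inv_system (R : realType) := InvSystem {
  sys_idx : Type;
  sys_le : sys_idx -> sys_idx -> Prop;
  sys_alg : sys_idx -> locCstarType R;
  sys_map : forall l m, sys_alg l -> sys_alg m;
  sys_directed : directed_preorder sys_le;
  sys_cstar : forall l, is_cstar (sys_alg l);
  sys_morph : forall l m, sys_le m l ->
    lc_morphism [set: sys_alg l] [set: sys_alg m] (sys_map l m);
  sys_id : forall l a, sys_map l l a = a;
  sys_comp : forall l m n a, sys_le m l -> sys_le n m ->
    sys_map m n (sys_map l m a) = sys_map l n a
}.

Arguments sys_idx {R}.
Arguments sys_le {R i}.
Arguments sys_alg {R i}.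
Arguments sys_map {R i}.

Record mod_inv_system (R : realType) := ModInvSystem {
  msys_sys :> inv_system R;
  msys_mod : forall l : sys_idx msys_sys, hilbModType (sys_alg l);
  msys_map : forall l m, msys_mod l -> msys_mod m;
  msys_ract : forall l m (x : msys_mod l) a, sys_le m l ->
    msys_map l m (ract x a) = ract (msys_map l m x) (sys_map l m a);
  msys_inner : forall l m (x y : msys_mod l), sys_le m l ->
    inner (msys_map l m x) (msys_map l m y) = sys_map l m (inner x y);
  msys_id : forall l x, msys_map l l x = x;
  msys_comp : forall l m n x, sys_le m l -> sys_le n m ->
    msys_map m n (msys_map l m x) = msys_map l n x
}.

Arguments msys_mod {R m0}.
Arguments msys_map {R m0}.

Set Implicit Arguments.

(* The maps chi l are compatible *-morphisms that exhibit D, as a topological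
   *-algebra, as the inverse limit of the system: the induced map from D to the
   algebra of threads is a bijection, and the topology of D is the initial one,
   i.e. the one pulled back from the product topology. *)
Definition is_alg_limit (R : realType) (S : inv_system R)
    (B : topStarAlgType R) (D : set B)
    (chi : forall l : sys_idx S, B -> sys_alg l) : Prop :=
  [/\ forall l, lc_morphism D [set: sys_alg l] (chi l),
      forall l m a, sys_le m l -> D a -> sys_map l m (chi l a) = chi m a,
      forall a b, D a -> D b -> (forall l, chi l a = chi l b) -> a = b,
      forall t : forall l, sys_alg l,
        (forall l m, sys_le m l -> sys_map l m (t l) = t m) ->
        exists2 a, D a & forall l, chi l a = t l &
      forall (F : set_system B) a, Filter F -> F D -> D a ->
        (forall l, chi l @ F --> chi l a) -> F --> a].

(* E is the inverse limit of the Hilbert modules of the system, over the algebra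
   A which is the inverse limit of the C*-algebras. The topologies need not be
   mentioned for E: they are given by those of the algebras. *)
Definition is_mod_limit (R : realType) (S : mod_inv_system R)
    (A : locCstarType R) (E : hilbModType A)
    (chi : forall l : sys_idx S, A -> sys_alg l)
    (sigma : forall l : sys_idx S, E -> msys_mod l) : Prop :=
  [/\ is_alg_limit [set: A] chi,
      (forall l x a, sigma l (ract x a) = ract (sigma l x) (chi l a)) /\
      (forall l x y, inner (sigma l x) (sigma l y) = chi l (inner x y)),
      forall l m x, sys_le m l -> msys_map l m (sigma l x) = sigma m x,
      forall x y, (forall l, sigma l x = sigma l y) -> x = y &
      forall t : forall l, msys_mod l,
        (forall l m, sys_le m l -> msys_map l m (t l) = t m) ->
        exists x, forall l, sigma l x = t l].

Section InverseLimitActions.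
Context (R : realType) (G : topGroupType).

Definition inverse_limit_alg_action (B : topStarAlgType R) (D : set B)
    (alpha : G -> B -> B) : Prop :=
  continuous_alg_action D alpha /\
  exists (S : inv_system R) (chi : forall l : sys_idx S, B -> sys_alg l)
         (alphal : forall l : sys_idx S, G -> sys_alg l -> sys_alg l),
    [/\ is_alg_limit D chi,
        forall l, alg_action [set: sys_alg l] (alphal l),
        forall l m g a, sys_le m l ->
          sys_map l m (alphal l g a) = alphal m g (sys_map l m a) &
        forall l g a, D a -> chi l (alpha g a) = alphal l g (chi l a)].

Definition inverse_limit_mod_action (A : locCstarType R) (E : hilbModType A)
    (u : G -> E -> E) : Prop :=
  mod_action u /\
  exists (S : mod_inv_system R) (chi : forall l : sys_idx S, A -> sys_alg l)
         (sigma : forall l : sys_idx S, E -> msys_mod l)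
         (ul : forall l : sys_idx S, G -> msys_mod l -> msys_mod l),
    [/\ is_mod_limit chi sigma,
        forall l, mod_action (ul l),
        forall l m g x, sys_le m l ->
          msys_map l m (ul l g x) = ul m g (msys_map l m x) &
        forall l g x, sigma l (u g x) = ul l g (sigma l x)].

End InverseLimitActions.

(* Main.v *)
Require Import Defs.
From HB Require Import structures.
From mathcomp Require Import all_boot all_order all_algebra.
From mathcomp Require Import complex.
From mathcomp Require Import all_classical all_reals all_analysis.
From mathcomp Require Import ring lra.
Import Order.TTheory GRing.Theory Num.Theory.
Import numFieldNormedType.Exports.

(** An automorphism [u g] of the full module [E] is twisted by an automorphism
   [twist g] of [A], which fullness makes unique, so that the twists form an
   action. Together they give the automorphism [twist g (+) u g] of [A (+) E],
   and the three induced actions are: the twist on [A], conjugation by [u g]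
   on [K(E)], and conjugation by [twist g (+) u g] on the linking algebra.
   Conjugation exchanges the seminorm of [L(E)] attached to [p] with the one
   attached to [p \o twist g] (ptilde_conj_op), hence is continuous; it maps
   generators to generators (conj_op_theta, conj_op_linkop), hence preserves
   [K(E)] and the linking algebra.

   Now let [u] be a continuous inverse limit action. The norms of the
   C*-algebras of the system pull back to C*-seminorms [q l] on [A], which are
   cofinal among all continuous ones and increase with [l]. They are invariant
   under the twists: on the module of level [l] the group acts by maps twisted
   by morphisms of C*-algebras, and these are contractive
   (level_seminorm_twist). So the group acts on [L(A (+) E)] by isometries for
   each of the operator seminorms attached to the [q l]. The operators whose
   orbit map is continuous therefore form a closed *-subalgebra; it contains
   the generators of the linking algebra, and isometry upgrades continuity of
   orbits to joint continuity (linking_orbit, continuous_orbit_joint).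

   To write the linking algebra as an inverse limit, take at level [l] its
   completion for the operator seminorm attached to [q l]. A coherent family
   of elements of these completions is approximated by a Cauchy filter of the
   linking algebra, which converges because [L(A (+) E)] is complete: limits
   of operators are taken pointwise, by completeness of [A] and [E]
   (operator_limit, link_thread, linking_limit). As the action is isometric at
   each level, it extends to the completions.

   All this rests on the Cauchy-Schwarz inequality for [A]-valued inner
   products (cauchy_schwarz), and thus on the theory of positive elements. By
   completing the unitization of [A] for a C*-seminorm the question is moved
   to a unital C*-algebra. There [h] is called positive when the norm of
   [t - h] is at most [t] for some [t >= 0]; sums of positive elements are
   then clearly positive, and squares of self-adjoint elements are by means of
   square roots, obtained by iteration (sqrt1B). That [a^* a] is positive
   (positive_star_square) is the classical argument with the negative part of
   [a^* a], where invertibility stands in for the spectrum. Rigidity of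
   C*-seminorms (cstar_seminorm_le), a consequence of the C*-identity applied
   to iterated squares, provides contractivity of morphisms and monotonicity
   in [p] of the operator seminorms. *)

Set Implicit Arguments.
Unset Strict Implicit.
Unset Printing Implicit Defensive.

Local Open Scope classical_set_scope.
Local Open Scope ring_scope.
Local Open Scope complex_scope.

(** * C*-seminorms on *-algebras *)

Section StarAlgebraTheory.
Context (R : realType) (A : starAlgType R).
Implicit Types a b c : A.

Lemma smul0l a : smul 0 a = 0.
Proof. by have := smulZl (0 : R[i]) 0 a; rewrite !scale0r. Qed.

Lemma smul0r a : smul a 0 = 0.
Proof. by have := smulZr (0 : R[i]) a 0; rewrite !scale0r. Qed.

Lemma smulNl a b : smul (- a) b = - smul a b.
Proof. by rewrite -scaleN1r smulZl scaleN1r. Qed.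

Lemma smulNr a b : smul a (- b) = - smul a b.
Proof. by rewrite -[- b]scaleN1r smulZr scaleN1r. Qed.

Lemma smulBl a b c : smul (a - b) c = smul a c - smul b c.
Proof. by rewrite smulDl smulNl. Qed.

Lemma smulBr a b c : smul a (b - c) = smul a b - smul a c.
Proof. by rewrite smulDr smulNr. Qed.

Lemma star_zero : star (0 : A) = 0.
Proof. by have := starZ (0 : R[i]) (0 : A); rewrite rmorph0 !scale0r. Qed.

Lemma starN a : star (- a) = - star a.
Proof. by rewrite -scaleN1r starZ rmorphN rmorph1 scaleN1r. Qed.

Lemma starB a b : star (a - b) = star a - star b.
Proof. by rewrite starD starN. Qed.

Lemma star_squareE a : star (smul (star a) a) = smul (star a) a.
Proof. by rewrite starM starK. Qed.

End StarAlgebraTheory.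

Section CstarSeminorm.
Context (R : realType).

Definition cstar_seminorm (A : starAlgType R) (p : A -> R) : Prop :=
  [/\ forall a b, p (a + b) <= p a + p b,
      forall (c : R[i]) a, p (c *: a) = Normc.normc c * p a,
      forall a b, p (smul a b) <= p a * p b &
      forall a, p (smul (star a) a) = p a ^+ 2].

Lemma csn_seminorm (A : topStarAlgType R) (p : A -> R) :
  csn A p -> cstar_seminorm p.
Proof. by case. Qed.

Lemma normc_real (x : R) : Normc.normc x%:C = `|x|.
Proof. by rewrite /Normc.normc /= expr0n addr0 sqrtr_sqr. Qed.

Context (A : starAlgType R) (p : A -> R) (hp : cstar_seminorm p).
Implicit Types a b c : A.

Lemma seminormD a b : p (a + b) <= p a + p b.
Proof. by case: hp. Qed.

Lemma seminormZ (c : R[i]) a : p (c *: a) = Normc.normc c * p a.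
Proof. by case: hp. Qed.

Lemma seminormM a b : p (smul a b) <= p a * p b.
Proof. by case: hp. Qed.

Lemma seminorm_star_square a : p (smul (star a) a) = p a ^+ 2.
Proof. by case: hp. Qed.

Lemma seminorm0 : p 0 = 0.
Proof. by rewrite -(scale0r (0 : A)) seminormZ Normc.normc0 mul0r. Qed.

Lemma seminormN a : p (- a) = p a.
Proof. by rewrite -scaleN1r seminormZ normcN Normc.normc1 mul1r. Qed.

Lemma seminormZr (r : R) a : p (r%:C *: a) = `|r| * p a.
Proof. by rewrite seminormZ normc_real. Qed.

Lemma seminorm_ge0 a : 0 <= p a.
Proof.
have := seminormD a (- a); rewrite subrr seminorm0 seminormN -mulr2n.
by rewrite pmulrn_lge0.
Qed.

Lemma seminormBC a b : p (a - b) = p (b - a).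
Proof. by rewrite -seminormN opprB. Qed.

Lemma seminorm_tri b a c : p (a - c) <= p (a - b) + p (b - c).
Proof. by have := seminormD (a - b) (b - c); rewrite addrA subrK. Qed.

Lemma seminorm_dist a b : `|p a - p b| <= p (a - b).
Proof.
rewrite ler_norml; apply/andP; split.
- have := seminormD (b - a) a; rewrite subrK seminormBC; lra.
- have := seminormD (a - b) b; rewrite subrK; lra.
Qed.

Lemma seminorm_star a : p (star a) = p a.
Proof.
suff le b : p b <= p (star b).
  by apply/le_anti; rewrite le andbT -{2}(starK a) le.
have [->|b0] := eqVneq (p b) 0; first exact: seminorm_ge0.
have b_gt0 : 0 < p b by rewrite lt_neqAle eq_sym b0 seminorm_ge0.
rewrite -(ler_pM2r b_gt0) -expr2 -seminorm_star_square.
exact: seminormM.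
Qed.

End CstarSeminorm.

Lemma normc_ge0 (R : realType) (c : R[i]) : 0 <= Normc.normc c.
Proof. by case: c => a b; exact: sqrtr_ge0. Qed.

(** The inequalities that remain to be proved for an operator norm: the
   reverse ones follow from the invertibility of nonzero scalars and from
   submultiplicativity, once the involution is known to be isometric. *)
Lemma cstar_seminormP (R : realType) (A : starAlgType R) (p : A -> R) :
  (forall a, 0 <= p a) ->
  (forall a b, p (a + b) <= p a + p b) ->
  (forall (c : R[i]) a, p (c *: a) <= Normc.normc c * p a) ->
  (forall a b, p (smul a b) <= p a * p b) ->
  (forall a, p a ^+ 2 <= p (smul (star a) a)) -> cstar_seminorm p.
Proof.
move=> p0 pD pZ pM pC; split=> // [c a|a].
  apply/le_anti; rewrite pZ/=.
  have [->|c0] := eqVneq c 0; first by rewrite Normc.normc0 mul0r.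
  have n0 : 0 < Normc.normc c.
    rewrite lt_neqAle eq_sym normc_ge0 andbT.
    by apply: contra c0 => /eqP/Normc.eq0_normc ->.
  have := pZ c^-1 (c *: a); rewrite scalerA mulVf// scale1r Normc.normcV.
  by rewrite mulrC ler_pdivlMr// mulrC.
apply/le_anti; rewrite pC andbT.
have le b : p b <= p (star b).
  have [->|b0] := eqVneq (p b) 0; first exact: p0.
  have b_gt0 : 0 < p b by rewrite lt_neqAle eq_sym b0 p0.
  by rewrite -(ler_pM2r b_gt0) -expr2 (le_trans (pC b)).
rewrite (le_trans (pM _ _))// expr2 ler_wpM2r//.
by rewrite -{2}(starK a) le.
Qed.

Section PowerTrick.
Context (R : realType).

(** Exponential growth absorbs any constant. *)
Lemma pow2_bound (C r M : R) : 0 <= r -> 0 <= M ->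
  (forall j : nat, r ^+ (2 ^ j) <= C * M ^+ (2 ^ j)) -> r <= M.
Proof.
move=> r0 M0 H; rewrite leNgt; apply/negP => Mr.
have r_gt0 : 0 < r by exact: le_lt_trans Mr.
pose q := M / r.
have q0 : 0 <= q by rewrite divr_ge0.
have q1 : q < 1 by rewrite ltr_pdivrMr// mul1r.
have Hq j : 1 <= C * q ^+ (2 ^ j).
  by rewrite expr_div_n mulrA ler_pdivlMr ?exprn_gt0// mul1r.
have cv : (fun n => C * q ^+ n) @ \oo --> (C * 0 : R).
  by apply: cvgMr; apply: cvg_expr; rewrite ger0_norm.
move: cv; rewrite mulr0 => /cvgrPdist_lt /(_ 1 ltr01) [N _ HN].
have N2 : (N <= 2 ^ N)%N by exact/ltnW/ltn_expl.
move: (Hq N) N2; move: (2 ^ N)%N => m Hm Nm; have := HN m Nm.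
by rewrite sub0r normrN => /(le_lt_trans (ler_norm _)); rewrite ltNge Hm.
Qed.

(** C*-seminorms are rigid: on a self-adjoint element [h] the C*-identity
   gives [p (h ^ 2 ^ j) = p h ^ 2 ^ j], so that a constant in front of [q]
   disappears in the limit. *)
Lemma cstar_seminorm_le (A : starAlgType R) (p q : A -> R) (C : R) :
  cstar_seminorm p -> cstar_seminorm q ->
  (forall a, p a <= C * q a) -> forall a, p a <= q a.
Proof.
move=> hp hq pq a.
have sq (h : A) (r : A -> R) : cstar_seminorm r -> star h = h ->
    r (smul h h) = r h ^+ 2.
  by move=> hr hh; rewrite -(seminorm_star_square hr) hh.
have sa (h : A) : star h = h -> p h <= q h.
  move=> hh; apply: (@pow2_bound C) => [||j].
  - exact: seminorm_ge0 hp _.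
  - exact: seminorm_ge0 hq _.
  pose w := iter j (fun x => smul x x) h.
  have [ws pw qw] : [/\ star w = w, p w = p h ^+ (2 ^ j)
      & q w = q h ^+ (2 ^ j)].
    rewrite /w; elim: j {w} => [|j [IHs IHp IHq]].
      by split; rewrite ?expr1.
    rewrite /= starM IHs; split=> //.
    - by rewrite (sq _ _ hp) // IHp -exprM expnSr.
    - by rewrite (sq _ _ hq) // IHq -exprM expnSr.
  by rewrite -pw -qw.
rewrite -(@ler_pXn2r _ 2) ?nnegrE ?(seminorm_ge0 hp) ?(seminorm_ge0 hq)//.
rewrite -(seminorm_star_square hp) -(seminorm_star_square hq).
exact/sa/star_squareE.
Qed.

(** Scaling turns the hypothesis on the ball of radius [d] into
   [p <= 2 / d * q], and rigidity removes the constant. *)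
Lemma cstar_seminorm_le_ball (A : starAlgType R) (p q : A -> R) (d : R) :
  cstar_seminorm p -> cstar_seminorm q -> 0 < d ->
  (forall a, q a < d -> p a <= 1) -> forall a, p a <= q a.
Proof.
move=> hp hq d0 pq.
apply: (@cstar_seminorm_le _ _ _ (2 / d)) => // a.
have qa0 := seminorm_ge0 hq a.
have [qa|qa] := eqVneq (q a) 0.
  rewrite qa mulr0 leNgt; apply/negP => pa.
  pose t := 2 / p a.
  have t0 : 0 < t by rewrite divr_gt0.
  have := pq (t%:C *: a); rewrite (seminormZr hq) (seminormZr hp) qa mulr0.
  move=> /(_ d0); rewrite gtr0_norm// /t divfK ?gt_eqF//.
  by rewrite leNgt ltr1n.
have q_gt0 : 0 < q a by rewrite lt_neqAle eq_sym qa.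
pose t := d / (2 * q a).
have t0 : 0 < t by rewrite divr_gt0// mulr_gt0.
have := pq (t%:C *: a); rewrite (seminormZr hq) (seminormZr hp).
rewrite gtr0_norm//.
have -> : t * q a = d / 2 by rewrite /t; field; rewrite gt_eqF.
rewrite ltr_pdivrMr// ltr_pMr// ltr1n => /(_ isT).
rewrite mulrC -ler_pdivlMr// mul1r /t invf_div => /le_trans; apply.
by rewrite mulrAC.
Qed.

End PowerTrick.

(** * Null and Cauchy sequences for a C*-seminorm *)

Section SeminormLimits.
Context (R : realType) (A : starAlgType R) (p : A -> R).
Implicit Types u v : nat -> A.

Definition null_seq u : Prop :=
  forall e : R, 0 < e -> exists N, forall i, (N <= i)%N -> p (u i) < e.

Definition tends u (l : A) : Prop := null_seq (fun i => u i - l).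

Definition cauchy_seq u : Prop :=
  forall e : R, 0 < e ->
    exists N, forall i j, (N <= i)%N -> (N <= j)%N -> p (u i - u j) < e.

Definition seq_complete : Prop :=
  forall u, cauchy_seq u -> exists l, tends u l.

Context (hp : cstar_seminorm p).

Lemma null_seq_le (B : starAlgType R) (q : B -> R) (M : R) u (v : nat -> B) :
  (forall i, q (v i) <= M * p (u i)) -> null_seq u ->
  forall e : R, 0 < e -> exists N, forall i, (N <= i)%N -> q (v i) < e.
Proof.
move=> vu u0 e e0.
have M0 : 0 < `|M| + 1 by rewrite ltr_wpDl.
have [N HN] := u0 (e / (`|M| + 1)) (divr_gt0 e0 M0).
exists N => i /HN; rewrite ltr_pdivlMr// mulrC => ue.
apply: le_lt_trans ue; rewrite (le_trans (vu i))//.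
rewrite ler_wpM2r ?(seminorm_ge0 hp)//.
by rewrite (le_trans (ler_norm _))// lerDl.
Qed.

Lemma null_seqD u v : null_seq u -> null_seq v ->
  null_seq (fun i => u i + v i).
Proof.
move=> u0 v0 e e0; have e2 : 0 < e / 2 by rewrite divr_gt0.
have [N HN] := u0 _ e2; have [M HM] := v0 _ e2.
exists (maxn N M) => i; rewrite geq_max => /andP[/HN ui /HM vi].
rewrite (le_lt_trans (seminormD hp _ _))//; lra.
Qed.

Lemma cauchy_bounded u : cauchy_seq u ->
  exists2 M : R, 0 < M & forall i, p (u i) <= M.
Proof.
move=> /(_ 1 ltr01) [N HN].
have s0 : 0 <= \sum_(i < N) p (u i).
  by apply: sumr_ge0 => i _; exact: seminorm_ge0.
exists (\sum_(i < N) p (u i) + p (u N) + 1) => [|i].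
  by rewrite ltr_wpDl// addr_ge0// (seminorm_ge0 hp).
have [iN|Ni] := ltnP i N.
  rewrite -addrA ler_wpDr ?addr_ge0 ?(seminorm_ge0 hp)//.
  rewrite (bigD1 (Ordinal iN))//= lerDl sumr_ge0// => j _.
  exact: seminorm_ge0.
have := seminormD hp (u i - u N) (u N); rewrite subrK.
have := HN _ _ Ni (leqnn N); lra.
Qed.

Lemma tends_cauchy u l : tends u l -> cauchy_seq u.
Proof.
move=> ul e e0; have e2 : 0 < e / 2 by rewrite divr_gt0.
have [N HN] := ul _ e2.
exists N => i j /HN ui /HN uj.
rewrite (le_lt_trans (seminorm_tri hp l _ _))//.
rewrite (seminormBC hp l); lra.
Qed.

Lemma cauchyD u v : cauchy_seq u -> cauchy_seq v ->
  cauchy_seq (fun i => u i + v i).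
Proof.
move=> u0 v0 e e0; have e2 : 0 < e / 2 by rewrite divr_gt0.
have [N HN] := u0 _ e2; have [M HM] := v0 _ e2.
exists (maxn N M) => i j; rewrite !geq_max => /andP[Ni Mi] /andP[Nj Mj].
rewrite opprD addrACA (le_lt_trans (seminormD hp _ _))//.
have := HN _ _ Ni Nj; have := HM _ _ Mi Mj; lra.
Qed.

Lemma cauchy_le (B : starAlgType R) (q : B -> R) (M : R) u (v : nat -> B) :
  (forall i j, q (v i - v j) <= M * p (u i - u j)) -> cauchy_seq u ->
  forall e : R, 0 < e -> exists N, forall i j,
    (N <= i)%N -> (N <= j)%N -> q (v i - v j) < e.
Proof.
move=> vu u0 e e0.
have M0 : 0 < `|M| + 1 by rewrite ltr_wpDl.
have [N HN] := u0 (e / (`|M| + 1)) (divr_gt0 e0 M0).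
exists N => i j Ni Nj; have := HN _ _ Ni Nj.
rewrite ltr_pdivlMr// mulrC => ue.
apply: le_lt_trans ue; rewrite (le_trans (vu i j))//.
rewrite ler_wpM2r ?(seminorm_ge0 hp)//.
by rewrite (le_trans (ler_norm _))// lerDl.
Qed.

Lemma cauchyZ (c : R[i]) u : cauchy_seq u -> cauchy_seq (fun i => c *: u i).
Proof.
apply: (cauchy_le (M := Normc.normc c)) => i j.
by rewrite -scalerBr (seminormZ hp).
Qed.

Lemma cauchyS u : cauchy_seq u -> cauchy_seq (fun i => star (u i)).
Proof.
by apply: (cauchy_le (M := 1)) => i j; rewrite -starB (seminorm_star hp) mul1r.
Qed.

Lemma cauchyM u v : cauchy_seq u -> cauchy_seq v ->
  cauchy_seq (fun i => smul (u i) (v i)).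
Proof.
move=> cu cv; have [M M0 uM] := cauchy_bounded cu.
have [K K0 vK] := cauchy_bounded cv.
move=> e e0; have e2 : 0 < e / 2 by rewrite divr_gt0.
have [N HN] := cu _ (divr_gt0 e2 K0); have [P HP] := cv _ (divr_gt0 e2 M0).
exists (maxn N P) => i j; rewrite !geq_max => /andP[Ni Pi] /andP[Nj Pj].
have -> : smul (u i) (v i) - smul (u j) (v j)
    = smul (u i - u j) (v i) + smul (u j) (v i - v j).
  by rewrite smulBl smulBr addrA subrK.
rewrite (le_lt_trans (seminormD hp _ _))//.
have H1 : p (smul (u i - u j) (v i)) < e / 2.
  rewrite (le_lt_trans (seminormM hp _ _))//.
  rewrite (le_lt_trans (ler_wpM2l (seminorm_ge0 hp _) (vK i)))//.
  by rewrite -ltr_pdivlMr// HN.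
have H2 : p (smul (u j) (v i - v j)) < e / 2.
  rewrite (le_lt_trans (seminormM hp _ _))//.
  rewrite (le_lt_trans (ler_wpM2r (seminorm_ge0 hp _) (uM j)))//.
  by rewrite mulrC -ltr_pdivlMr// HP.
lra.
Qed.

Lemma cauchy_cst (a : A) : cauchy_seq (fun=> a).
Proof. by move=> e e0; exists 0%N => i j _ _; rewrite subrr (seminorm0 hp). Qed.

Lemma null_bounded_mull u v : cauchy_seq u -> null_seq v ->
  null_seq (fun i => smul (u i) (v i)).
Proof.
move=> /cauchy_bounded[M M0 uM].
apply: (null_seq_le (M := M)) => i; rewrite (le_trans (seminormM hp _ _))//.
by rewrite ler_wpM2r// (seminorm_ge0 hp).
Qed.

Lemma null_bounded_mulr u v : null_seq u -> cauchy_seq v ->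
  null_seq (fun i => smul (u i) (v i)).
Proof.
move=> u0 /cauchy_bounded[M M0 vM]; move: u0.
apply: (null_seq_le (M := M)) => i; rewrite (le_trans (seminormM hp _ _))//.
by rewrite mulrC ler_wpM2r// (seminorm_ge0 hp).
Qed.

Lemma cauchy_norm_cvg u : cauchy_seq u -> cvgn (fun i => p (u i)).
Proof.
move=> cu; apply: cauchy_cvg; apply: cauchy_exP => e e0.
have [N HN] := cu _ e0; exists (p (u N)), N => // i /= Ni.
rewrite /ball /= (le_lt_trans (seminorm_dist hp _ _))//.
exact: HN.
Qed.

End SeminormLimits.

(** * Completion of a C*-seminormed algebra *)

Section Completion.
Context (R : realType) (A : starAlgType R) (p : A -> R)
  (hp : cstar_seminorm p).

(** The completion consists of Cauchy sequences modulo null sequences, which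
   also divides out the kernel of [p]. Operations are computed on
   representatives chosen by [rep]; the equations on [cls] below free them
   from that choice. *)
Record cseq := CSeq { cseq_fun :> nat -> A; cseqP : cauchy_seq p cseq_fun }.

HB.instance Definition _ := gen_eqMixin cseq.
HB.instance Definition _ := gen_choiceMixin cseq.

Definition cseq_rel (u v : cseq) : bool :=
  `[< null_seq p (fun i => u i - v i) >].

Lemma cseq_rel_refl : reflexive cseq_rel.
Proof.
move=> u; apply/asboolP => e e0; exists 0%N => i _.
by rewrite subrr (seminorm0 hp).
Qed.

Lemma cseq_rel_sym : symmetric cseq_rel.
Proof.
move=> u v; apply/asboolP/asboolP => uv e /uv [N HN]; exists N => i /HN;
  by rewrite (seminormBC hp).
Qed.

Lemma cseq_rel_trans : transitive cseq_rel.
Proof.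
move=> v u w /asboolP uv /asboolP vw; apply/asboolP => e e0.
have [N HN] := null_seqD hp uv vw e0; exists N => i /HN.
by rewrite addrA subrK.
Qed.

Canonical cseq_equiv :=
  EquivRel cseq_rel cseq_rel_refl cseq_rel_sym cseq_rel_trans.

Definition completion := {eq_quot cseq_equiv}%qT.

HB.instance Definition _ := Choice.on completion.

Definition cls (u : cseq) : completion := (\pi_completion u)%qT.
Definition rep (x : completion) : cseq := repr x.

Lemma clsK x : cls (rep x) = x.
Proof. exact: reprK. Qed.

Lemma cls_eq u v : cls u = cls v <-> null_seq p (fun i => u i - v i).
Proof.
split=> [/eqmodP/asboolP//|uv].
by apply/eqmodP/asboolP.
Qed.

Lemma rep_cls u : null_seq p (fun i => rep (cls u) i - u i).
Proof. by apply/cls_eq; rewrite clsK. Qed.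

Lemma completionW (P : completion -> Prop) : (forall u, P (cls u)) ->
  forall x, P x.
Proof. by move=> Pu x; rewrite -(clsK x). Qed.

Definition cseqD (u v : cseq) := CSeq (cauchyD hp (cseqP u) (cseqP v)).
Definition cseqZ (c : R[i]) (u : cseq) := CSeq (cauchyZ hp c (cseqP u)).
Definition cseqM (u v : cseq) := CSeq (cauchyM hp (cseqP u) (cseqP v)).
Definition cseqS (u : cseq) := CSeq (cauchyS hp (cseqP u)).
Definition cseqC (a : A) := CSeq (cauchy_cst hp a).

Definition compD (x y : completion) := cls (cseqD (rep x) (rep y)).
Definition compZ (c : R[i]) (x : completion) := cls (cseqZ c (rep x)).
Definition compM (x y : completion) := cls (cseqM (rep x) (rep y)).
Definition compS (x : completion) := cls (cseqS (rep x)).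
Definition compC (a : A) := cls (cseqC a).

Lemma null_ext (u v : nat -> A) : (forall i, u i = v i) ->
  null_seq p u -> null_seq p v.
Proof. by move=> uv u0 e /u0 [N HN]; exists N => i /HN; rewrite uv. Qed.

Lemma compDE u v : compD (cls u) (cls v) = cls (cseqD u v).
Proof.
apply/cls_eq; apply: null_ext (null_seqD hp (rep_cls u) (rep_cls v)) => i /=.
by rewrite opprD addrACA.
Qed.

Lemma compZE c u : compZ c (cls u) = cls (cseqZ c u).
Proof.
apply/cls_eq => /=; move: (rep_cls u).
apply: (null_seq_le hp (M := Normc.normc c)) => i /=.
by rewrite -scalerBr (seminormZ hp).
Qed.

Lemma compME u v : compM (cls u) (cls v) = cls (cseqM u v).
Proof.
apply/cls_eq => /=.
have H1 := null_bounded_mulr hp (rep_cls u) (cseqP v).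
have H2 := null_bounded_mull hp (cseqP (rep (cls u))) (rep_cls v).
apply: null_ext (null_seqD hp H2 H1) => i.
by rewrite smulBr smulBl addrA subrK.
Qed.

Lemma compSE u : compS (cls u) = cls (cseqS u).
Proof.
apply/cls_eq => /=; move: (rep_cls u).
apply: (null_seq_le hp (M := 1)) => i /=.
by rewrite -starB (seminorm_star hp) mul1r.
Qed.

Definition compE := (compDE, compZE, compME, compSE).

Lemma cls_ext (u v : cseq) : (forall i, u i = v i) -> cls u = cls v.
Proof.
move=> uv; apply/cls_eq => e e0; exists 0%N => i _.
by rewrite uv subrr (seminorm0 hp).
Qed.

Lemma compDA : associative compD.
Proof.
elim/completionW=> u; elim/completionW=> v; elim/completionW=> w.
by rewrite !compE; apply: cls_ext => i /=; rewrite addrA.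
Qed.

Lemma compDC : commutative compD.
Proof.
elim/completionW=> u; elim/completionW=> v.
by rewrite !compE; apply: cls_ext => i /=; rewrite addrC.
Qed.

Lemma comp0D : left_id (compC 0) compD.
Proof.
by elim/completionW=> u; rewrite !compE; apply: cls_ext => i /=; rewrite add0r.
Qed.

Lemma compND : left_inverse (compC 0) (compZ (-1)) compD.
Proof.
elim/completionW=> u; rewrite !compE; apply: cls_ext => i /=.
by rewrite scaleN1r addNr.
Qed.

HB.instance Definition _ :=
  GRing.isZmodule.Build completion compDA compDC comp0D compND.

Lemma compZA (c d : R[i]) x : compZ c (compZ d x) = compZ (c * d) x.
Proof.
elim/completionW: x => u; rewrite !compE; apply: cls_ext => i /=.
by rewrite scalerA.
Qed.

Lemma compZ1 : left_id (1 : R[i]) compZ.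
Proof.
elim/completionW=> u; rewrite !compE; apply: cls_ext => i /=.
by rewrite scale1r.
Qed.

Lemma compZDr : right_distributive compZ +%R.
Proof.
move=> c; elim/completionW=> u; elim/completionW=> v.
rewrite /GRing.add /= !compE; apply: cls_ext => i /=.
by rewrite scalerDr.
Qed.

Lemma compZDl x : {morph compZ^~ x : c d / c + d}.
Proof.
elim/completionW: x => u c d.
rewrite [in RHS]/GRing.add /= !compE; apply: cls_ext => i /=.
by rewrite scalerDl.
Qed.

HB.instance Definition _ :=
  GRing.Zmodule_isLmodule.Build R[i] completion compZA compZ1 compZDr compZDl.

Lemma cls_addE u v : cls u + cls v = cls (cseqD u v).
Proof. exact: compDE. Qed.

Lemma cls_scaleE (c : R[i]) u : c *: cls u = cls (cseqZ c u).
Proof. exact: compZE. Qed.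

Definition clsE := (compME, compSE, cls_addE, cls_scaleE).

Lemma compMA : associative compM.
Proof.
elim/completionW=> u; elim/completionW=> v; elim/completionW=> w.
by rewrite !clsE; apply: cls_ext => i /=; rewrite smulA.
Qed.

Lemma compMDl : left_distributive compM +%R.
Proof.
elim/completionW=> u; elim/completionW=> v; elim/completionW=> w.
by rewrite !clsE; apply: cls_ext => i /=; rewrite smulDl.
Qed.

Lemma compMDr : right_distributive compM +%R.
Proof.
elim/completionW=> u; elim/completionW=> v; elim/completionW=> w.
by rewrite !clsE; apply: cls_ext => i /=; rewrite smulDr.
Qed.

Lemma compMZl (c : R[i]) x y : compM (c *: x) y = c *: compM x y.
Proof.
elim/completionW: x => u; elim/completionW: y => v.
by rewrite !clsE; apply: cls_ext => i /=; rewrite smulZl.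
Qed.

Lemma compMZr (c : R[i]) x y : compM x (c *: y) = c *: compM x y.
Proof.
elim/completionW: x => u; elim/completionW: y => v.
by rewrite !clsE; apply: cls_ext => i /=; rewrite smulZr.
Qed.

Lemma compSK : involutive compS.
Proof.
by elim/completionW=> u; rewrite !clsE; apply: cls_ext => i /=; rewrite starK.
Qed.

Lemma compSD : {morph compS : x y / x + y}.
Proof.
elim/completionW=> u; elim/completionW=> v.
by rewrite !clsE; apply: cls_ext => i /=; rewrite starD.
Qed.

Lemma compSZ (c : R[i]) x : compS (c *: x) = c^* *: compS x.
Proof.
elim/completionW: x => u.
by rewrite !clsE; apply: cls_ext => i /=; rewrite starZ.
Qed.

Lemma compSM x y : compS (compM x y) = compM (compS y) (compS x).
Proof.
elim/completionW: x => u; elim/completionW: y => v.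
by rewrite !clsE; apply: cls_ext => i /=; rewrite starM.
Qed.

HB.instance Definition _ := isStarAlgebra.Build R completion
  compMA compMDl compMDr compMZl compMZr compSK compSD compSZ compSM.

Lemma cls_mulE u v : smul (cls u) (cls v) = cls (cseqM u v).
Proof. exact: compME. Qed.

Lemma cls_starE u : star (cls u) = cls (cseqS u).
Proof. exact: compSE. Qed.

Definition comp_norm (x : completion) : R := limn (fun i => p (rep x i)).

Lemma cls_norm_cvg (u : cseq) : p (u i) @[i --> \oo] --> comp_norm (cls u).
Proof.
have cv := cauchy_norm_cvg hp (cseqP (rep (cls u))).
suff H : (fun i => p (rep (cls u) i) - p (u i)) @ \oo --> (0 : R).
  rewrite -[comp_norm _]subr0.
  rewrite (_ : (fun i => p (u i)) = (fun i =>
    p (rep (cls u) i) - (p (rep (cls u) i) - p (u i)))); last first.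
    by apply/funext => i; rewrite opprB addrC subrK.
  exact: cvgB cv H.
apply/cvgrPdist_lt => e e0; have [N HN] := rep_cls u e0.
exists N => // i /= /HN; rewrite sub0r normrN.
exact/le_lt_trans/seminorm_dist.
Unshelve. all: by end_near. Qed.

Lemma comp_normE (u : cseq) l :
  p (u i) @[i --> \oo] --> l -> comp_norm (cls u) = l.
Proof. by move=> ul; apply: (cvg_unique _ (@cls_norm_cvg u) ul). Qed.

Lemma comp_norm_le (u : cseq) (M : R) (N : nat) :
  (forall i, (N <= i)%N -> p (u i) <= M) -> comp_norm (cls u) <= M.
Proof.
move=> uM; apply: (ler_cvg_to (@cls_norm_cvg u) (cvg_cst M)).
by exists N => // i /= /uM.
Qed.

Lemma comp_norm_cstar : cstar_seminorm comp_norm.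
Proof.
split.
- elim/completionW=> u; elim/completionW=> v; rewrite cls_addE.
  apply: (ler_cvg_to (@cls_norm_cvg _)
    (cvgD (@cls_norm_cvg u) (@cls_norm_cvg v))).
  by near=> i; exact: seminormD.
- move=> c; elim/completionW=> u; rewrite cls_scaleE; apply: comp_normE.
  under eq_fun do rewrite (seminormZ hp).
  by apply: cvgMr; exact: cls_norm_cvg.
- elim/completionW=> u; elim/completionW=> v; rewrite cls_mulE.
  apply: (ler_cvg_to (@cls_norm_cvg _)
    (cvgM (@cls_norm_cvg u) (@cls_norm_cvg v))).
  by near=> i; exact: seminormM.
- elim/completionW=> u; rewrite cls_starE cls_mulE; apply: comp_normE.
  under eq_fun do rewrite (seminorm_star_square hp).
  rewrite expr2; under eq_fun do rewrite expr2.
  by apply: cvgM; exact: cls_norm_cvg.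
Unshelve. all: by end_near. Qed.

Lemma comp_norm_eq0 x : comp_norm x = 0 -> x = 0.
Proof.
elim/completionW: x => u u0; apply/cls_eq => e e0.
have := @cls_norm_cvg u; rewrite u0 => /cvgrPdist_lt /(_ _ e0) [N _ HN].
exists N => i /HN; rewrite sub0r normrN /= subr0.
exact/le_lt_trans/ler_norm.
Qed.

Lemma comp_norm_compC a : comp_norm (compC a) = p a.
Proof. by apply: comp_normE => /=; exact: cvg_cst. Qed.

Lemma compC_dense x (e : R) : 0 < e -> exists a, comp_norm (x - compC a) < e.
Proof.
elim/completionW: x => u e0.
have [N HN] := cseqP u (divr_gt0 e0 (ltr0n _ 2)).
exists (u N); rewrite -scaleN1r cls_scaleE cls_addE.
apply: (@le_lt_trans _ _ (e / 2)); last by lra.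
apply: (@comp_norm_le _ _ N) => i Ni /=.
by rewrite scaleN1r ltW// HN.
Qed.

Lemma compC_tends (u : cseq) :
  tends comp_norm (fun i => compC (u i)) (cls u).
Proof.
move=> e e0; have [N HN] := cseqP u (divr_gt0 e0 (ltr0n _ 2)).
exists N => i Ni; rewrite -scaleN1r cls_scaleE cls_addE.
apply: (@le_lt_trans _ _ (e / 2)); last by lra.
by apply: (@comp_norm_le _ _ N) => j Nj /=; rewrite scaleN1r ltW// HN.
Qed.

Lemma compC_add a b : compC (a + b) = compC a + compC b.
Proof. by rewrite cls_addE; exact: cls_ext. Qed.

Lemma compC_scale (c : R[i]) a : compC (c *: a) = c *: compC a.
Proof. by rewrite cls_scaleE; exact: cls_ext. Qed.

Lemma compC_mul a b : compC (smul a b) = smul (compC a) (compC b).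
Proof. by rewrite cls_mulE; exact: cls_ext. Qed.

Lemma compC_star a : compC (star a) = star (compC a).
Proof. by rewrite cls_starE; exact: cls_ext. Qed.

Lemma compC_sub a b : compC (a - b) = compC a - compC b.
Proof. by rewrite compC_add -scaleN1r compC_scale scaleN1r. Qed.

(** A Cauchy sequence of the completion has the same limit as a sequence of
   elements of the algebra chosen closer and closer to its terms. *)
Lemma completion_complete : seq_complete comp_norm.
Proof.
move=> x cx; have hn := comp_norm_cstar.
have [v Hv] : {v : nat -> A &
    forall k, comp_norm (x k - compC (v k)) < k.+1%:R^-1}.
  by apply: (@choice _ _ (fun k a => comp_norm (x k - compC a) < k.+1%:R^-1))
    => k; exact: compC_dense.
have xv : null_seq comp_norm (fun k => compC (v k) - x k).
  move=> e e0.
  have [N _ HN] := near_infty_natSinv_lt (PosNum e0).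
  exists N => i Ni; rewrite (seminormBC hn) (lt_trans (Hv i))//.
  exact: (HN i Ni).
have cv : cauchy_seq p v.
  move=> e e0; have e3 : 0 < e / 3 by rewrite divr_gt0.
  have [N HN] := xv _ e3; have [M HM] := cx _ e3.
  exists (maxn N M) => i j; rewrite !geq_max => /andP[Ni Mi] /andP[Nj Mj].
  rewrite -comp_norm_compC compC_sub.
  rewrite (le_lt_trans (seminorm_tri hn (x i) _ _))//.
  have := seminorm_tri hn (x j) (x i) (compC (v j)).
  have := HN _ Ni; have := HN _ Nj; have := HM _ _ Mi Mj.
  rewrite (seminormBC hn (compC (v j))); lra.
exists (cls (CSeq cv)) => e e0; have e2 : 0 < e / 2 by rewrite divr_gt0.
have [N HN] := xv _ e2; have [M HM] := compC_tends (CSeq cv) e2.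
exists (maxn N M) => i; rewrite geq_max => /andP[/HN Ni /HM Mi].
rewrite (le_lt_trans (seminorm_tri hn (compC (v i)) _ _))//.
rewrite (seminormBC hn (x i)); move: Ni Mi => /=; lra.
Qed.

End Completion.

(** * Limits for a complete C*-norm *)

Section CompleteLimits.
Context (R : realType) (A : starAlgType R) (p : A -> R)
  (hp : cstar_seminorm p) (p_eq0 : forall a, p a = 0 -> a = 0).
Implicit Types u v : nat -> A.

Lemma seminorm_small a : (forall e : R, 0 < e -> p a < e) -> a = 0.
Proof.
move=> pa; apply: p_eq0; apply/le_anti; rewrite (seminorm_ge0 hp) andbT.
by rewrite leNgt; apply/negP => /pa; rewrite ltxx.
Qed.

Lemma tends_unique u l m : tends p u l -> tends p u m -> l = m.
Proof.
move=> ul um; apply/eqP; rewrite -subr_eq0; apply/eqP/seminorm_small => e e0.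
have e2 : 0 < e / 2 by rewrite divr_gt0.
have [N HN] := ul _ e2; have [M HM] := um _ e2.
have := HN _ (leq_maxl N M); have := HM _ (leq_maxr N M).
have := seminorm_tri hp (u (maxn N M)) l m.
rewrite (seminormBC hp l (u _)); lra.
Qed.

Lemma tends_ext u v l : (forall i, u i = v i) -> tends p u l -> tends p v l.
Proof. by move=> /funext ->. Qed.

Lemma tends_shift u l : tends p u l -> tends p (fun i => u i.+1) l.
Proof.
by move=> ul e /ul [N HN]; exists N => i Ni; apply/HN/(leq_trans Ni)/leqnSn.
Qed.

Lemma tends_cst a : tends p (fun=> a) a.
Proof. by move=> e e0; exists 0%N => i _; rewrite subrr (seminorm0 hp). Qed.

Lemma tendsD u v l m : tends p u l -> tends p v m ->
  tends p (fun i => u i + v i) (l + m).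
Proof.
move=> ul vm e e0; have [N HN] := null_seqD hp ul vm e0.
by exists N => i /HN; rewrite addrACA -opprD.
Qed.

Lemma tendsZ (c : R[i]) u l :
  tends p u l -> tends p (fun i => c *: u i) (c *: l).
Proof.
apply: (null_seq_le hp (M := Normc.normc c)) => i.
by rewrite -scalerBr (seminormZ hp).
Qed.

Lemma tendsS u l : tends p u l -> tends p (fun i => star (u i)) (star l).
Proof.
apply: (null_seq_le hp (M := 1)) => i.
by rewrite -starB (seminorm_star hp) mul1r.
Qed.

Lemma tendsM u v l m : tends p u l -> tends p v m ->
  tends p (fun i => smul (u i) (v i)) (smul l m).
Proof.
move=> ul vm e e0.
have H1 := null_bounded_mull hp (tends_cauchy hp ul) vm.
have H2 := null_bounded_mulr hp ul (cauchy_cst hp m).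
have [N HN] := null_seqD hp H1 H2 e0.
by exists N => i /HN; rewrite smulBr smulBl addrA subrK.
Qed.

Lemma tends_le u l (M : R) :
  (forall i, p (u i) <= M) -> tends p u l -> p l <= M.
Proof.
move=> uM ul; rewrite leNgt; apply/negP => Ml.
have e0 : 0 < p l - M by rewrite subr_gt0.
have [N HN] := ul _ e0; have := HN _ (leqnn N); have := uM N.
have := seminorm_tri hp (u N) l 0; rewrite !subr0 (seminormBC hp l (u N)); lra.
Qed.

(** The iterations below converge because a scalar iteration dominates their
   increments. *)
Lemma dominated_cauchy u (s : nat -> R) (M : R) : (forall i, s i <= M) ->
  (forall i, p (u i.+1 - u i) <= s i.+1 - s i) -> cauchy_seq p u.
Proof.
move=> sM us.
have s_nd i j : (i <= j)%N -> p (u j - u i) <= s j - s i.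
  elim: j => [|j IH].
    by rewrite leqn0 => /eqP ->; rewrite !subrr (seminorm0 hp).
  rewrite leq_eqVlt => /orP[/eqP ->|]; first by rewrite !subrr (seminorm0 hp).
  rewrite ltnS => /IH ij.
  have := seminorm_tri hp (u j) (u j.+1) (u i); have := us j; lra.
have s_homo : {homo s : i j / (i <= j)%N >-> i <= j}.
  by move=> i j /s_nd; have := seminorm_ge0 hp (u j - u i); lra.
have cv : s @ \oo --> limn s.
  apply: nondecreasing_is_cvgn => //.
  by exists M => _ [i _ <-].
move=> e e0; have e4 : 0 < e / 4 by rewrite divr_gt0.
move: cv => /cvgrPdist_lt /(_ _ e4) [N _ HN].
exists N => i j Ni Nj.
have := seminorm_tri hp (u N) (u i) (u j); rewrite (seminormBC hp (u N) (u j)).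
have := s_nd _ _ Ni; have := s_nd _ _ Nj.
have := HN _ Ni; have := HN _ Nj; have := HN _ (leqnn N).
rewrite /= !ltr_norml => /andP[? ?] /andP[? ?] /andP[? ?]; lra.
Qed.

End CompleteLimits.

(** * Positivity in unital C*-algebras *)
Section UnitalCstar.
Context (R : realType) (B : starAlgType R) (e : B) (N : B -> R).
Hypotheses (hN : cstar_seminorm N) (N_eq0 : forall x, N x = 0 -> x = 0).
Hypotheses (cN : seq_complete N).
Hypotheses (mul1 : forall x, smul e x = x) (mulx1 : forall x, smul x e = x).
Local Infix "**" := smul (at level 40, left associativity).
Implicit Types a b c d f h k q w x y z : B.

Let N_ge0 := seminorm_ge0 hN.
Let N_D := seminormD hN.
Let N_M := seminormM hN.
Let N_Zr := seminormZr hN.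
Let N_C := seminorm_star_square hN.

Lemma star1 : star e = e.
Proof. by rewrite -[LHS]mulx1 -{2}(starK e) -starM mulx1 starK. Qed.

Lemma norm1_le : N e <= 1.
Proof.
have := N_C e; rewrite star1 mul1 expr2.
have := N_ge0 e; rewrite le_eqVlt => /orP[/eqP<-//|Ne] /eqP.
rewrite -subr_eq0 -{1}[N e]mulr1 -mulrBr mulf_eq0 gt_eqF//= subr_eq0.
by move=> /eqP <-.
Qed.

Lemma norm_sa_square h : star h = h -> N (h ** h) = N h ^+ 2.
Proof. by move=> hh; rewrite -N_C hh. Qed.

Lemma starZr (r : R) x : star (r%:C *: x) = r%:C *: star x.
Proof.
by rewrite starZ; congr (_ *: _); apply/eqP; rewrite eq_complex /= oppr0 !eqxx.
Qed.

Lemma scale_half x : (2^-1 : R)%:C *: (x + x) = x.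
Proof.
rewrite scalerDr -scalerDl -rmorphD /= [X in X%:C](_ : _ = 1) ?scale1r//.
by field.
Qed.

(** The square root of [1 - k] is [1 - s], where [s] is the limit of the
   iteration [s -> (k + s ^ 2) / 2] started from 0. It converges even for
   [N k = 1], because it is dominated by the same iteration with the scalar 1
   in place of [k], which is increasing and bounded by 1. *)
Lemma sqrt1B k : star k = k -> N k <= 1 -> exists d,
  [/\ star d = d, d ** d = e - k, N (e - d) <= 1 &
      forall x, x ** k = k ** x -> x ** d = d ** x].
Proof.
move=> kk k1.
(* [t] is the scalar iteration, [u] the one in the algebra. *)
pose t : nat -> R := fun n => iter n (fun t => 2^-1 * (1 + t ^+ 2)) 0.
pose u : nat -> B := fun n => iter n (fun s => (2^-1)%:C *: (k + s ** s)) 0.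
have tS n : t n.+1 = 2^-1 * (1 + t n ^+ 2) by [].
have uS n : u n.+1 = (2^-1)%:C *: (k + u n ** u n) by [].
have t01 n : 0 <= t n <= 1.
  elim: n => [|n /andP[t0 t1]]; first by rewrite lexx ler01.
  rewrite tS; apply/andP; split.
    by rewrite mulr_ge0// addr_ge0// exprn_ge0.
  have : t n ^+ 2 <= 1 by rewrite expr_le1.
  lra.
have half_norm : `|2^-1 : R| = 2^-1 by rewrite ger0_norm.
have uN n : N (u n) <= t n.
  elim: n => [|n IH]; first by rewrite /u/= (seminorm0 hN).
  rewrite tS uS N_Zr half_norm ler_wpM2l// (le_trans (N_D _ _))// lerD//.
  by rewrite (le_trans (N_M _ _))// expr2 ler_pM.
have du n : N (u n.+1 - u n) <= t n.+1 - t n.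
  elim: n => [|n IH].
    rewrite /u /t /= subr0 smul0l addr0 N_Zr half_norm expr0n/= addr0 subr0.
    by rewrite ler_wpM2l.
  have -> : u n.+2 - u n.+1
      = (2^-1)%:C *: (u n.+1 ** u n.+1 - u n ** u n).
    rewrite [u n.+2]uS [in X in _ - X]uS -scalerBr opprD addrACA subrr.
    by rewrite add0r.
  rewrite N_Zr half_norm.
  have -> : u n.+1 ** u n.+1 - u n ** u n
      = (u n.+1 - u n) ** u n.+1 + u n ** (u n.+1 - u n).
    by rewrite smulBl smulBr addrA subrK.
  have H1 : N ((u n.+1 - u n) ** u n.+1) <= (t n.+1 - t n) * t n.+1.
    by rewrite (le_trans (N_M _ _))// ler_pM.
  have H2 : N (u n ** (u n.+1 - u n)) <= t n * (t n.+1 - t n).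
    by rewrite (le_trans (N_M _ _))// ler_pM.
  have := N_D ((u n.+1 - u n) ** u n.+1) (u n ** (u n.+1 - u n)).
  have := tS n.+1; have := tS n; nra.
have [s us] : exists s, tends N u s.
  apply: cN; apply: (dominated_cauchy hN (M := 1) _ du) => i.
  by case/andP: (t01 i).
have ss : star s = s.
  apply: (tends_unique hN N_eq0 (tendsS hN us)).
  apply: tends_ext us => i; elim: i => [|i IH]; first by rewrite star_zero.
  by rewrite uS starZr starD starM kk -IH.
have s2 : s + s = k + s ** s.
  have sE : s = (2^-1)%:C *: (k + s ** s).
    apply: (tends_unique hN N_eq0 (tends_shift us)).
    apply: (tendsZ hN); apply: (tendsD hN (tends_cst hN k)).
    exact: tendsM.
  by rewrite {1 2}sE -scalerDr scale_half.
exists (e - s); split.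
- by rewrite starB star1 ss.
- rewrite smulBl mul1 smulBr mulx1 opprB.
  have : s ** s - s = s - k.
    by apply/eqP; rewrite subr_eq addrAC eq_sym subr_eq s2 addrC.
  by move=> ->; rewrite addrA subrK.
- rewrite opprB addrC subrK; apply: (tends_le hN _ us) => i.
  by rewrite (le_trans (uN i))//; case/andP: (t01 i).
- move=> x xk; rewrite smulBr smulBl mul1 mulx1; congr (_ - _).
  have H1 := tendsM hN (tends_cst hN x) us.
  apply: (tends_unique hN N_eq0 H1).
  apply: tends_ext (tendsM hN us (tends_cst hN x)) => i.
  elim: i => [|i IH]; first by rewrite smul0l smul0r.
  rewrite uS smulZl smulZr smulDl smulDr xk; congr (_ *: (_ + _)).
  by rewrite -smulA IH smulA IH smulA.
Qed.

(** Here [c ** c + f ** f] is [star z ** z] for [z = c + i f], whose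
   self-adjoint part is [c]. *)
Lemma norm_sum_squares c f : star c = c -> star f = f -> c ** f = f ** c ->
  N (c ** c) <= N (c ** c + f ** f).
Proof.
move=> cc ff cf; pose z := c + 'i *: f.
have zs : star z = c - 'i *: f.
  rewrite /z starD starZ cc ff; congr (_ + _).
  rewrite -scaleNr; congr (_ *: _).
  by apply/eqP; rewrite eq_complex /= oppr0 !eqxx.
have ii : ('i * 'i : R[i]) = -1 by rewrite -expr2 sqr_i.
have zz : star z ** z = c ** c + f ** f.
  rewrite zs /z smulBl !smulDr !smulZl !smulZr scalerA ii scaleN1r cf.
  by rewrite opprD opprK addrA addrK.
rewrite -zz N_C norm_sa_square// ler_pXn2r ?nnegrE//.
have -> : c = (2^-1 : R)%:C *: (z + star z).
  by rewrite zs /z addrACA subrr addr0 scale_half.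
rewrite N_Zr ger0_norm// mulrC ler_pdivrMr// mulr_natr mulr2n.
by rewrite (le_trans (N_D _ _))// (seminorm_star hN).
Qed.

Lemma sa_square_le1 c : star c = c -> N c <= 1 -> N (c ** c) <= 1.
Proof. by move=> cc c1; rewrite norm_sa_square// expr_le1. Qed.

(** With [d ^ 2 = 1 - c ^ 2], norm_sum_squares bounds [d ^ 2] by the norm of
   [d ^ 2 + c ^ 2 = 1]. *)
Lemma norm_1B_square c : star c = c -> N c <= 1 -> N (e - c ** c) <= 1.
Proof.
move=> cc c1.
have [d [dd d2 _ dc]] : exists d, [/\ star d = d, d ** d = e - c ** c,
    N (e - d) <= 1 & forall x, x ** (c ** c) = (c ** c) ** x ->
    x ** d = d ** x].
  by apply: sqrt1B; rewrite ?starM ?cc// sa_square_le1.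
rewrite -d2; have dc' : d ** c = c ** d by apply/esym/dc; rewrite smulA.
by rewrite (le_trans (norm_sum_squares dd cc dc'))// d2 subrK norm1_le.
Qed.

(** For a self-adjoint [h] this says that the spectrum of [h] lies in the disc
   of centre [t] and radius [t], hence in the nonnegative reals. *)
Definition positive h : Prop :=
  star h = h /\ exists2 t : R, 0 <= t & N (t%:C *: e - h) <= t.

Lemma positive_sa h : positive h -> star h = h.
Proof. by case. Qed.

Lemma positiveD h k : positive h -> positive k -> positive (h + k).
Proof.
move=> [hh [t t0 ht]] [kk [s s0 ks]]; split; first by rewrite starD hh kk.
exists (t + s); first exact: addr_ge0.
rewrite rmorphD/= scalerDl opprD addrACA.
by rewrite (le_trans (N_D _ _))// lerD.
Qed.

Lemma positiveZ (r : R) h : 0 <= r -> positive h -> positive (r%:C *: h).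
Proof.
move=> r0 [hh [t t0 ht]]; split; first by rewrite starZr hh.
exists (r * t); first exact: mulr_ge0.
rewrite rmorphM/= -scalerA -scalerBr N_Zr ger0_norm//.
by rewrite ler_wpM2l.
Qed.

Lemma positive_1B h : star h = h -> N h <= 1 -> positive (e - h).
Proof.
move=> hh h1; split; first by rewrite starB star1 hh.
by exists 1 => //; rewrite scale1r opprB addrC subrK.
Qed.

(** The norm bound on [1 - c ^ 2] is the definition of positivity with
   [t = 1], once [c] is scaled to the unit ball. *)
Lemma positive_square c : star c = c -> positive (c ** c).
Proof.
move=> cc; pose r := N c + 1; have r0 : 0 < r by rewrite ltr_wpDl.
have -> : c ** c = (r ^+ 2)%:C *: ((r^-1%:C *: c) ** (r^-1%:C *: c)).
  rewrite smulZl smulZr !scalerA -!rmorphM/= (_ : _ * _ = 1) ?scale1r//.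
  by field; rewrite gt_eqF.
apply: positiveZ; first by rewrite exprn_ge0// ltW.
have c1 : N (r^-1%:C *: c) <= 1.
  by rewrite N_Zr gtr0_norm ?invr_gt0// mulrC ler_pdivrMr// mul1r lerDl.
have cs : star (r^-1%:C *: c) = r^-1%:C *: c by rewrite starZr cc.
split; first by rewrite starM cs.
by exists 1 => //; rewrite scale1r norm_1B_square.
Qed.

Definition inverse x y : Prop := x ** y = e /\ y ** x = e.

Lemma inverse_sa x y : star x = x -> inverse x y -> star y = y.
Proof.
move=> xx [xy yx].
have /(congr1 star) := xy; rewrite starM xx star1 => ys.
by rewrite -[LHS]mulx1 -xy smulA ys mul1.
Qed.

Lemma inverse_comm x y z : inverse x y -> z ** x = x ** z -> z ** y = y ** z.
Proof.
move=> [xy yx] zx.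
by rewrite -[z in LHS]mul1 -yx -!smulA [x ** _]smulA -zx -smulA xy mulx1.
Qed.

Lemma inverseM x y x' y' : inverse x y -> inverse x' y' ->
  inverse (x ** x') (y' ** y).
Proof.
move=> [xy yx] [xy' yx']; split.
- by rewrite smulA -(smulA x) xy' mulx1.
- by rewrite smulA -(smulA y') yx mulx1.
Qed.

Lemma inverseZ (r : R) x y : r != 0 -> inverse x y ->
  inverse (r%:C *: x) (r^-1%:C *: y).
Proof.
move=> r0 [xy yx].
have rr : (r^-1 * r)%:C = 1 :> R[i] by rewrite mulVf.
split; rewrite smulZl smulZr scalerA ?xy ?yx -rmorphM/= ?rr ?scale1r//.
by rewrite mulrC rr scale1r.
Qed.

(** The geometric series, as the iteration [y = 1 + z y]. *)
Lemma neumann z : N z < 1 -> exists y, inverse (e - z) y.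
Proof.
move=> z1; pose r := N z; have r0 : 0 <= r by exact: N_ge0.
pose u : nat -> B := fun n => iter n (fun y => e + z ** y) 0.
have uS n : u n.+1 = e + z ** u n by [].
have du n : N (u n.+1 - u n) <= r ^+ n.
  elim: n => [|n IH]; first by rewrite uS smul0r subr0 addr0 expr0 norm1_le.
  have -> : u n.+2 - u n.+1 = z ** (u n.+1 - u n).
    by rewrite [u n.+2]uS [in X in _ - X]uS opprD addrACA subrr add0r smulBr.
  by rewrite (le_trans (N_M _ _))// exprS ler_pM.
have [y uy] : exists y, tends N u y.
  apply: cN.
  apply: (dominated_cauchy hN (s := fun n => (1 - r ^+ n) / (1 - r))
    (M := (1 - r)^-1)) => i.
  - rewrite ler_pdivrMr ?subr_gt0// mulVf ?gt_eqF ?subr_gt0//.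
    by rewrite gerBl exprn_ge0.
  - rewrite (le_trans (du i))// exprS le_eqVlt; apply/orP; left; apply/eqP.
    by field; rewrite gt_eqF// subr_gt0.
have yE : y = e + z ** y.
  apply: (tends_unique hN N_eq0 (tends_shift uy)).
  by apply: (tendsD hN (tends_cst hN e)); apply: tendsM (tends_cst hN z) uy.
have yz : z ** y = y ** z.
  have H1 := tendsM hN (tends_cst hN z) uy.
  apply: (tends_unique hN N_eq0 H1).
  apply: tends_ext (tendsM hN uy (tends_cst hN z)) => i.
  elim: i => [|i IH]; first by rewrite smul0l smul0r.
  by rewrite uS smulDl smulDr mul1 mulx1 -smulA IH.
have xy : (e - z) ** y = e by rewrite smulBl mul1 {1}yE addrK.
by exists y; split=> //; rewrite smulBr mulx1 -yz {1}yE addrK.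
Qed.

(** [l + h = (l + t) (1 - (t - h) / (l + t))], and the norm of [t - h] is at
   most [t < l + t]. *)
Lemma positive_inverse h (l : R) : positive h -> 0 < l ->
  exists y, inverse (l%:C *: e + h) y.
Proof.
move=> [hh [t t0 ht]] l0; have lt0 : 0 < l + t by rewrite ltr_wpDr.
have [|y yi] := @neumann ((l + t)^-1%:C *: (t%:C *: e - h)).
  rewrite N_Zr gtr0_norm ?invr_gt0// mulrC ltr_pdivrMr// mul1r.
  by rewrite (le_lt_trans ht)// ltrDr.
exists ((l + t)^-1%:C *: y).
have -> : l%:C *: e + h
    = (l + t)%:C *: (e - (l + t)^-1%:C *: (t%:C *: e - h)).
  rewrite scalerBr scalerA -rmorphM/= divff ?gt_eqF// scale1r.
  by rewrite rmorphD/= scalerDl opprB addrA addrAC addrK.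
by apply: inverseZ => //; rewrite gt_eqF.
Qed.

(** If [y] inverts [1 - c ^ 2], then [1 - c ^ 2 - eps] is still a square
   [g ^ 2] for small [eps], and [N c ^ 2 <= N (c ^ 2 + g ^ 2) = 1 - eps]. This
   replaces the fact that the norm of a self-adjoint element is attained on
   its spectrum. *)
Lemma norm_lt1 c y : star c = c -> N c <= 1 -> inverse (e - c ** c) y ->
  N c < 1.
Proof.
move=> cc c1 yi; pose eps := (N y + 1)^-1.
have c2s : star (c ** c) = c ** c by rewrite starM cc.
have Ny0 : 0 < N y + 1 by rewrite ltr_wpDl.
have eps0 : 0 < eps by rewrite invr_gt0.
have ys : star y = y by apply: inverse_sa yi; rewrite starB star1 c2s.
have comm_y x : x ** (c ** c) = (c ** c) ** x -> x ** y = y ** x.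
  by move=> xc; apply: (inverse_comm yi); rewrite smulBl smulBr mul1 mulx1 xc.
have [d [dd d2 _ dcomm]] := @sqrt1B (c ** c) c2s (sa_square_le1 cc c1).
have [f [ff f2 _ fcomm]] : exists f, [/\ star f = f,
    f ** f = e - eps%:C *: y, N (e - f) <= 1 &
    forall x, x ** (eps%:C *: y) = (eps%:C *: y) ** x -> x ** f = f ** x].
  apply: sqrt1B; first by rewrite starZr ys.
  by rewrite N_Zr gtr0_norm// mulrC ler_pdivrMr// mul1r lerDl.
have fcomm' x : x ** (c ** c) = (c ** c) ** x -> x ** f = f ** x.
  by move=> /comm_y xy; apply: fcomm; rewrite smulZl smulZr xy.
have c_c2 : c ** (c ** c) = c ** c ** c by rewrite smulA.
have cd := dcomm _ c_c2; have cf := fcomm' _ c_c2.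
have df : d ** f = f ** d by apply/fcomm'/esym/dcomm.
pose g := d ** f.
have gs : star g = g by rewrite /g starM dd ff df.
have cg : c ** g = g ** c by rewrite /g smulA cd -smulA cf smulA.
have g2 : g ** g = (e - c ** c) - eps%:C *: e.
  rewrite /g {1}df -smulA [d ** (d ** f)]smulA d2 smulA.
  have -> : f ** (e - c ** c) = (e - c ** c) ** f.
    by rewrite smulBl smulBr mul1 mulx1 (fcomm' (c ** c)).
  by rewrite -smulA f2 smulBr mulx1 smulZr yi.1.
have := norm_sum_squares cc gs cg.
rewrite g2 addrA [c ** c + _]addrC subrK norm_sa_square//.
have -> : e - eps%:C *: e = (1 - eps)%:C *: e.
  by rewrite rmorphB scalerBl scale1r.
have eps1 : eps <= 1 by rewrite invf_le1// lerDr.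
rewrite N_Zr ger0_norm ?subr_ge0// => c2.
have {}c2 : N c ^+ 2 < 1.
  apply: (le_lt_trans c2); rewrite (@le_lt_trans _ _ ((1 - eps) * 1))//.
    by rewrite ler_wpM2l ?norm1_le// subr_ge0.
  by rewrite mulr1 gtrBl.
by rewrite -(@ltr_pXn2r _ 2) ?nnegrE// expr1n.
Qed.

(** Were [r = N h] larger than 1, both [r - h = (r - 1) + (1 - h)] and [r + h]
   would be invertible, hence [1 - (h / r) ^ 2] as well, which norm_lt1
   excludes because [h / r] has norm 1. *)
Lemma norm_le1 h : positive h -> positive (e - h) -> N h <= 1.
Proof.
move=> ph p1h; rewrite leNgt; apply/negP => h1; pose r := N h.
have hh := positive_sa ph.
have r0 : 0 < r by exact: lt_trans h1.
have [y1 i1] : exists y, inverse (r%:C *: e - h) y.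
  have r1 : 0 < r - 1 by rewrite subr_gt0.
  have [y] := positive_inverse p1h r1.
  by rewrite rmorphB scalerBl scale1r addrA subrK => iy; exists y.
have [y2 i2] := positive_inverse ph r0.
pose c := r^-1%:C *: h.
have cc : star c = c by rewrite starZr hh.
have Nc : N c = 1 by rewrite N_Zr gtr0_norm ?invr_gt0// mulVf ?gt_eqF.
have ic : inverse (e - c ** c) ((r ^+ 2)^-1^-1%:C *: (y2 ** y1)).
  have -> : e - c ** c
      = (r ^+ 2)^-1%:C *: ((r%:C *: e - h) ** (r%:C *: e + h)).
    rewrite smulBl !smulDr !smulZl !smulZr !mul1 !mulx1 opprD addrA addrK.
    rewrite scalerBr !scalerA -!rmorphM/=; congr (_ - _%:C *: _).
    - rewrite [X in X%:C](_ : _ = 1) ?scale1r//.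
      by field; rewrite gt_eqF.
    - by field; rewrite gt_eqF.
  by apply: inverseZ; [rewrite invr_eq0 expf_neq0// gt_eqF|exact: inverseM].
by have := norm_lt1 cc (_ : N c <= 1) ic; rewrite Nc ltxx => /(_ (lexx _)).
Qed.

(** If [star c ** c = - q ^ 2], then [c ** star c], being a sum of squares
   minus [star c ** c], is positive. The spectra of the two products agree
   outside 0, so that [l - q ^ 2] is invertible for all [l > 0], and [q = 0]
   by norm_lt1. *)
Lemma neg_square_eq0 c q : star q = q -> star c ** c = - (q ** q) -> c = 0.
Proof.
move=> qq cq.
have pcc : positive (c ** star c).
  (* [X] and [Y] are twice the real and imaginary parts of [c]. *)
  pose X := c + star c; pose Y := 'i *: (c - star c).
  have Xs : star X = X by rewrite starD starK addrC.
  have Ys : star Y = Y.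
    rewrite /Y starZ starB starK -[in RHS]opprB scalerN -scaleNr.
    by congr (_ *: _); apply/eqP; rewrite eq_complex /= oppr0 !eqxx.
  have ii : ('i * 'i : R[i]) = -1 by rewrite -expr2 sqr_i.
  have XY : X ** X + Y ** Y = (c ** star c + star c ** c)
      + (c ** star c + star c ** c).
    rewrite /X /Y smulZl smulZr scalerA ii scaleN1r.
    rewrite !smulDl !smulDr !smulNl !smulNr !opprD !opprK.
    rewrite addrACA [RHS]addrACA; congr (_ + _).
      by rewrite addrACA subrr add0r.
    by rewrite addrACA subrr addr0.
  have -> : c ** star c = (2^-1)%:C *: (X ** X + Y ** Y) + q ** q.
    by rewrite XY scale_half cq subrK.
  apply: positiveD; last exact: positive_square.
  by apply: positiveZ => //; apply: positiveD; exact: positive_square.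
have inv (l : R) : 0 < l -> exists y, inverse (l%:C *: e - q ** q) y.
  move=> l0; have [y [yr yl]] := positive_inverse pcc l0.
  (* The usual inverse of [l + star c ** c] from that of [l + c ** star c]. *)
  exists (l^-1%:C *: (e - star c ** y ** c)).
  have l1 : (l^-1 * l)%:C = 1 :> R[i] by rewrite mulVf ?gt_eqF.
  have {}yr : c ** star c ** y = e - l%:C *: y.
    by rewrite -yr smulDl smulZl mul1 addrC addKr.
  have {}yl : y ** (c ** star c) = e - l%:C *: y.
    by rewrite -yl smulDr smulZr mulx1 addrC addKr.
  suff [H1 H2] : (l%:C *: e + star c ** c) ** (e - star c ** y ** c) = l%:C *: e
      /\ (e - star c ** y ** c) ** (l%:C *: e + star c ** c) = l%:C *: e.
    rewrite -cq; split; rewrite ?smulZl ?smulZr ?H1 ?H2 scalerA -rmorphM/= l1;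
      by rewrite scale1r.
  split.
  - rewrite smulBr mulx1 smulDl smulZl mul1.
    have -> : star c ** c ** (star c ** y ** c)
        = star c ** (c ** star c ** y) ** c by rewrite !smulA.
    rewrite yr smulBr mulx1 smulBl smulZr smulZl.
    by rewrite [X in _ - X]addrC subrK addrK.
  - rewrite smulBl mul1 smulDr smulZr mulx1.
    have -> : star c ** y ** c ** (star c ** c)
        = star c ** (y ** (c ** star c)) ** c by rewrite !smulA.
    rewrite yl smulBr mulx1 smulBl smulZr smulZl.
    by rewrite [X in _ - X]addrC subrK addrK.
suff q0 : q = 0.
  apply: N_eq0; apply/eqP.
  by rewrite -sqrf_eq0 -N_C cq q0 smul0l oppr0 (seminorm0 hN).
apply: N_eq0; apply/eqP; apply: contraT => q0.
have r0 : 0 < N q by rewrite lt_neqAle eq_sym q0 N_ge0.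
(* [1 - c' ^ 2] is invertible although [c'] has norm 1. *)
have [y iy] := inv _ (exprn_gt0 2 r0).
pose c' := (N q)^-1%:C *: q.
have c's : star c' = c' by rewrite starZr qq.
have Nc' : N c' = 1 by rewrite N_Zr gtr0_norm ?invr_gt0// mulVf.
have ic : inverse (e - c' ** c') ((N q ^+ 2)^-1^-1%:C *: y).
  have -> : e - c' ** c' = (N q ^+ 2)^-1%:C *: ((N q ^+ 2)%:C *: e - q ** q).
    rewrite scalerBr smulZl smulZr !scalerA -!rmorphM/=.
    rewrite mulVf ?expf_neq0// scale1r; congr (_ - _%:C *: _).
    by rewrite expr2 invfM.
  by apply: inverseZ => //; rewrite invr_eq0 expf_neq0.
by have := norm_lt1 c's (_ : N c' <= 1) ic; rewrite Nc' ltxx => /(_ (lexx _)).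
Qed.

(** With [m = |h|] for [h = star a ** a], the element [w = m - h] is twice the
   negative part of [h], and
   [star (a ** w) ** (a ** w) = w ** h ** w = - w ** m ** w] is the opposite
   of a square. *)
Theorem positive_star_square a : positive (star a ** a).
Proof.
wlog a1 : a / N a <= 1.
  move=> H; pose r := N a + 1; have r0 : 0 < r by rewrite ltr_wpDl.
  have -> : star a ** a
      = (r ^+ 2)%:C *: (star (r^-1%:C *: a) ** (r^-1%:C *: a)).
    rewrite starZr smulZl smulZr !scalerA -!rmorphM/=.
    by rewrite (_ : _ * _ = 1) ?scale1r//; field; rewrite gt_eqF.
  apply: positiveZ; first by rewrite exprn_ge0// ltW.
  apply: H; rewrite N_Zr gtr0_norm ?invr_gt0// mulrC ler_pdivrMr//.
  by rewrite mul1r lerDl.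
pose h := star a ** a; rewrite -/h.
have hh : star h = h by exact: star_squareE.
have h1 : N h <= 1 by rewrite N_C expr_le1.
have hhs : star (h ** h) = h ** h by rewrite starM hh.
have [m [ms m2 m1 mcomm]] := @sqrt1B (e - h ** h)
  ltac:(by rewrite starB star1 hhs) (norm_1B_square hh h1).
have {}m2 : m ** m = h ** h by rewrite m2 opprB addrC subrK.
have hm : h ** m = m ** h.
  by apply: mcomm; rewrite smulBr smulBl mul1 mulx1 smulA.
have [v [vs v2 _ vcomm]] := @sqrt1B (e - m) ltac:(by rewrite starB star1 ms) m1.
have {}v2 : v ** v = m by rewrite v2 opprB addrC subrK.
pose w := m - h.
have ws : star w = w by rewrite starB ms hh.
have hw : h ** w = - (m ** w) by rewrite !smulBr m2 hm opprB.
have wm : w ** m = m ** w by rewrite smulBl smulBr hm.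
have wv : w ** v = v ** w.
  by apply: vcomm; rewrite smulBr smulBl mul1 mulx1 wm.
have aw : a ** w = 0.
  apply: (@neg_square_eq0 _ (v ** w)); first by rewrite starM vs ws.
  have -> : star (a ** w) ** (a ** w) = w ** (h ** w).
    by rewrite starM ws /h !smulA.
  rewrite hw smulNr; congr (- _).
  by rewrite smulA wm -smulA -[in RHS]smulA [w ** (v ** w)]smulA wv !smulA v2.
have hw0 : h ** w = 0 by rewrite /h -smulA aw smul0r.
have mw0 : m ** w = 0 by apply/eqP; rewrite -oppr_eq0 -hw hw0.
have w0 : w = 0.
  apply: N_eq0; apply/eqP; rewrite -sqrf_eq0 -norm_sa_square//.
  by rewrite {1}/w smulBl hw0 mw0 subrr (seminorm0 hN).
have -> : h = m by apply/eqP; rewrite eq_sym -subr_eq0 -/w w0.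
by rewrite -[m](subKr e); apply: positive_1B; rewrite ?starB ?star1 ?ms.
Qed.

End UnitalCstar.

(** * The unitization and its operator seminorm *)

(** A unit is adjoined even if there is one already; the operator seminorm
   below may then have a kernel, which completion removes. *)
Definition unitization (R : realType) (A : starAlgType R) : Type :=
  (A * R[i])%type.

Section Unitization.
Context (R : realType) (A : starAlgType R).
Local Notation U := (unitization A).

HB.instance Definition _ := GRing.Lmodule.copy U (A * (R[i])^o)%type.

Definition unitz_mul (x y : U) : U :=
  (smul x.1 y.1 + (y.2 *: x.1 + x.2 *: y.1), x.2 * y.2).
Definition unitz_star (x : U) : U := (star x.1, x.2^*).

Lemma unitz_eq (x y : U) : x.1 = y.1 -> x.2 = y.2 -> x = y.
Proof. by case: x y => [a c] [b d] /= -> ->. Qed.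

Lemma unitz_mulA : associative unitz_mul.
Proof.
move=> x y z; apply: unitz_eq; rewrite /= ?mulrA//.
rewrite !smulDl !smulDr !scalerDr !smulA !smulZl !smulZr !scalerA.
rewrite (mulrC z.2 x.2) (mulrC z.2 y.2) !addrA.
by rewrite [LHS](ACl (1*3*5*2*4*6*7)).
Qed.

Lemma unitz_mulDl : left_distributive unitz_mul +%R.
Proof.
move=> x y z; apply: unitz_eq; rewrite /= ?mulrDl//.
by rewrite smulDl scalerDr scalerDl !addrA [LHS](ACl (1*3*5*2*4*6)).
Qed.

Lemma unitz_mulDr : right_distributive unitz_mul +%R.
Proof.
move=> x y z; apply: unitz_eq; rewrite /= ?mulrDr//.
by rewrite smulDr scalerDr scalerDl !addrA [LHS](ACl (1*3*5*2*4*6)).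
Qed.

Lemma unitz_mulZl (c : R[i]) x y : unitz_mul (c *: x) y = c *: unitz_mul x y.
Proof.
apply: unitz_eq; rewrite /= ?smulZl ?scalerDr ?scalerA ?mulrA//.
by rewrite (mulrC y.2).
Qed.

Lemma unitz_mulZr (c : R[i]) x y : unitz_mul x (c *: y) = c *: unitz_mul x y.
Proof.
apply: unitz_eq => /=; last exact: mulrCA.
by rewrite smulZr !scalerDr !scalerA (mulrC x.2).
Qed.

Lemma unitz_starK : involutive unitz_star.
Proof. by move=> x; apply: unitz_eq; rewrite /= ?starK// conjcK. Qed.

Lemma unitz_starD : {morph unitz_star : x y / x + y}.
Proof. by move=> x y; apply: unitz_eq; rewrite /= ?starD// rmorphD. Qed.

Lemma unitz_starZ (c : R[i]) x : unitz_star (c *: x) = c^* *: unitz_star x.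
Proof. by apply: unitz_eq; rewrite /= ?starZ// [LHS]rmorphM. Qed.

Lemma unitz_starM x y :
  unitz_star (unitz_mul x y) = unitz_mul (unitz_star y) (unitz_star x).
Proof.
apply: unitz_eq => /=; last by rewrite rmorphM mulrC.
by rewrite !starD starM !starZ; congr (_ + _); rewrite addrC.
Qed.

HB.instance Definition _ := isStarAlgebra.Build R U
  unitz_mulA unitz_mulDl unitz_mulDr unitz_mulZl unitz_mulZr
  unitz_starK unitz_starD unitz_starZ unitz_starM.

(** Left multiplication by [x] on the ideal [A], whose operator norm is the
   C*-seminorm that extends the one of [A]. *)
Definition unitz_act (x : U) (b : A) : A := x.2 *: b + smul x.1 b.

Lemma unitz_actM x y b : unitz_act (smul x y) b = unitz_act x (unitz_act y b).
Proof.
rewrite /unitz_act /= !smulDl !smulDr !smulZl !smulZr !scalerDr !scalerA smulA.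
by rewrite !addrA [LHS](ACl (1*4*3*2)).
Qed.

Lemma unitz_act_star x b :
  smul (star (unitz_act x b)) (unitz_act x b)
  = smul (star b) (unitz_act (smul (star x) x) b).
Proof.
rewrite unitz_actM; move E : (unitz_act x b) => z.
rewrite -[in star _]E /unitz_act /= starD starZ starM.
by rewrite smulDl smulDr smulZl smulZr smulA.
Qed.

Context (p : A -> R) (hp : cstar_seminorm p).

Definition unitz_norm (x : U) : R :=
  sup [set p (unitz_act x b) | b in [set b | p b <= 1]].

Let ub (x : U) : has_ubound [set p (unitz_act x b) | b in [set b | p b <= 1]].
Proof.
exists (Normc.normc x.2 + p x.1) => _ [b /= b1 <-].
rewrite (le_trans (seminormD hp _ _))// (seminormZ hp).
rewrite lerD ?ler_piMr ?normc_ge0//.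
by rewrite (le_trans (seminormM hp _ _))// ler_piMr// (seminorm_ge0 hp).
Qed.

Let nonempty (x : U) : [set p (unitz_act x b) | b in [set b | p b <= 1]] !=set0.
Proof.
by exists (p (unitz_act x 0)), 0 => //=; rewrite (seminorm0 hp).
Qed.

Lemma unitz_norm_le x (M : R) : 0 <= M ->
  (forall b, p (unitz_act x b) <= M * p b) -> unitz_norm x <= M.
Proof.
move=> M0 H; apply: ge_sup => // _ [b /= b1 <-].
by rewrite (le_trans (H b))// ler_piMr.
Qed.

Lemma unitz_actZ x (c : R[i]) b : unitz_act x (c *: b) = c *: unitz_act x b.
Proof. by rewrite /unitz_act smulZr scalerDr !scalerA mulrC. Qed.

Lemma unitz_norm_act x b : p (unitz_act x b) <= unitz_norm x * p b.
Proof.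
have [b0|b0] := eqVneq (p b) 0.
  rewrite b0 mulr0 (le_trans (seminormD hp _ _))// (seminormZ hp) b0.
  rewrite mulr0 add0r.
  by rewrite (le_trans (seminormM hp _ _))// b0 mulr0.
have b_gt0 : 0 < p b by rewrite lt_neqAle eq_sym b0 (seminorm_ge0 hp).
have := ub_le_sup (ub x) (_ : _ (p (unitz_act x ((p b)^-1%:C *: b)))).
rewrite unitz_actZ (seminormZr hp) gtr0_norm ?invr_gt0// mulrC ler_pdivrMr//.
apply; exists ((p b)^-1%:C *: b); rewrite ?unitz_actZ ?(seminormZr hp)//=.
  by rewrite (seminormZr hp) gtr0_norm ?invr_gt0// mulVf.
by rewrite gtr0_norm ?invr_gt0// mulrC.
Qed.

Lemma unitz_norm_ge0 x : 0 <= unitz_norm x.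
Proof.
apply: le_trans (ub_le_sup (ub x) _); last first.
  by exists 0 => //=; rewrite (seminorm0 hp).
exact: seminorm_ge0.
Qed.

Lemma unitz_norm_cstar : cstar_seminorm unitz_norm.
Proof.
apply: cstar_seminormP.
- exact: unitz_norm_ge0.
- move=> x y; apply: unitz_norm_le => [|b].
    by rewrite addr_ge0 ?unitz_norm_ge0.
  rewrite mulrDl; have -> : unitz_act (x + y) b = unitz_act x b + unitz_act y b.
    by rewrite /unitz_act /= scalerDl smulDl addrACA.
  by rewrite (le_trans (seminormD hp _ _))// lerD// unitz_norm_act.
- move=> c x; apply: unitz_norm_le => [|b].
    by rewrite mulr_ge0 ?normc_ge0 ?unitz_norm_ge0.
  have -> : unitz_act (c *: x) b = c *: unitz_act x b.
    by rewrite /unitz_act /= smulZl scalerDr scalerA.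
  by rewrite (seminormZ hp) -mulrA ler_wpM2l ?normc_ge0// unitz_norm_act.
- move=> x y; apply: unitz_norm_le => [|b].
    by rewrite mulr_ge0 ?unitz_norm_ge0.
  rewrite unitz_actM (le_trans (unitz_norm_act _ _))// -mulrA.
  by rewrite ler_wpM2l ?unitz_norm_ge0 ?unitz_norm_act.
- move=> x; rewrite -[leRHS]sqr_sqrtr ?unitz_norm_ge0//.
  rewrite ler_pXn2r ?nnegrE ?sqrtr_ge0 ?unitz_norm_ge0//.
  apply: unitz_norm_le => [|b]; first exact: sqrtr_ge0.
  rewrite -(@ler_pXn2r _ 2) ?nnegrE ?mulr_ge0 ?sqrtr_ge0 ?(seminorm_ge0 hp)//.
  rewrite exprMn sqr_sqrtr ?unitz_norm_ge0//.
  rewrite -(seminorm_star_square hp) unitz_act_star.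
  rewrite (le_trans (seminormM hp _ _))// (seminorm_star hp) mulrC expr2 mulrA.
  by rewrite ler_wpM2r ?(seminorm_ge0 hp) ?unitz_norm_act.
Qed.

Definition unitz_in (a : A) : U := (a, 0).

(** By the C*-identity the norm of multiplication by [a] is attained on
   [star a]. *)
Lemma unitz_norm_in a : unitz_norm (unitz_in a) = p a.
Proof.
have actE b : unitz_act (unitz_in a) b = smul a b.
  by rewrite /unitz_act /= scale0r add0r.
apply/le_anti/andP; split.
  apply: unitz_norm_le => [|b]; first exact: seminorm_ge0.
  by rewrite actE seminormM.
have [->|a0] := eqVneq (p a) 0; first exact: unitz_norm_ge0.
have a_gt0 : 0 < p a by rewrite lt_neqAle eq_sym a0 (seminorm_ge0 hp).
rewrite -(ler_pM2r a_gt0) -expr2 -{2}(seminorm_star hp a).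
rewrite -(seminorm_star hp a) -(seminorm_star_square hp) starK -actE.
exact: unitz_norm_act.
Qed.

End Unitization.

(** * Positivity in a C*-seminormed algebra *)

Section Sos.
Context (R : realType) (A : starAlgType R).
Implicit Types a h k m w : A.

(** The values of the inner product of a Hilbert module are squares
   [star b ** b]; those of the direct sum [A (+) E] are sums of two of
   them. *)
Inductive sos : A -> Prop :=
| sos_square a : sos (smul (star a) a)
| sos_add h k : sos h -> sos k -> sos (h + k).

Lemma sos_sa h : sos h -> star h = h.
Proof.
by elim=> [a|x y _ IHx _ IHy]; rewrite ?star_squareE// starD IHx IHy.
Qed.

(** Inequalities between values of [p] are proved in the completion of the
   unitization, a unital C*-algebra in which [A] embeds isometrically. *)
Section Envelope.
Context (p : A -> R) (hp : cstar_seminorm p).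

Let B := completion (unitz_norm_cstar hp).
Let N : B -> R := @comp_norm _ _ _ (unitz_norm_cstar hp).
Let e : B := compC (unitz_norm_cstar hp) ((0, 1) : unitization A).
Let io (a : A) : B := compC (unitz_norm_cstar hp) (unitz_in a).

Let hN : cstar_seminorm N := comp_norm_cstar (unitz_norm_cstar hp).
Let N_eq0 : forall x, N x = 0 -> x = 0.
Proof. exact: comp_norm_eq0. Qed.
Let cN : seq_complete N := @completion_complete _ _ _ (unitz_norm_cstar hp).

Let mul1 x : smul e x = x.
Proof.
elim/completionW: x => u; rewrite /e cls_mulE; apply: cls_ext => i /=.
apply: unitz_eq; rewrite /= ?mul1r//.
by rewrite smul0l scaler0 scale1r !add0r.
Qed.

Let mulx1 x : smul x e = x.
Proof.
elim/completionW: x => u; rewrite /e cls_mulE; apply: cls_ext => i /=.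
apply: unitz_eq; rewrite /= ?mulr1//.
by rewrite smul0r scaler0 scale1r addr0 add0r.
Qed.

Let ioD a b : io (a + b) = io a + io b.
Proof.
by rewrite -compC_add; congr compC; apply: unitz_eq; rewrite /= ?addr0.
Qed.
Let ioM a b : io (smul a b) = smul (io a) (io b).
Proof.
rewrite -compC_mul; congr compC; apply: unitz_eq; rewrite /= ?mulr0//.
by rewrite !scale0r !addr0.
Qed.
Let ioS a : io (star a) = star (io a).
Proof.
rewrite -compC_star; congr compC; apply: unitz_eq => //=.
by apply/eqP; rewrite eq_complex /= oppr0 !eqxx.
Qed.
Let ioZ (c : R[i]) a : io (c *: a) = c *: io a.
Proof.
by rewrite -compC_scale; congr compC; apply: unitz_eq => //=; rewrite scaler0.
Qed.
Let ioB a b : io (a - b) = io a - io b.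
Proof. by rewrite ioD -scaleN1r ioZ scaleN1r. Qed.
Let N_io a : N (io a) = p a.
Proof. by rewrite /N comp_norm_compC unitz_norm_in. Qed.

Let sos_positive h : sos h -> positive e N (io h).
Proof.
elim=> [a|x y _ px _ py].
  rewrite ioM ioS.
  exact: (positive_star_square hN N_eq0 cN mul1 mulx1).
by rewrite ioD; exact: positiveD.
Qed.

(** For [r > p (h + k)], both [h / r] and
   [1 - h / r = (1 - (h + k) / r) + k / r] are positive. *)
Lemma seminorm_sosD h k : sos h -> sos k -> p h <= p (h + k).
Proof.
move=> /sos_positive ph /[dup] /sos_sa ks /sos_positive pk.
have hs := positive_sa ph.
apply/ler_addgt0Pr => eps eps0; pose r := p (h + k) + eps.
have r0 : 0 < r by rewrite ltr_wpDl ?(seminorm_ge0 hp).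
have ri : 0 <= r^-1 by rewrite invr_ge0 ltW.
suff : N (r^-1%:C *: io h) <= 1.
  rewrite (seminormZr hN) N_io gtr0_norm ?invr_gt0//.
  by rewrite mulrC ler_pdivrMr// mul1r.
apply: (norm_le1 hN N_eq0 cN mul1 mulx1); first exact: positiveZ.
have -> : e - r^-1%:C *: io h
    = (e - r^-1%:C *: io (h + k)) + r^-1%:C *: io k.
  by rewrite ioD scalerDr opprD addrA subrK.
apply: positiveD; [exact: hN| |exact: positiveZ].
apply: (positive_1B mulx1).
  by rewrite starZr ioD starD hs (positive_sa pk).
rewrite (seminormZr hN) N_io gtr0_norm ?invr_gt0//.
by rewrite mulrC ler_pdivrMr// mul1r lerDl ltW.
Qed.

(** Since [1 - k] is a square, [w^* w - w^* k w] is one as well, so that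
   [m - w^* w] is a sum of positive elements. *)
Lemma seminorm_schur k m w : star k = k -> p k <= 1 -> star m = m -> p m <= 1 ->
  sos (m - smul (star w) w - smul (star w) w + smul (smul (star w) k) w) ->
  p w <= 1.
Proof.
move=> ks k1 ms m1 /sos_positive pos.
have [d [ds d2 _ _]] := @sqrt1B _ _ e N hN N_eq0 cN mul1 mulx1 (io k)
  ltac:(by rewrite -ioS ks) ltac:(by rewrite N_io).
rewrite -(@ler_pXn2r _ 2) ?nnegrE ?(seminorm_ge0 hp)// expr1n.
rewrite -(seminorm_star_square hp) -N_io.
apply: (norm_le1 hN N_eq0 cN mul1 mulx1).
  rewrite ioM ioS; exact: (positive_star_square hN N_eq0 cN mul1 mulx1).
have dw : smul (star (smul d (io w))) (smul d (io w))
    = io (smul (star w) w) - io (smul (smul (star w) k) w).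
  rewrite starM ds smulA -(smulA (star (io w))) d2 smulBr mulx1 smulBl.
  by rewrite !ioM !ioS.
have -> : e - io (smul (star w) w) = (e - io m) + io (m - smul (star w) w
    - smul (star w) w + smul (smul (star w) k) w)
    + smul (star (smul d (io w))) (smul d (io w)).
  by rewrite dw ioD !ioB !addrA subrK [RHS]addrAC addrK subrK.
apply: positiveD; first exact: hN.
  apply: positiveD => //; apply: (positive_1B mulx1).
    by rewrite -ioS ms.
  by rewrite N_io.
exact: (positive_star_square hN N_eq0 cN mul1 mulx1).
Qed.

End Envelope.

End Sos.

(** * Inner products and operator bounds *)

Lemma normc_conj (R : realType) (c : R[i]) : Normc.normc c^* = Normc.normc c.
Proof. by case: c => a b; rewrite /Normc.normc /= sqrrN. Qed.

Section InnerProduct.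
Context (R : realType) (A : locCstarType R) (E : ipModType A).

Definition sos_inner : Prop := forall x : E, sos (inner x x).

Lemma ract0l a : ract (0 : E) a = 0.
Proof. by have := ractZl (0 : R[i]) (0 : E) a; rewrite !scale0r. Qed.

Lemma innerNr (x y : E) : inner x (- y) = - inner x y.
Proof. by rewrite -scaleN1r innerZr scaleN1r. Qed.

Lemma innerNl (x y : E) : inner (- x) y = - inner x y.
Proof. by rewrite -innerC innerNr starN innerC. Qed.

Lemma innerBr (x y z : E) : inner x (y - z) = inner x y - inner x z.
Proof. by rewrite innerDr innerNr. Qed.

Lemma innerBl (x y z : E) : inner (x - y) z = inner x z - inner y z.
Proof. by rewrite innerDl innerNl. Qed.

Context (hE : sos_inner) (p : A -> R) (hp : cstar_seminorm p).
Local Notation pb := (@pbar R A E p).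

Lemma pbar_ge0 (x : E) : 0 <= pb x.
Proof. exact: sqrtr_ge0. Qed.

Lemma pbar_sqr (x : E) : pb x ^+ 2 = p (inner x x).
Proof. by rewrite sqr_sqrtr// (seminorm_ge0 hp). Qed.

Lemma pbarZ (c : R[i]) (x : E) : pb (c *: x) = Normc.normc c * pb x.
Proof.
rewrite /pbar innerZl innerZr scalerA (seminormZ hp) Normc.normcM normc_conj.
by rewrite -expr2 sqrtrM ?sqr_ge0// sqrtr_sqr ger0_norm// normc_ge0.
Qed.

Lemma pbarZr (r : R) (x : E) : pb (r%:C *: x) = `|r| * pb x.
Proof. by rewrite pbarZ normc_real. Qed.

Lemma pbar0 : pb 0 = 0.
Proof. by rewrite -(scale0r (0 : E)) pbarZ Normc.normc0 mul0r. Qed.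

Lemma pbarN (x : E) : pb (- x) = pb x.
Proof. by rewrite -scaleN1r pbarZ normcN Normc.normc1 mul1r. Qed.

Lemma pbarBC (x y : E) : pb (x - y) = pb (y - x).
Proof. by rewrite -pbarN opprB. Qed.

(** After scaling [x] and [y] to the unit ball, positivity of the square of
   [y - x w] with [w = <x, y>] is what seminorm_schur asks for. *)
Theorem cauchy_schwarz (x y : E) : p (inner x y) <= pb x * pb y.
Proof.
have H (r s : R) : pb x < r -> pb y < s -> p (inner x y) <= r * s.
  move=> xr ys; have r0 : 0 < r by exact: le_lt_trans (pbar_ge0 x) xr.
  have s0 : 0 < s by exact: le_lt_trans (pbar_ge0 y) ys.
  pose x' := r^-1%:C *: x; pose y' := s^-1%:C *: y.
  have x1 : pb x' <= 1.
    by rewrite pbarZr gtr0_norm ?invr_gt0// mulrC ler_pdivrMr// mul1r ltW.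
  have y1 : pb y' <= 1.
    by rewrite pbarZr gtr0_norm ?invr_gt0// mulrC ler_pdivrMr// mul1r ltW.
  have : p (inner x' y') <= 1.
    apply: (@seminorm_schur _ _ p hp (inner x' x') (inner y' y')).
    - by rewrite innerC.
    - by rewrite -pbar_sqr expr_le1// pbar_ge0.
    - by rewrite innerC.
    - by rewrite -pbar_sqr expr_le1// pbar_ge0.
    have := hE (y' - ract x' (inner x' y')).
    rewrite innerBl !innerBr !innerMr !innerMl innerC.
    by rewrite opprB addrA addrAC.
  have conjr (t : R) : Num.conj t%:C = t%:C :> R[i].
    by apply/eqP; rewrite eq_complex /= oppr0 !eqxx.
  rewrite innerZl innerZr. rewrite conjr scalerA -rmorphM/= (seminormZr hp).
  rewrite gtr0_norm ?mulr_gt0 ?invr_gt0// -invfM mulrC ler_pdivrMr ?mulr_gt0//.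
  by rewrite mul1r.
rewrite leNgt; apply/negP; set c := p _ => cxy.
have x0 := pbar_ge0 x; have y0 := pbar_ge0 y.
pose d := c - pb x * pb y; have d0 : 0 < d by rewrite subr_gt0.
have k0 : 0 < pb x + pb y + 1 + d by lra.
pose t := d / (pb x + pb y + 1 + d).
have t0 : 0 < t by rewrite divr_gt0.
have t1 : t < 1 by rewrite ltr_pdivrMr// mul1r; lra.
have tk : t * (pb x + pb y + 1 + d) = d by rewrite divfK// gt_eqF.
have := H (pb x + t) (pb y + t); rewrite !ltrDl => /(_ t0 t0).
rewrite -/c; rewrite /d in tk d0 k0 *; nra.
Qed.

Lemma pbarD (x y : E) : pb (x + y) <= pb x + pb y.
Proof.
rewrite -(@ler_pXn2r _ 2) ?nnegrE ?addr_ge0 ?pbar_ge0// pbar_sqr.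
rewrite innerDl !innerDr.
have := seminormD hp (inner x x + inner x y) (inner y x + inner y y).
have := seminormD hp (inner x x) (inner x y).
have := seminormD hp (inner y x) (inner y y).
have := cauchy_schwarz x y; have := cauchy_schwarz y x.
rewrite -!pbar_sqr; nra.
Qed.

Lemma pbar_tri (y x z : E) : pb (x - z) <= pb (x - y) + pb (y - z).
Proof. by have := pbarD (x - y) (y - z); rewrite addrA subrK. Qed.

Lemma pbar_ract (x : E) (a : A) : pb (ract x a) <= pb x * p a.
Proof.
rewrite -(@ler_pXn2r _ 2) ?nnegrE ?mulr_ge0 ?pbar_ge0 ?(seminorm_ge0 hp)//.
rewrite pbar_sqr innerMl innerMr exprMn pbar_sqr.
rewrite (le_trans (seminormM hp _ _))// (seminorm_star hp) mulrC expr2 mulrA.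
by rewrite ler_wpM2r ?(seminorm_ge0 hp)// (seminormM hp).
Qed.

Lemma pbar_le (q : A -> R) (x : E) : (forall a, p a <= q a) ->
  pb x <= pbar q x.
Proof. by move=> pq; rewrite ler_wsqrtr. Qed.

Definition op_bound (T : E -> E) (M : R) : Prop :=
  forall x, pb (T x) <= M * pb x.

Implicit Types S T : adjointable E.

Lemma adj_funD T (x y : E) : T (x + y) = T x + T y.
Proof. by case: (adj_fun_map T). Qed.
Lemma adj_funZ T (c : R[i]) (x : E) : T (c *: x) = c *: T x.
Proof. by case: (adj_fun_map T). Qed.
Lemma adj_fun_ract T (x : E) a : T (ract x a) = ract (T x) a.
Proof. by case: (adj_fun_map T). Qed.
Lemma adj_oppE T (x : E) : (- T) x = - T x.
Proof. by rewrite -[RHS]scaleN1r. Qed.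
Lemma adj_subE S T (x : E) : (S - T) x = S x - T x.
Proof. by rewrite -adj_oppE. Qed.
Lemma adj_fun0 T : T 0 = 0.
Proof. by rewrite -(scale0r (0 : E)) adj_funZ !scale0r. Qed.

Lemma op_boundW T (M K : R) : M <= K -> op_bound T M -> op_bound T K.
Proof.
by move=> MK TM x; rewrite (le_trans (TM x))// ler_wpM2r// pbar_ge0.
Qed.

Lemma op_boundD S T (M K : R) : op_bound S M -> op_bound T K ->
  op_bound (S + T)%R (M + K).
Proof.
by move=> SM TK x; rewrite (le_trans (pbarD _ _))// mulrDl lerD.
Qed.

Lemma op_boundZ (c : R[i]) T (M : R) : op_bound T M ->
  op_bound (c *: T) (Normc.normc c * M).
Proof.
by move=> TM x; rewrite [leLHS]pbarZ -mulrA ler_wpM2l// normc_ge0.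
Qed.

Lemma op_boundN T (M : R) : op_bound T M -> op_bound (- T) M.
Proof. by move=> TM x; rewrite adj_oppE pbarN. Qed.

Lemma op_boundBC S T (M : R) : op_bound (S - T)%R M -> op_bound (T - S)%R M.
Proof. by move=> /op_boundN; rewrite opprB. Qed.

Lemma op_boundM S T (M K : R) : 0 <= M -> op_bound S M -> op_bound T K ->
  op_bound (smul S T) (M * K).
Proof.
by move=> M0 SM TK x; rewrite (le_trans (SM _))// -mulrA ler_wpM2l.
Qed.

Lemma op_bound_star T (M : R) : 0 <= M -> op_bound T M -> op_bound (star T) M.
Proof.
move=> M0 TM x; set y := star T x; have y0 := pbar_ge0 y.
have [->|yn] := eqVneq (pb y) 0; first by rewrite mulr_ge0 ?pbar_ge0.
have y_gt0 : 0 < pb y by rewrite lt_neqAle eq_sym yn.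
rewrite -(ler_pM2r y_gt0) -expr2 pbar_sqr {1}/y [inner _ _]adjPr.
rewrite (le_trans (cauchy_schwarz _ _))// mulrAC [leRHS]mulrC.
by rewrite ler_wpM2l ?pbar_ge0.
Qed.

(** The half of the C*-identity for operator seminorms that cstar_seminormP
   asks for. *)
Lemma op_bound_star_square T (M : R) : 0 <= M -> op_bound (smul (star T) T) M ->
  op_bound T (Num.sqrt M).
Proof.
move=> M0 TM x.
rewrite -(@ler_pXn2r _ 2) ?nnegrE ?mulr_ge0 ?sqrtr_ge0 ?pbar_ge0//.
rewrite pbar_sqr exprMn sqr_sqrtr// adjP (le_trans (cauchy_schwarz _ _))//.
by rewrite mulrC expr2 mulrA ler_wpM2r ?pbar_ge0//; exact: TM.
Qed.

Lemma theta_bound (x y : E) : op_bound (theta y x) (pb y * pb x).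
Proof.
move=> z /=; rewrite (le_trans (pbar_ract _ _))// -mulrA ler_wpM2l ?pbar_ge0//.
exact: cauchy_schwarz.
Qed.

End InnerProduct.

(** Passing to a smaller seminorm does not increase the operator seminorm: for
   [S = T^* T] and [pb x = 1], Cauchy-Schwarz gives
   [pb (T x) ^ 2 ^ j.+1 <= pb (S ^ 2 ^ j x)], and the larger seminorm bounds
   the right-hand side. *)
Lemma op_bound_le (R : realType) (A : locCstarType R) (E : ipModType A)
    (p q : A -> R) (T : adjointable E) (M : R) : sos_inner E ->
  cstar_seminorm p -> cstar_seminorm q -> (forall a, p a <= q a) -> 0 <= M ->
  op_bound q T M -> op_bound p T M.
Proof.
move=> hE hp hq pq M0 TM x.
have [x0|x0] := eqVneq (pbar p x) 0.
  rewrite x0 mulr0 -(@ler_pXn2r _ 2) ?nnegrE ?pbar_ge0// (pbar_sqr hp) adjP.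
  by rewrite (le_trans (cauchy_schwarz hE hp _ _))// x0 mul0r expr0n.
have x_gt0 : 0 < pbar p x by rewrite lt_neqAle eq_sym x0 pbar_ge0.
wlog x1 : x {x0} x_gt0 / pbar p x = 1.
  move=> H; have := H ((pbar p x)^-1%:C *: x).
  rewrite (pbarZr hp) gtr0_norm ?invr_gt0//.
  rewrite mulVf ?gt_eqF// => /(_ ltr01 erefl).
  rewrite adj_funZ (pbarZr hp) gtr0_norm ?invr_gt0// mulr1 mulrC.
  by rewrite ler_pdivrMr.
pose S j := iter j (fun S => smul S S) (smul (star T) T).
have Ss j : star (S j) = S j.
  by elim: j => [|j IH]; [exact: star_squareE|rewrite /= starM IH].
have sq_le (U : adjointable E) : star U = U ->
    pbar p (U x) ^+ 2 <= pbar p (smul U U x).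
  move=> Us; rewrite (pbar_sqr hp) adjP.
  have -> : adj_star U = adj_fun U by rewrite -{2}Us.
  by rewrite (le_trans (cauchy_schwarz hE hp _ _))// x1 mul1r.
have f0 : pbar p (T x) ^+ 2 <= pbar p (S 0%N x).
  rewrite (pbar_sqr hp) adjP.
  by rewrite (le_trans (cauchy_schwarz hE hp _ _))// x1 mul1r.
have fj j : (pbar p (T x) ^+ 2) ^+ (2 ^ j) <= pbar p (S j x).
  elim: j => [|j IH]; first by rewrite expr1.
  rewrite expnSr exprM (le_trans _ (sq_le _ (Ss j)))//.
  by rewrite ler_pXn2r ?nnegrE ?pbar_ge0// exprn_ge0// sqr_ge0.
have gj j : op_bound q (S j) ((M ^+ 2) ^+ (2 ^ j)).
  elim: j => [|j IH].
    rewrite expr1 expr2; apply: (op_boundM (p := q)) => //.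
    exact: (op_bound_star hE hq).
  rewrite expnSr exprM [X in op_bound _ _ X]expr2.
  by apply: (op_boundM (p := q)) => //; rewrite exprn_ge0// exprn_ge0.
rewrite x1 mulr1 -(@ler_pXn2r _ 2) ?nnegrE ?pbar_ge0//.
apply: (@pow2_bound _ (pbar q x)) => [||j]; rewrite ?sqr_ge0//.
rewrite (le_trans (fj j))// mulrC (le_trans _ (gj j x))//.
exact: pbar_le.
Qed.

(** * The topologies of Hilbert modules and of algebras of operators *)

Section SubbaseConvergence.
Context (T : choiceType) (D : set (set T)) (F : set_system T).

(** A filter converges as soon as it contains the subbasic neighbourhoods of
   the limit, since it is stable under finite intersections. *)
Lemma finI_from_filter (x : T) : Filter F -> (forall U, D U -> U x -> F U) ->
  forall V, finI_from D id V -> V x -> F V.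
Proof.
move=> FF HD V [s sD <-] Vx.
apply: filter_bigI => U Us; apply: HD; last exact: Vx.
by have := sD _ Us; rewrite inE.
Qed.

End SubbaseConvergence.

Section Topologies.
Context (R : realType) (A : locCstarType R) (E : ipModType A).

Lemma ip_top_cvg (F : set_system (ip_top E)) {FF : Filter F} (x : ip_top E) :
  (forall p (y : E) (e : R), csn A p -> pbar p ((x : E) - y) < e ->
     F [set z : E | pbar p (z - y) < e]) -> F --> x.
Proof.
move=> H U; rewrite nbhsE => -[B [[W WD WB] Bx] BU]; apply: filterS BU _.
rewrite -WB in Bx *; case: Bx => V WV Vx.
apply: (@filterS _ _ _ V) => [z Vz|]; first by exists V.
apply: finI_from_filter (WD _ WV) Vx => _ [p [y [e [cp e0 ->]]]] /=.
exact: H.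
Qed.

Lemma ip_top_nbhs (p : A -> R) (x : ip_top E) (y : E) (e : R) : csn A p ->
  0 < e -> pbar p ((x : E) - y) < e -> nbhs x [set z : E | pbar p (z - y) < e].
Proof.
move=> cp e0 xe; rewrite nbhsE; exists [set z : E | pbar p (z - y) < e] => //.
split=> //; exists [set [set z : E | pbar p (z - y) < e]].
  move=> _ ->; apply: finI_from1; rewrite /=.
  by exists p, y, e.
by rewrite bigcup_set1.
Qed.

Lemma adj_cvg (F : set_system (adjointable E)) {FF : Filter F}
    (S : adjointable E) :
  (forall p (T : adjointable E) (e : R), csn A p ->
     (ptilde p (S - T)%R < e%:E)%E ->
     F [set S' | (ptilde p (S' - T)%R < e%:E)%E]) -> F --> S.
Proof.
move=> H U; rewrite nbhsE => -[B [[W WD WB] Bx] BU]; apply: filterS BU _.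
rewrite -WB in Bx *; case: Bx => V WV Vx.
apply: (@filterS _ _ _ V) => [z Vz|]; first by exists V.
apply: finI_from_filter (WD _ WV) Vx => _ [p [y [e [cp e0 ->]]]] /=.
exact: H.
Qed.

Lemma adj_nbhs (p : A -> R) (S T : adjointable E) (e : R) : csn A p ->
  0 < e -> (ptilde p (S - T)%R < e%:E)%E ->
  nbhs S [set S' | (ptilde p (S' - T)%R < e%:E)%E].
Proof.
move=> cp e0 xe; rewrite nbhsE.
exists [set S' | (ptilde p (S' - T)%R < e%:E)%E] => //.
split=> //; exists [set [set S' | (ptilde p (S' - T)%R < e%:E)%E]].
  move=> _ ->; apply: finI_from1; rewrite /=.
  by exists p, T, e.
by rewrite bigcup_set1.
Qed.

Section Ptilde.
Context (p : A -> R) (hp : cstar_seminorm p).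
Implicit Types S T : adjointable E.

Lemma ptilde_ge0 T : (0 <= ptilde p T)%E.
Proof.
apply: ereal_sup_ubound; exists 0; rewrite /= ?adj_fun0 ?(pbar0 E hp)//.
Qed.

(** By homogeneity the unit ball suffices, also for vectors of seminorm 0, all
   multiples of which lie in that ball. *)
Lemma ptilde_leP T (M : R) : 0 <= M ->
  (ptilde p T <= M%:E)%E <-> op_bound p T M.
Proof.
move=> M0; split=> [TM x|TM]; last first.
  apply: ge_ereal_sup => _ [x /= x1 <-]; rewrite lee_fin.
  by rewrite (le_trans (TM x))// ler_piMr.
have H (y : E) : pbar p y <= 1 -> pbar p (T y) <= M.
  move=> y1; rewrite -lee_fin (le_trans _ TM)//.
  by apply: ereal_sup_ubound; exists y.
have [x0|x0] := eqVneq (pbar p x) 0; last first.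
  have x_gt0 : 0 < pbar p x by rewrite lt_neqAle eq_sym x0 pbar_ge0.
  have := H ((pbar p x)^-1%:C *: x); rewrite adj_funZ !(pbarZr hp).
  by rewrite gtr0_norm ?invr_gt0// mulVf// lexx mulrC ler_pdivrMr// => /(_ isT).
rewrite x0 mulr0 leNgt; apply/negP => Tx.
have := H (((M + 1) / pbar p (T x))%:C *: x); rewrite adj_funZ !(pbarZr hp).
rewrite x0 mulr0 ler01 gtr0_norm ?divr_gt0 ?ltr_wpDl// divfK ?gt_eqF//.
by move=> /(_ isT); rewrite gerDl ler10.
Qed.

Lemma ptilde_ltP T (e : R) : (ptilde p T < e%:E)%E <->
  exists M, [/\ 0 <= M, M < e & op_bound p T M].
Proof.
split=> [Te|[M [M0 Me TM]]]; last first.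
  by rewrite (@le_lt_trans _ _ M%:E) ?lte_fin//; apply/ptilde_leP.
have T0 := ptilde_ge0 T.
have Tfin : ptilde p T \is a fin_num.
  rewrite fin_numE; apply/andP; split; apply/eqP => Ti; rewrite Ti in Te T0 *;
  by [].
exists (fine (ptilde p T)); rewrite fine_ge0//; split=> //.
  by rewrite -lte_fin fineK.
by apply/ptilde_leP; rewrite ?fine_ge0// fineK.
Qed.

End Ptilde.

End Topologies.

(** * The direct sum and the linking operators *)

Section DirectSumNorms.
Context (R : realType) (A : locCstarType R).

Lemma hilbert_sos (E : hilbModType A) : sos_inner E.
Proof. by move=> x; have [b ->] := inner_pos x; exact: sos_square. Qed.

Lemma dsum_sos (E : ipModType A) : sos_inner E -> sos_inner (dsum E).
Proof. by move=> hE x; apply: sos_add => //; exact: sos_square. Qed.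

Context (E : ipModType A) (hE : sos_inner E) (p : A -> R)
  (hp : cstar_seminorm p).

(** [<z, z>] is the sum of [z.1^* z.1] and [<z.2, z.2>], and seminorms are
   monotone on sums of squares. *)
Lemma dsum_pbar_fst (z : dsum E) : p z.1 <= pbar p z.
Proof.
rewrite -(@ler_pXn2r _ 2) ?nnegrE ?pbar_ge0 ?(seminorm_ge0 hp)//.
rewrite (pbar_sqr hp) -(seminorm_star_square hp).
by apply: (seminorm_sosD hp) => //; exact: sos_square.
Qed.

Lemma dsum_pbar_snd (z : dsum E) : pbar p z.2 <= pbar p z.
Proof.
rewrite -(@ler_pXn2r _ 2) ?nnegrE ?pbar_ge0// !(pbar_sqr hp).
rewrite [X in _ <= p X]addrC.
by apply: (seminorm_sosD hp) => //; exact: sos_square.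
Qed.

Lemma dsum_pbar_le (z : dsum E) : pbar p z <= p z.1 + pbar p z.2.
Proof.
have z1 := seminorm_ge0 hp z.1; have z2 := pbar_ge0 p z.2.
rewrite -(@ler_pXn2r _ 2) ?nnegrE ?pbar_ge0 ?addr_ge0// (pbar_sqr hp).
rewrite (le_trans (seminormD hp _ _))// (seminorm_star_square hp).
rewrite -(pbar_sqr hp); nra.
Qed.

Lemma linkop_bound (a : A) (x y : E) (T : adjointable E) (M : R) : 0 <= M ->
  op_bound p T M -> op_bound p (linkop a x y T) (p a + pbar p x + pbar p y + M).
Proof.
move=> M0 TM z; rewrite (le_trans (dsum_pbar_le _))//=.
have z1 := dsum_pbar_fst z; have z2 := dsum_pbar_snd z.
have a0 := seminorm_ge0 hp a; have x0 := pbar_ge0 p x; have y0 := pbar_ge0 p y.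
have H1 : p (smul a z.1) <= p a * pbar p z.
  by rewrite (le_trans (seminormM hp _ _))// ler_wpM2l.
have H2 : p (inner x z.2) <= pbar p x * pbar p z.
  by rewrite (le_trans (cauchy_schwarz hE hp _ _))// ler_wpM2l.
have H3 : pbar p (ract y z.1) <= pbar p y * pbar p z.
  by rewrite (le_trans (pbar_ract hp _ _))// ler_wpM2l.
have H4 : pbar p (T z.2) <= M * pbar p z.
  by rewrite (le_trans (TM _))// ler_wpM2l.
have := seminormD hp (smul a z.1) (inner x z.2).
have := pbarD hE hp (ract y z.1) (T z.2).
rewrite !mulrDl; lra.
Qed.

Lemma linkop_add (a b : A) (x y z t : E) (S T : adjointable E) :
  linkop (a + b) (x + z) (y + t) (S + T) = linkop a x y S + linkop b z t T.
Proof.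
apply: adjointable_ext => w; apply: dsum_eq; rewrite /= /link_fun /=.
- by rewrite smulDl innerDl addrACA.
- by rewrite ractDl addrACA.
- by rewrite starD smulDl innerDl addrACA.
- by rewrite ractDl addrACA.
Qed.

Lemma linkop_scaleN (a : A) (x y : E) (T : adjointable E) :
  linkop (- a) (- x) (- y) (- T) = - linkop a x y T.
Proof.
apply/eqP; rewrite -addr_eq0 -linkop_add !addNr; apply/eqP.
by apply: adjointable_ext => w; apply: dsum_eq;
  rewrite /= /link_fun /= ?star0 ?smul0l ?inner0l ?ract0l ?addr0.
Qed.

Lemma linkop_sub (a b : A) (x y z t : E) (S T : adjointable E) :
  linkop (a - b) (x - z) (y - t) (S - T) = linkop a x y S - linkop b z t T.
Proof. by rewrite linkop_add linkop_scaleN. Qed.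

End DirectSumNorms.

(** * Morphisms of locally C*-algebras *)

Section LocCstarTheory.
Context (R : realType) (A : locCstarType R).

Lemma csn_nbhs (p : A -> R) (a : A) (e : R) : csn A p -> 0 < e ->
  nbhs a [set b | p (b - a) < e].
Proof.
move=> cp e0; have [_ _ _ _ pc] := cp; have hp := csn_seminorm cp.
have : (fun b => p (b - a)) @ a --> p (a - a).
  apply: (@continuous_comp A A R (fun b => b - a) p); last exact: pc.
  apply: (@continuous_comp A (A * A)%type A (fun b => (b, a))
    (fun x => x.1 - x.2)); last exact: sub_continuous.
  by apply: cvg_pair => /=; [exact: cvg_id|exact: cvg_cst].
rewrite subrr (seminorm0 hp) => /cvgrPdist_lt /(_ _ e0).
apply: filterS => b /=; rewrite sub0r normrN.
exact/le_lt_trans/ler_norm.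
Qed.

Lemma csn_separated (a b : A) : (forall p, csn A p -> p (a - b) = 0) -> a = b.
Proof. by move=> H; apply/eqP; rewrite -subr_eq0; apply/eqP/csn_eq0. Qed.

(** Two continuous C*-seminorms have a common bound, so that both can be made
   small at once. *)
Lemma csn_max (p q : A -> R) : csn A p -> csn A q ->
  csn A (fun a => Num.max (p a) (q a)).
Proof.
move=> cp cq; have hp := csn_seminorm cp; have hq := csn_seminorm cq.
have [_ _ _ _ pc] := cp; have [_ _ _ _ qc] := cq.
have max0 (r s : R) : 0 <= r -> 0 <= Num.max r s.
  by move=> r0; rewrite le_max r0.
split.
- move=> a b; rewrite ge_max; apply/andP; split.
  + rewrite (le_trans (seminormD hp _ _))// lerD// le_max lexx//.
  + by rewrite (le_trans (seminormD hq _ _))// lerD// le_max lexx orbT.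
- by move=> c a; rewrite (seminormZ hp) (seminormZ hq) maxr_pMr ?normc_ge0.
- move=> a b; rewrite ge_max; apply/andP; split.
  + rewrite (le_trans (seminormM hp _ _))// ler_pM ?(seminorm_ge0 hp)//;
      by rewrite le_max lexx.
  + rewrite (le_trans (seminormM hq _ _))// ler_pM ?(seminorm_ge0 hq)//;
      by rewrite le_max lexx orbT.
- move=> a; rewrite (seminorm_star_square hp) (seminorm_star_square hq).
  have p0 := seminorm_ge0 hp a; have q0 := seminorm_ge0 hq a.
  have [pq|qp] := leP (p a) (q a).
  + by rewrite max_r// ler_pXn2r.
  + by rewrite max_l// ler_pXn2r// ltW.
- by move=> a; apply: continuous_max; [exact: pc|exact: qc].
Qed.

Lemma csn_comp (B : locCstarType R) (f : A -> B) (p : B -> R) :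
  lc_morphism [set: A] [set: B] f -> csn B p -> csn A (fun a => p (f a)).
Proof.
move=> [_ fD fZ fM [fS fc]] [pD pZ pM pC pc]; split.
- by move=> a b; rewrite fD.
- by move=> c a; rewrite fZ.
- by move=> a b; rewrite fM.
- by move=> a; rewrite fM// fS.
- move=> a; apply: (@continuous_comp A B R f p); last exact: pc.
  exact: (proj2 (continuous_subspace_setT f) fc).
Qed.

Lemma lc_morphism_id : lc_morphism [set: A] [set: A] id.
Proof.
split=> //; split=> //; apply: (proj1 (continuous_subspace_setT _)) => a U Ua.
exact: Ua.
Qed.

End LocCstarTheory.

Lemma lc_morphism_comp (R : realType) (A B C : locCstarType R) (f : A -> B)
    (g : B -> C) :
  lc_morphism [set: A] [set: B] f -> lc_morphism [set: B] [set: C] g ->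
  lc_morphism [set: A] [set: C] (fun a => g (f a)).
Proof.
move=> [_ fD fZ fM [fS fc]] [_ gD gZ gM [gS gc]]; split=> //.
- by move=> a b _ _; rewrite fD// gD.
- by move=> c a _; rewrite fZ// gZ.
- by move=> a b _ _; rewrite fM// gM.
- split=> [a _|]; first by rewrite fS// gS.
  apply: (proj1 (continuous_subspace_setT _)) => a.
  apply: (@continuous_comp A B C f g).
    exact: (proj2 (continuous_subspace_setT f) fc).
  exact: (proj2 (continuous_subspace_setT g) gc).
Qed.

Section LcMorphismLinear.
Context (R : realType) (A B : locCstarType R) (f : A -> B).
Hypothesis hf : lc_morphism [set: A] [set: B] f.

Lemma lc_morphD a b : f (a + b) = f a + f b.
Proof. by case: hf => _ H _ _ _; exact: H. Qed.
Lemma lc_morphZ (c : R[i]) a : f (c *: a) = c *: f a.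
Proof. by case: hf => _ _ H _ _; exact: H. Qed.
Lemma lc_morphM a b : f (smul a b) = smul (f a) (f b).
Proof. by case: hf => _ _ _ H _; exact: H. Qed.
Lemma lc_morphS a : f (star a) = star (f a).
Proof. by case: hf => _ _ _ _ [H _]; exact: H. Qed.
Lemma lc_morphB a b : f (a - b) = f a - f b.
Proof. by rewrite lc_morphD -scaleN1r lc_morphZ scaleN1r. Qed.
Lemma lc_morph0 : f 0 = 0.
Proof. by rewrite -(scale0r (0 : A)) lc_morphZ !scale0r. Qed.
Lemma lc_morph_sum (n : nat) (F : 'I_n -> A) :
  f (\sum_(i < n) F i) = \sum_(i < n) f (F i).
Proof.
elim: n F => [|n IH] F; first by rewrite !big_ord0 lc_morph0.
by rewrite !big_ord_recr /= lc_morphD IH.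
Qed.

End LcMorphismLinear.

(** * Full modules *)
Section FullModule.
Context (R : realType) (A : locCstarType R) (E : hilbModType A).
Hypothesis hE : full_module E.

Lemma full_module_dense (a : A) (p : A -> R) (e : R) : csn A p -> 0 < e ->
  exists2 b, linear_span [set inner xy.1 xy.2 | xy in [set: E * E]] b &
    p (b - a) < e.
Proof.
move=> cp e0; have : [set: A] a by [].
rewrite -hE => /(_ _ (csn_nbhs a cp e0)) [b [sb ba]].
by exists b.
Qed.

(** The span of the inner products is dense, and [p \o f] and [p \o g] are
   themselves continuous C*-seminorms, in which the approximation can be
   made. *)
Lemma lc_morphism_full_ext (B : locCstarType R) (f g : A -> B) :
  lc_morphism [set: A] [set: B] f -> lc_morphism [set: A] [set: B] g ->
  (forall x y : E, f (inner x y) = g (inner x y)) -> forall a, f a = g a.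
Proof.
move=> hf hg fg a; apply: csn_separated => p cp; have hp := csn_seminorm cp.
have cf := csn_comp hf cp; have cg := csn_comp hg cp.
have cm := csn_max cf cg.
apply/le_anti; rewrite (seminorm_ge0 hp) andbT; apply/ler_addgt0Pr => e e0.
have e2 : 0 < e / 2 by rewrite divr_gt0.
have [b [n [c [v [vi ->]]]]] := full_module_dense a cm e2.
set s := \sum_(i < n) _; rewrite gt_max => /andP[fs gs].
have sfg : f s = g s.
  rewrite /s (lc_morph_sum hf) (lc_morph_sum hg); apply: eq_bigr => i _.
  rewrite (lc_morphZ hf) (lc_morphZ hg); congr (_ *: _).
  by have [[x y] _ <-] := vi i.
have := seminorm_tri hp (f s) (f a) (g a).
rewrite {2}sfg -(lc_morphB hf) -(lc_morphB hg).
by rewrite (seminormBC (csn_seminorm cf)); lra.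
Qed.

End FullModule.

(** * Transport of operators along a module automorphism *)

Section ModuleAutomorphisms.
Context (R : realType) (A : locCstarType R).

(** An automorphism of a module need not be [A]-linear: it is twisted by an
   automorphism of [A]. The inverses are stored, so that transport of
   operators is given by a formula. *)
Record mod_aut (E : ipModType A) := ModAut {
  ma_fun :> E -> E;
  ma_inv : E -> E;
  ma_alg : A -> A;
  ma_alg_inv : A -> A;
  ma_funK : cancel ma_fun ma_inv;
  ma_invK : cancel ma_inv ma_fun;
  ma_algK : cancel ma_alg_inv ma_alg;
  ma_alg_invK : cancel ma_alg ma_alg_inv;
  ma_funD : {morph ma_fun : x y / x + y};
  ma_funZ : forall (c : R[i]) x, ma_fun (c *: x) = c *: ma_fun x;
  ma_fun_ract : forall x a, ma_fun (ract x a) = ract (ma_fun x) (ma_alg a);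
  ma_invD : {morph ma_inv : x y / x + y};
  ma_invZ : forall (c : R[i]) x, ma_inv (c *: x) = c *: ma_inv x;
  ma_inv_ract : forall x a, ma_inv (ract x a) = ract (ma_inv x) (ma_alg_inv a);
  ma_inner : forall x y, inner (ma_fun x) (ma_fun y) = ma_alg (inner x y)
}.

Section Conjugation.
Context (E : ipModType A) (W : mod_aut E).

Lemma conj_op_map (f : E -> E) : module_map f ->
  module_map (fun x => W (f (ma_inv W x))).
Proof.
move=> [fD fZ fM]; split=> [x y|c x|x a].
- by rewrite ma_invD fD ma_funD.
- by rewrite ma_invZ fZ ma_funZ.
- by rewrite ma_inv_ract fM ma_fun_ract ma_algK.
Qed.

Lemma conj_opP (T : adjointable E) (x y : E) :
  inner (W (T (ma_inv W x))) y = inner x (W (adj_star T (ma_inv W y))).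
Proof.
by rewrite -{1}(ma_invK W y) -{2}(ma_invK W x) !ma_inner adjP.
Qed.

Definition conj_op (T : adjointable E) : adjointable E :=
  Adjointable (conj_op_map (adj_fun_map T)) (conj_op_map (adj_star_map T))
    (conj_opP T).

Lemma conj_opD : {morph conj_op : S T / S + T}.
Proof. by move=> S T; apply: adjointable_ext => x /=; rewrite ma_funD. Qed.

Lemma conj_opZ (c : R[i]) T : conj_op (c *: T) = c *: conj_op T.
Proof. by apply: adjointable_ext => x /=; rewrite ma_funZ. Qed.

Lemma conj_opB : {morph conj_op : S T / S - T}.
Proof. by move=> S T; rewrite conj_opD -scaleN1r conj_opZ scaleN1r. Qed.

Lemma conj_opM S T : conj_op (smul S T) = smul (conj_op S) (conj_op T).
Proof. by apply: adjointable_ext => x /=; rewrite ma_funK. Qed.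

Lemma conj_opS T : conj_op (star T) = star (conj_op T).
Proof. exact: adjointable_ext. Qed.

Lemma conj_op0 : conj_op 0 = 0.
Proof. by have := conj_opZ 0 0; rewrite !scale0r. Qed.

Lemma conj_op_theta (x y : E) : conj_op (theta x y) = theta (W x) (W y).
Proof.
by apply: adjointable_ext => z /=;
  rewrite ma_fun_ract -ma_inner ma_invK.
Qed.

Lemma pbar_ma (p : A -> R) (x : E) :
  pbar p (W x) = pbar (fun a => p (ma_alg W a)) x.
Proof. by rewrite /pbar ma_inner. Qed.

(** The automorphism carries the unit ball of the seminorm [p \o ma_alg W]
   onto that of [p]. *)
Lemma ptilde_conj_op (p : A -> R) T :
  ptilde p (conj_op T) = ptilde (fun a => p (ma_alg W a)) T.
Proof.
rewrite /ptilde; congr ereal_sup; apply/seteqP; split=> _ [x /= x1 <-].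
- exists (ma_inv W x); first by rewrite /= -pbar_ma ma_invK.
  by rewrite -pbar_ma.
- exists (W x); first by rewrite /= pbar_ma.
  by rewrite -pbar_ma /= ma_funK.
Qed.

End Conjugation.

Lemma ma_inv_inner (E : ipModType A) (W : mod_aut E) (x y : E) :
  inner (ma_inv W x) (ma_inv W y) = ma_alg_inv W (inner x y).
Proof. by rewrite -{2}(ma_invK W x) -{2}(ma_invK W y) ma_inner ma_alg_invK. Qed.

Definition ma_opp (E : ipModType A) (W : mod_aut E) : mod_aut E :=
  ModAut (ma_invK W) (ma_funK W) (ma_alg_invK W) (ma_algK W)
    (ma_invD W) (ma_invZ W) (ma_inv_ract W)
    (ma_funD W) (ma_funZ W) (ma_fun_ract W) (ma_inv_inner W).

Lemma conj_op_oppK (E : ipModType A) (W : mod_aut E) :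
  cancel (conj_op (ma_opp W)) (conj_op W).
Proof. by move=> T; apply: adjointable_ext => x /=; rewrite !ma_invK. Qed.

Lemma conj_opK (E : ipModType A) (W : mod_aut E) :
  cancel (conj_op W) (conj_op (ma_opp W)).
Proof. by move=> T; apply: adjointable_ext => x /=; rewrite !ma_funK. Qed.

(** Conjugation permutes the seminorms that define the topology. *)
Lemma conj_op_continuous (E : ipModType A) (W : mod_aut E) :
  lc_morphism [set: A] [set: A] (ma_alg W) -> continuous (conj_op W).
Proof.
move=> hW T; have FT : Filter (conj_op W @ T).
  exact: (@fmap_filter _ _ _ _ (nbhs_filter T)).
apply: adj_cvg => p S e cp.
rewrite -(conj_op_oppK W S) -conj_opB ptilde_conj_op => Te.
have ca := csn_comp hW cp.
have e0 : 0 < e.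
  by rewrite -lte_fin (le_lt_trans _ Te)// (ptilde_ge0 (csn_seminorm ca)).
apply: filterS (adj_nbhs ca e0 Te) => S' /=.
by rewrite -conj_opB ptilde_conj_op.
Qed.

Section DsumAut.
Context (E : ipModType A) (W : mod_aut E).
Hypothesis hW : lc_morphism [set: A] [set: A] (ma_alg W).

Definition dsum_fun (z : dsum E) : dsum E := (ma_alg W z.1, W z.2).
Definition dsum_inv (z : dsum E) : dsum E := (ma_alg_inv W z.1, ma_inv W z.2).

Let alg_invM a b :
  ma_alg_inv W (smul a b) = smul (ma_alg_inv W a) (ma_alg_inv W b).
Proof.
by apply: (can_inj (ma_alg_invK W)); rewrite (lc_morphM hW) !ma_algK.
Qed.
Let alg_invD a b : ma_alg_inv W (a + b) = ma_alg_inv W a + ma_alg_inv W b.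
Proof.
by apply: (can_inj (ma_alg_invK W)); rewrite (lc_morphD hW) !ma_algK.
Qed.
Let alg_invZ (c : R[i]) a : ma_alg_inv W (c *: a) = c *: ma_alg_inv W a.
Proof.
by apply: (can_inj (ma_alg_invK W)); rewrite (lc_morphZ hW) !ma_algK.
Qed.

Lemma dsum_funK : cancel dsum_fun dsum_inv.
Proof. by move=> z; apply: dsum_eq; rewrite /= ?ma_alg_invK ?ma_funK. Qed.
Lemma dsum_invK : cancel dsum_inv dsum_fun.
Proof. by move=> z; apply: dsum_eq; rewrite /= ?ma_algK ?ma_invK. Qed.
Lemma dsum_funD : {morph dsum_fun : x y / x + y}.
Proof. by move=> x y; apply: dsum_eq; rewrite /= ?(lc_morphD hW) ?ma_funD. Qed.
Lemma dsum_funZ (c : R[i]) x : dsum_fun (c *: x) = c *: dsum_fun x.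
Proof. by apply: dsum_eq; rewrite /= ?(lc_morphZ hW) ?ma_funZ. Qed.
Lemma dsum_fun_ract x a : dsum_fun (ract x a) = ract (dsum_fun x) (ma_alg W a).
Proof. by apply: dsum_eq; rewrite /= ?(lc_morphM hW) ?ma_fun_ract. Qed.
Lemma dsum_invD : {morph dsum_inv : x y / x + y}.
Proof. by move=> x y; apply: dsum_eq; rewrite /= ?alg_invD ?ma_invD. Qed.
Lemma dsum_invZ (c : R[i]) x : dsum_inv (c *: x) = c *: dsum_inv x.
Proof. by apply: dsum_eq; rewrite /= ?alg_invZ ?ma_invZ. Qed.
Lemma dsum_inv_ract x a :
  dsum_inv (ract x a) = ract (dsum_inv x) (ma_alg_inv W a).
Proof. by apply: dsum_eq; rewrite /= ?alg_invM ?ma_inv_ract. Qed.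
Lemma dsum_fun_inner x y :
  inner (dsum_fun x) (dsum_fun y) = ma_alg W (inner x y).
Proof.
rewrite /inner /= /dsum_inner /= ma_inner (lc_morphD hW) (lc_morphM hW).
by rewrite (lc_morphS hW).
Qed.

(** The twist itself is the automorphism of the summand [A]: multiplicativity
   gives [ma_fun_ract], and compatibility with [star] gives [ma_inner]. *)
Definition dsum_aut : mod_aut (dsum E) :=
  ModAut dsum_funK dsum_invK (ma_algK W) (ma_alg_invK W)
    dsum_funD dsum_funZ dsum_fun_ract dsum_invD dsum_invZ dsum_inv_ract
    dsum_fun_inner.

Lemma conj_op_linkop (a : A) (x y : E) (T : adjointable E) :
  conj_op dsum_aut (linkop a x y T)
  = linkop (ma_alg W a) (W x) (W y) (conj_op W T).
Proof.
apply: adjointable_ext => z; apply: dsum_eq; rewrite /= /link_fun /=.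
- rewrite (lc_morphD hW) (lc_morphM hW) ma_algK; congr (_ + _).
  by rewrite -ma_inner ma_invK.
- by rewrite ma_funD ma_fun_ract ma_algK.
- rewrite (lc_morphD hW) (lc_morphM hW) ma_algK (lc_morphS hW); congr (_ + _).
  by rewrite -ma_inner ma_invK.
- by rewrite ma_funD ma_fun_ract ma_algK.
Qed.

End DsumAut.

Lemma conj_op_compacts (E : ipModType A) (W : mod_aut E)
    (T : adjointable E) : lc_morphism [set: A] [set: A] (ma_alg W) ->
  compacts T -> compacts (conj_op W T).
Proof.
move=> hW KT U /(conj_op_continuous hW) /KT [S [[n [c [v [vi ->]]]] US]].
exists (conj_op W (\sum_(i < n) c i *: v i)); split=> //.
exists n, c, (fun i => conj_op W (v i)); split.
  move=> i; have [[x y] _ <-] := vi i; exists (W x, W y) => //.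
  by rewrite conj_op_theta.
elim: n c v {vi US} => [|n IH] c v; first by rewrite !big_ord0 conj_op0.
by rewrite !big_ord_recr /= conj_opD conj_opZ IH.
Qed.

(** The operators that conjugation maps into a closed *-subalgebra form one
   themselves, and they include the generators. *)
Lemma conj_op_linking (E : ipModType A) (W : mod_aut E)
    (hW : lc_morphism [set: A] [set: A] (ma_alg W)) (S : adjointable (dsum E)) :
  linking S -> linking (conj_op (dsum_aut hW) S).
Proof.
move=> LS D [[cD D0 DD DZ [DM DS]] genD].
apply: (LS [set S | D (conj_op (dsum_aut hW) S)]); split; last first.
  move=> _ [a [x [y [T [KT ->]]]]]; apply: genD; rewrite conj_op_linkop.
  exists (ma_alg W a), (W x), (W y), (conj_op W T); split=> //.
  exact: conj_op_compacts.
split; rewrite /=.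
- apply: (@preimage_closed _ _ (conj_op (dsum_aut hW))) cD.
  by move=> T _; exact: conj_op_continuous.
- by rewrite conj_op0.
- by move=> T U TD UD; rewrite conj_opD; exact: DD.
- by move=> c T TD; rewrite conj_opZ; exact: DZ.
- split=> [T U TD UD|T TD]; first by rewrite conj_opM; exact: DM.
  by rewrite conj_opS; exact: DS.
Qed.

End ModuleAutomorphisms.

(** * The induced actions *)

Section InducedActions.
Context (R : realType) (G : topGroupType) (A : locCstarType R)
  (E : hilbModType A) (u : G -> E -> E) (hu : mod_action u).
Hypothesis hE : full_module E.

Lemma mod_action1 x : u 1%g x = x.
Proof.
have [hiso hM] := hu; have [_ [v [_ uv _]]] := hiso 1%g.
by apply: (can_inj uv); rewrite -hM mul1g.
Qed.

Lemma mod_actionK g : cancel (u g) (u g^-1%g).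
Proof. by move=> x; have [_ hM] := hu; rewrite -hM mulVg mod_action1. Qed.

Lemma mod_actionVK g : cancel (u g^-1%g) (u g).
Proof. by move=> x; have [_ hM] := hu; rewrite -hM mulgV mod_action1. Qed.

Lemma twist_exists : exists alpha : G -> A -> A, forall g,
  lc_morphism [set: A] [set: A] (alpha g) /\
  forall x y, inner (u g x) (u g y) = alpha g (inner x y).
Proof.
have [f Hf] : {f : G -> A -> A & forall g,
    lc_morphism [set: A] [set: A] (f g) /\
    forall x y, inner (u g x) (u g y) = f g (inner x y)}.
  apply: (@choice G (A -> A) (fun g f => lc_morphism [set: A] [set: A] f /\
    forall x y, inner (u g x) (u g y) = f (inner x y))) => g.
  by have [hiso _] := hu; have [[f Hf] _] := hiso g; exists f.
by exists f.
Qed.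

Definition twist : G -> A -> A := projT1 (cid twist_exists).

Lemma twist_morph g : lc_morphism [set: A] [set: A] (twist g).
Proof. by have [] := projT2 (cid twist_exists) g. Qed.

Lemma twist_inner g x y : inner (u g x) (u g y) = twist g (inner x y).
Proof. by have [_ ] := projT2 (cid twist_exists) g; apply. Qed.

(** Fullness determines [twist g], hence the group law. *)
Lemma twistM g h a : twist (g * h)%g a = twist g (twist h a).
Proof.
apply: (lc_morphism_full_ext hE (twist_morph _)
  (lc_morphism_comp (twist_morph h) (twist_morph g))) => x y.
by rewrite -!twist_inner; have [_ hM] := hu; rewrite !hM.
Qed.

Lemma twist1 a : twist 1%g a = a.
Proof.
apply: (lc_morphism_full_ext hE (twist_morph _) (@lc_morphism_id _ A)) => x y.
by rewrite -twist_inner !mod_action1.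
Qed.

Lemma twistK g : cancel (twist g) (twist g^-1%g).
Proof. by move=> a; rewrite -twistM mulVg twist1. Qed.

Lemma twistVK g : cancel (twist g^-1%g) (twist g).
Proof. by move=> a; rewrite -twistM mulgV twist1. Qed.

Lemma inner_ext (x y : E) : (forall z, inner x z = inner y z) -> x = y.
Proof.
move=> xy; apply/eqP; rewrite -subr_eq0; apply/eqP/inner_eq0.
by rewrite innerBl xy subrr.
Qed.

(** [u g] is onto, and inner products with its values are computed by the
   twist: this is how its linearity is derived from its compatibility with
   inner products. *)
Lemma mod_action_ext g (x y : E) :
  (forall z, inner x (u g z) = inner y (u g z)) -> x = y.
Proof. by move=> xy; apply: inner_ext => z; rewrite -(mod_actionVK g z). Qed.

Lemma mod_actionD g : {morph u g : x y / x + y}.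
Proof.
move=> x y; apply: (@mod_action_ext g) => z.
by rewrite innerDl !twist_inner innerDl (lc_morphD (twist_morph g)).
Qed.

Lemma mod_actionZ g (c : R[i]) x : u g (c *: x) = c *: u g x.
Proof.
apply: (@mod_action_ext g) => z.
by rewrite innerZl !twist_inner innerZl (lc_morphZ (twist_morph g)).
Qed.

Lemma mod_action_ract g x a : u g (ract x a) = ract (u g x) (twist g a).
Proof.
apply: (@mod_action_ext g) => z.
rewrite innerMl !twist_inner innerMl (lc_morphM (twist_morph g)).
by rewrite (lc_morphS (twist_morph g)).
Qed.

Definition action_aut (g : G) : mod_aut E :=
  ModAut (mod_actionK g) (mod_actionVK g) (twistVK g) (twistK g)
    (mod_actionD g) (mod_actionZ g) (@mod_action_ract g)
    (mod_actionD g^-1%g) (mod_actionZ g^-1%g) (@mod_action_ract g^-1%g)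
    (twist_inner g).

Definition action_compacts (g : G) : adjointable E -> adjointable E :=
  conj_op (action_aut g).

Definition action_dsum (g : G) : mod_aut (dsum E) :=
  @dsum_aut R A E (action_aut g) (twist_morph g).

Definition action_linking (g : G) :
    adjointable (dsum E) -> adjointable (dsum E) :=
  conj_op (action_dsum g).

Lemma action_compactsM g h T :
  action_compacts (g * h)%g T = action_compacts g (action_compacts h T).
Proof.
have [_ hM] := hu.
by apply: adjointable_ext => x /=; rewrite invgM !hM.
Qed.

Lemma action_linkingM g h S :
  action_linking (g * h)%g S = action_linking g (action_linking h S).
Proof.
have [_ hM] := hu; apply: adjointable_ext => x; apply: dsum_eq;
  by rewrite /= /dsum_inv /= invgM !hM !twistM.
Qed.

Lemma action_compacts1 T : action_compacts 1%g T = T.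
Proof.
have := action_compactsM 1%g 1%g T; rewrite mul1g.
by move=> /(can_inj (conj_opK (action_aut 1%g))).
Qed.

Lemma action_linking1 S : action_linking 1%g S = S.
Proof.
have := action_linkingM 1%g 1%g S; rewrite mul1g.
by move=> /(can_inj (conj_opK (action_dsum 1%g))).
Qed.

Lemma conj_op_morphism (F : ipModType A) (W : mod_aut F)
    (D : set (adjointable F)) :
  lc_morphism [set: A] [set: A] (ma_alg W) ->
  (forall S, D S -> D (conj_op W S)) -> lc_morphism D D (conj_op W).
Proof.
move=> hW DW; split=> //.
- by move=> S T _ _; exact: conj_opD.
- by move=> c T _; exact: conj_opZ.
- by move=> S T _ _; exact: conj_opM.
- split; first by move=> S _; exact: conj_opS.
  exact/continuous_subspaceT/conj_op_continuous.
Qed.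

Lemma alg_action_of_group (B : topStarAlgType R) (D : set B) (f : G -> B -> B) :
  (forall g, lc_morphism D D (f g)) -> (forall b, D b -> f 1%g b = b) ->
  (forall g h b, D b -> f (g * h)%g b = f g (f h b)) -> alg_action D f.
Proof.
move=> fm f1 fM; split=> // g; split=> //; exists (f g^-1%g); split=> //.
- by move=> b Db; rewrite -fM// mulVg f1.
- by move=> b Db; rewrite -fM// mulgV f1.
Qed.

Lemma twist_action : induced_on_alg u twist.
Proof.
split; last by move=> g x y; rewrite twist_inner.
apply: alg_action_of_group => [g|b _|g h b _].
- exact: twist_morph.
- exact: twist1.
- exact: twistM.
Qed.

Lemma action_compacts_action : induced_on_compacts u action_compacts.
Proof.
split; last by move=> g x y; exact: conj_op_theta.
apply: alg_action_of_group => [g|b _|g h b _].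
- apply: conj_op_morphism; first exact: twist_morph.
  by move=> T; apply: conj_op_compacts; exact: twist_morph.
- exact: action_compacts1.
- exact: action_compactsM.
Qed.

Lemma action_linking_action : alg_action (@linking R A E) action_linking.
Proof.
apply: alg_action_of_group => [g|b _|g h b _].
- apply: conj_op_morphism; first exact: twist_morph.
  exact: conj_op_linking.
- exact: action_linking1.
- exact: action_linkingM.
Qed.

Lemma action_linking_linkop g (a : A) (x y : E) (T : adjointable E) :
  action_linking g (linkop a x y T)
  = linkop (twist g a) (u g x) (u g y) (action_compacts g T).
Proof. exact: conj_op_linkop. Qed.

End InducedActions.

(** * The invariant seminorms of an inverse limit action *)

Section CstarNorms.
Context (R : realType) (B : locCstarType R) (n : B -> R).
Hypothesis hn : csn B n.
Hypothesis n_cvg : forall F : set_system B, Filter F ->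
  (F --> (0 : B) <-> n @ F --> (0 : R)).

Lemma cstar_norm_nbhs (U : set B) : nbhs (0 : B) U ->
  exists2 d : R, 0 < d & forall b, n b < d -> U b.
Proof.
move=> U0.
pose F := filter_from [set d : R | 0 < d] (fun d => [set b | n b < d]).
have FF : Filter F.
  apply: filter_from_filter; first by exists 1 => /=.
  move=> d e d0 e0; exists (Num.min d e); first by rewrite /= lt_min d0 e0.
  by move=> b /=; rewrite lt_min => /andP[].
have /(n_cvg FF) : n @ F --> (0 : R).
  apply/cvgrPdist_lt => e e0; exists e => // b /=.
  by rewrite sub0r normrN ger0_norm// (seminorm_ge0 (csn_seminorm hn)).
by move=> /(_ _ U0) [d d0 dU]; exists d.
Qed.

(** A C*-seminorm is bounded near 0 in terms of the norm, by continuity, and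
   rigidity removes the constant. Applied to the norm of the values of a
   morphism it says that morphisms of C*-algebras are contractive. *)
Lemma csn_le_cstar_norm (p : B -> R) : csn B p -> forall b, p b <= n b.
Proof.
move=> cp; have [d d0 H] := cstar_norm_nbhs (csn_nbhs 0 cp ltr01).
apply: (cstar_seminorm_le_ball (csn_seminorm cp) (csn_seminorm hn) d0) => b.
by move=> /H; rewrite /= subr0 => /ltW.
Qed.

End CstarNorms.

Section LimitSeminorms.
Context (R : realType) (G : topGroupType) (A : locCstarType R)
  (E : hilbModType A) (u : G -> E -> E) (hu : mod_action u).
Hypothesis hE : full_module E.
Context (S : mod_inv_system R) (chi : forall l : sys_idx S, A -> sys_alg l)
  (sigma : forall l : sys_idx S, E -> msys_mod l)
  (ul : forall l : sys_idx S, G -> msys_mod l -> msys_mod l).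
Hypothesis lim : is_mod_limit chi sigma.
Hypothesis ul_action : forall l, mod_action (@ul l).
Hypothesis sigma_u : forall l g x, sigma l (u g x) = @ul l g (sigma l x).

Let chi_morph l : lc_morphism [set: A] [set: sys_alg l] (chi l).
Proof. by have [[H _ _ _ _] _ _ _ _] := lim; exact: H. Qed.

Definition level_norm (l : sys_idx S) : sys_alg l -> R :=
  projT1 (cid (sys_cstar R S l)).

Lemma level_norm_csn l : csn (sys_alg l) (@level_norm l).
Proof. by have [] := projT2 (cid (sys_cstar R S l)). Qed.

Lemma level_norm_cvg l (F : set_system (sys_alg l)) : Filter F ->
  (F --> (0 : sys_alg l) <-> @level_norm l @ F --> (0 : R)).
Proof. by have [_ _] := projT2 (cid (sys_cstar R S l)); exact. Qed.

Definition level_seminorm (l : sys_idx S) (a : A) : R := level_norm (chi l a).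

Lemma level_seminorm_csn l : csn A (level_seminorm l).
Proof. exact: csn_comp (chi_morph l) (level_norm_csn l). Qed.

Lemma level_seminorm_mono l m a : sys_le m l ->
  level_seminorm m a <= level_seminorm l a.
Proof.
move=> ml; have [[_ H _ _ _] _ _ _ _] := lim.
rewrite /level_seminorm -(H l m a ml)//.
exact: (csn_le_cstar_norm (level_norm_csn l) (@level_norm_cvg l)
  (csn_comp (sys_morph R S l m ml) (level_norm_csn m))).
Qed.

(** [A] carries the initial topology, so the filter of balls of all levels
   converges to 0; since [p] is continuous, one of these balls is mapped below
   1. *)
Lemma level_seminorm_cofinal (p : A -> R) : csn A p ->
  exists l, forall a, p a <= level_seminorm l a.
Proof.
move=> cp; have [[_ _ _ _ top] _ _ _ _] := lim.
have [[l0] _ _ dir] := sys_directed R S.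
pose F := filter_from [set ld : sys_idx S * R | 0 < ld.2]
  (fun ld => [set a | level_seminorm ld.1 a < ld.2]).
have FF : Filter F.
  apply: filter_from_filter; first by exists (l0, 1) => /=.
  move=> [l d] [m e] /= d0 e0; have [k [lk mk]] := dir l m.
  exists (k, Num.min d e); first by rewrite /= lt_min d0 e0.
  move=> a /=; rewrite lt_min => /andP[ad ae]; split.
    exact: le_lt_trans (level_seminorm_mono a lk) ad.
  exact: le_lt_trans (level_seminorm_mono a mk) ae.
have F0 : F --> (0 : A).
  apply: top => // [|l].
    by exists (l0, 1) => //= a.
  rewrite (lc_morph0 (chi_morph l)).
  have FFl : Filter (chi l @ F) by exact: fmap_filter.
  apply/(level_norm_cvg FFl)/cvgrPdist_lt => e e0; exists (l, e) => // a /=.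
  rewrite sub0r normrN ger0_norm//.
  exact: (seminorm_ge0 (csn_seminorm (level_norm_csn l))).
have [[l d] /= d0 H] := F0 _ (csn_nbhs 0 cp ltr01).
exists l; apply: (cstar_seminorm_le_ball (csn_seminorm cp)
  (csn_seminorm (level_seminorm_csn l)) d0) => a /H.
by rewrite /= subr0 => /ltW.
Qed.

(** The action on the module of level [l] is twisted by a morphism [b] of the
   C*-algebra of level [l], which is contractive; by fullness
   [chi l \o twist g = b \o chi l]. *)
Lemma level_seminorm_twist_le l g a :
  level_seminorm l (twist hu g a) <= level_seminorm l a.
Proof.
have [[_ _ _ _ _] [_ chi_inner] _ _ _] := lim.
have [uiso _] := ul_action l; have [[b [bm bin]] _] := uiso g.
have -> : level_seminorm l (twist hu g a) = level_norm (b (chi l a)).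
  congr level_norm.
  apply: (lc_morphism_full_ext hE
    (lc_morphism_comp (twist_morph hu g) (chi_morph l))
    (lc_morphism_comp (chi_morph l) bm)) => x y.
  by rewrite -twist_inner -!chi_inner !sigma_u bin.
exact: (csn_le_cstar_norm (level_norm_csn l) (@level_norm_cvg l)
  (csn_comp bm (level_norm_csn l))).
Qed.

Lemma level_seminorm_twist l g a :
  level_seminorm l (twist hu g a) = level_seminorm l a.
Proof.
apply/le_anti; rewrite level_seminorm_twist_le /=.
by rewrite -{1}(twistK hu hE g a) level_seminorm_twist_le.
Qed.

End LimitSeminorms.

(** * Continuity of the induced actions *)

Lemma op_bound0 (R : realType) (A : locCstarType R) (F : ipModType A)
    (p : A -> R) : cstar_seminorm p -> op_bound p (0 : adjointable F) 0.
Proof. by move=> hp x; rewrite mul0r [leLHS](pbar0 F hp). Qed.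
Arguments op_bound0 [R A] F [p].

Section ThetaLinear.
Context (R : realType) (A : locCstarType R) (F : ipModType A).
Implicit Types x y z : F.

Lemma theta_addl x y z : theta (x + y) z = theta x z + theta y z.
Proof.
by apply: adjointable_ext => t /=; rewrite ?innerDl ?ractDl ?ractDr.
Qed.

Lemma theta_addr x y z : theta z (x + y) = theta z x + theta z y.
Proof.
by apply: adjointable_ext => t /=; rewrite ?innerDl ?ractDl ?ractDr.
Qed.

Lemma theta_subl x y z : theta (x - y) z = theta x z - theta y z.
Proof. by rewrite -[in RHS](subrK y x) [in RHS]theta_addl addrK. Qed.

Lemma theta_subr x y z : theta z (x - y) = theta z x - theta z y.
Proof. by rewrite -[in RHS](subrK y x) [in RHS]theta_addr addrK. Qed.

End ThetaLinear.

Section CofinalFamily.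
Context (R : realType) (A : locCstarType R) (I : Type) (q : I -> A -> R).
Hypothesis q_csn : forall l, csn A (q l).
Hypothesis q_cofinal : forall p, csn A p -> exists l, forall a, p a <= q l a.
Let hq l : cstar_seminorm (q l) := csn_seminorm (q_csn l).
Context (F : ipModType A) (hF : sos_inner F).

Lemma adj_ball_cvg (Phi : set_system (adjointable F)) {FF : Filter Phi}
    (S : adjointable F) :
  (forall l (e : R), 0 < e -> Phi [set S' | op_bound (q l) (S' - S)%R e]) ->
  Phi --> S.
Proof.
move=> H; apply: adj_cvg => p T e cp; have hp := csn_seminorm cp.
move=> /(ptilde_ltP hp) [M [M0 Me ST]].
have [l pl] := q_cofinal cp.
have d0 : 0 < (e - M) / 2 by rewrite divr_gt0// subr_gt0.
apply: filterS (H l _ d0) => S' S'S /=; apply/(ptilde_ltP hp).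
exists ((e - M) / 2 + M); split; [by lra|by lra|].
have -> : S' - T = (S' - S) + (S - T) by rewrite addrA subrK.
apply: op_boundD => //.
by apply: (op_bound_le hF hp (hq l)) => //; exact: ltW.
Qed.

Lemma adj_ball_nbhs l (S : adjointable F) (e : R) : 0 < e ->
  nbhs S [set S' | op_bound (q l) (S' - S)%R e].
Proof.
move=> e0; have := @adj_nbhs _ _ _ (q l) S S e (q_csn l) e0.
rewrite subrr => H; apply: filterS (H _) => [S' /= /(ptilde_ltP (hq l))|].
  by move=> [M [M0 Me SM]]; apply: op_boundW SM; exact: ltW.
apply/(ptilde_ltP (hq l)); exists 0; split=> //; exact: op_bound0.
Qed.

End CofinalFamily.

Section ContinuousOrbits.
Context (R : realType) (G : topGroupType) (A : locCstarType R) (I : Type)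
  (q : I -> A -> R).
Hypothesis q_csn : forall l, csn A (q l).
Hypothesis q_cofinal : forall p, csn A p -> exists l, forall a, p a <= q l a.
Let hq l : cstar_seminorm (q l) := csn_seminorm (q_csn l).
Context (F : ipModType A) (hF : sos_inner F) (W : G -> mod_aut F).
Hypothesis W_q : forall l g a, q l (ma_alg (W g) a) = q l a.
Implicit Types S T : adjointable F.

Lemma pbar_invariant l g x : pbar (q l) (W g x) = pbar (q l) x.
Proof. by rewrite pbar_ma /pbar W_q. Qed.

Lemma op_bound_conj l g T M :
  op_bound (q l) T M -> op_bound (q l) (conj_op (W g) T) M.
Proof.
move=> TM x; rewrite /= pbar_invariant (le_trans (TM _))//.
by rewrite -{2}(ma_invK (W g) x) pbar_invariant.
Qed.

(** Boundedness is included because the orbit of a product is estimated by the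
   bounds of its factors. *)
Definition continuous_orbit T : Prop :=
  (forall l, exists2 M : R, 0 <= M & op_bound (q l) T M) /\
  (forall g0 l (e : R), 0 < e -> nbhs g0
    [set g | op_bound (q l) (conj_op (W g) T - conj_op (W g0) T)%R e]).

Lemma continuous_orbit0 : continuous_orbit 0.
Proof.
split=> [l|g0 l e e0]; first by exists 0 => //; exact: op_bound0.
apply: nearW => g.
suff H : op_bound (q l) (conj_op (W g) 0 - conj_op (W g0) 0)%R e by exact: H.
rewrite !conj_op0 subrr.
by apply: op_boundW (op_bound0 F (hq l)); exact: ltW.
Qed.

Lemma continuous_orbitD S T :
  continuous_orbit S -> continuous_orbit T -> continuous_orbit (S + T).
Proof.
move=> [bS cS] [bT cT]; split=> [l|g0 l e e0].
  have [M M0 SM] := bS l; have [K K0 TK] := bT l.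
  by exists (M + K); [exact: addr_ge0|exact: op_boundD].
have e2 : 0 < e / 2 by rewrite divr_gt0.
apply: filterS2 (cS g0 l _ e2) (cT g0 l _ e2) => g; rewrite /mkset => Sg Tg.
rewrite !conj_opD opprD addrACA [e]splitr; exact: op_boundD.
Qed.

Lemma continuous_orbitZ (c : R[i]) T :
  continuous_orbit T -> continuous_orbit (c *: T).
Proof.
move=> [bT cT]; have c0 := normc_ge0 c; split=> [l|g0 l e e0].
  have [K K0 TK] := bT l.
  exists (Normc.normc c * K); first exact: mulr_ge0.
  exact: op_boundZ.
have c1 : 0 < Normc.normc c + 1 by rewrite ltr_wpDl.
apply: filterS (cT g0 l _ (divr_gt0 e0 c1)) => g; rewrite /mkset => Tg.
rewrite !conj_opZ -scalerBr.
apply: (op_boundW (M := Normc.normc c * (e / (Normc.normc c + 1)))).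
  by rewrite mulrA ler_pdivrMr// mulrC ler_pM2l// lerDl.
exact: op_boundZ.
Qed.

Lemma continuous_orbitM S T :
  continuous_orbit S -> continuous_orbit T -> continuous_orbit (smul S T).
Proof.
move=> [bS cS] [bT cT]; split=> [l|g0 l e e0].
  have [M M0 SM] := bS l; have [K K0 TK] := bT l.
  by exists (M * K); [exact: mulr_ge0|exact: op_boundM].
have [M M0 SM] := bS l; have [K K0 TK] := bT l.
have M1 : 0 < M + 1 by rewrite ltr_wpDl.
have K1 : 0 < K + 1 by rewrite ltr_wpDl.
have e2 : 0 < e / 2 by rewrite divr_gt0.
apply: filterS2 (cS g0 l _ (divr_gt0 e2 K1)) (cT g0 l _ (divr_gt0 e2 M1)).
move=> g; rewrite /mkset => Sg Tg.
have -> : conj_op (W g) (smul S T) - conj_op (W g0) (smul S T)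
    = smul (conj_op (W g) S) (conj_op (W g) T - conj_op (W g0) T)
    + smul (conj_op (W g) S - conj_op (W g0) S) (conj_op (W g0) T).
  by rewrite !conj_opM smulBr smulBl addrA subrK.
rewrite [e]splitr; apply: op_boundD => //.
- apply: (op_boundW (M := M * (e / 2 / (M + 1)))).
    by rewrite mulrA ler_pdivrMr// mulrC ler_pM2l// lerDl.
  by apply: op_boundM => //; exact: op_bound_conj.
- apply: (op_boundW (M := (e / 2 / (K + 1)) * K)).
    by rewrite mulrAC ler_pdivrMr// ler_pM2l// lerDl.
  apply: op_boundM => //; last exact: op_bound_conj.
  by rewrite ltW// divr_gt0.
Qed.

Lemma continuous_orbitS T : continuous_orbit T -> continuous_orbit (star T).
Proof.
move=> [bT cT]; split=> [l|g0 l e e0].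
  have [K K0 TK] := bT l.
  by exists K => //; exact: op_bound_star.
apply: filterS (cT g0 l _ e0) => g; rewrite /mkset => Tg.
by rewrite !conj_opS -starB; apply: op_bound_star => //; exact: ltW.
Qed.

(** The group acts by isometries, so that orbits which are uniformly close to
   a continuous one are nearly continuous. *)
Lemma continuous_orbit_closed : closed continuous_orbit.
Proof.
move=> T clT; split=> [l|g0 l e e0].
  have [T1 [[bT _] T1T]] := clT _ (adj_ball_nbhs q_csn l T ltr01).
  have [M M0 TM] := bT l; exists (1 + M); first exact: addr_ge0.
  rewrite -[T](subrK T1); apply: op_boundD => //.
  exact: op_boundBC.
have e3 : 0 < e / 3 by rewrite divr_gt0.
have [T1 [[_ cT] T1T]] := clT _ (adj_ball_nbhs q_csn l T e3).
apply: filterS (cT g0 l _ e3) => g; rewrite /mkset => Tg.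
have -> : conj_op (W g) T - conj_op (W g0) T
    = conj_op (W g) (T - T1) + (conj_op (W g) T1 - conj_op (W g0) T1)
    + conj_op (W g0) (T1 - T).
  by rewrite !conj_opB !addrA !subrK.
have -> : e = e / 3 + e / 3 + e / 3 by field.
apply: op_boundD => //; last exact: op_bound_conj.
by apply: op_boundD => //; apply: op_bound_conj; exact: op_boundBC.
Qed.

Lemma continuous_orbit_subalgebra :
  @closed_star_subalgebra R (adjointable F) continuous_orbit.
Proof.
split.
- exact: continuous_orbit_closed.
- exact: continuous_orbit0.
- exact: continuous_orbitD.
- exact: continuous_orbitZ.
- by split; [exact: continuous_orbitM|exact: continuous_orbitS].
Qed.

(** Joint continuity follows from the continuity of the orbits, as the action
   is isometric for each of the seminorms. *)
Lemma continuous_orbit_joint (D : set (adjointable F)) :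
  D `<=` continuous_orbit ->
  {within [set: G] `*` D, continuous
    (fun gS : G * adjointable F => conj_op (W gS.1) gS.2)}.
Proof.
move=> Dc; apply/subspace_continuousP => -[g0 S0] [_ /= DS0].
set Phi := _ @ _; have FF : Filter Phi by exact: fmap_filter.
apply: (adj_ball_cvg q_csn q_cofinal hF) => l e e0.
have e2 : 0 < e / 2 by rewrite divr_gt0.
have [_ c0] := Dc _ DS0.
apply: cvg_within.
exists ([set g |
    op_bound (q l) (conj_op (W g) S0 - conj_op (W g0) S0)%R (e / 2)],
  [set S | op_bound (q l) (S - S0)%R (e / 2)]).
  by split; [exact: c0|exact: adj_ball_nbhs].
move=> [g S] [gS SS0].
suff H : op_bound (q l) (conj_op (W g) S - conj_op (W g0) S0)%R e by exact: H.
have -> : conj_op (W g) S - conj_op (W g0) S0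
    = conj_op (W g) (S - S0) + (conj_op (W g) S0 - conj_op (W g0) S0).
  by rewrite conj_opB addrA subrK.
by rewrite [e]splitr; apply: op_boundD => //; exact: op_bound_conj.
Qed.

End ContinuousOrbits.

Section ContinuousInduced.
Context (R : realType) (G : topGroupType) (A : locCstarType R)
  (E : hilbModType A) (u : G -> E -> E) (hu : mod_action u).
Hypothesis hE : full_module E.
Context (I : Type) (q : I -> A -> R).
Hypothesis q_csn : forall l, csn A (q l).
Hypothesis q_cofinal : forall p, csn A p -> exists l, forall a, p a <= q l a.
Hypothesis q_twist : forall l g a, q l (twist hu g a) = q l a.
Hypothesis u_continuous :
  continuous (fun gx : G * ip_top E => u gx.1 gx.2 : ip_top E).
Let hq l : cstar_seminorm (q l) := csn_seminorm (q_csn l).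
Let sE := @hilbert_sos R A E.
Let pbar_u l g x : pbar (q l) (u g x) = pbar (q l) x.
Proof. by rewrite /pbar (twist_inner hu) q_twist. Qed.

Lemma mod_orbit_continuous (x : E) g0 l (e : R) : 0 < e ->
  nbhs g0 [set g | pbar (q l) (u g x - u g0 x) < e].
Proof.
move=> e0.
have V : nbhs (u g0 x : ip_top E) [set y : E | pbar (q l) (y - u g0 x) < e].
  by apply: ip_top_nbhs => //; rewrite subrr (pbar0 E (hq l)).
have [[P Q] [/= Pg Qx] PQ] := @u_continuous (g0, x : ip_top E) _ V.
apply: filterS Pg => g Pg.
by apply: (PQ (g, x)); split=> //=; exact: (@nbhs_singleton (ip_top E) _ _ Qx).
Qed.

Lemma theta_orbit (x y : E) :
  continuous_orbit q (@action_aut _ _ _ _ _ hu hE) (theta x y).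
Proof.
split=> [l|g0 l e e0].
  exists (pbar (q l) x * pbar (q l) y); last exact: theta_bound.
  by rewrite mulr_ge0 ?pbar_ge0.
have x0 : 0 < pbar (q l) x + 1 by rewrite ltr_wpDl ?pbar_ge0.
have y0 : 0 < pbar (q l) y + 1 by rewrite ltr_wpDl ?pbar_ge0.
have e2 : 0 < e / 2 by rewrite divr_gt0.
apply: filterS2 (mod_orbit_continuous x g0 l (divr_gt0 e2 y0))
  (mod_orbit_continuous y g0 l (divr_gt0 e2 x0)) => g; rewrite /mkset => gx gy.
rewrite !conj_op_theta [ma_fun _]/= [ma_fun _]/=.
have -> : theta (u g x) (u g y) - theta (u g0 x) (u g0 y)
    = theta (u g x - u g0 x) (u g y) + theta (u g0 x) (u g y - u g0 y).
  by rewrite theta_subl theta_subr addrA subrK.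
rewrite [e]splitr; apply: op_boundD => //.
- apply: op_boundW (theta_bound sE (hq l) _ _).
  rewrite pbar_u; move: gx; rewrite ltr_pdivlMr//; have := pbar_ge0 (q l) y.
  have := pbar_ge0 (q l) (u g x - u g0 x); nra.
- apply: op_boundW (theta_bound sE (hq l) _ _).
  rewrite pbar_u; move: gy; rewrite ltr_pdivlMr//; have := pbar_ge0 (q l) x.
  have := pbar_ge0 (q l) (u g y - u g0 y); nra.
Qed.

Let Wq l g a : q l (ma_alg (@action_aut _ _ _ _ _ hu hE g) a) = q l a.
Proof. exact: q_twist. Qed.

Lemma compacts_orbit (T : adjointable E) : compacts T ->
  continuous_orbit q (@action_aut _ _ _ _ _ hu hE) T.
Proof.
move=> KT; apply: (continuous_orbit_closed q_csn sE Wq).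
apply: (closureS _ KT) => _ [n [c [v [vi ->]]]] /=.
elim: n c v vi => [|n IH] c v vi.
  by rewrite big_ord0; exact: continuous_orbit0.
rewrite big_ord_recr /=; apply: (continuous_orbitD q_csn sE).
  exact: IH.
by apply: (continuous_orbitZ q_csn); have [[x y] _ <-] := vi ord_max;
  exact: theta_orbit.
Qed.

(** Clear on inner products by Cauchy-Schwarz; it spreads to the closure of
   their span because the twists are isometric. *)
Lemma twist_orbit (a : A) g0 l (e : R) : 0 < e ->
  nbhs g0 [set g | q l (twist hu g a - twist hu g0 a) < e].
Proof.
have inn (x y : E) : forall e : R, 0 < e -> nbhs g0 [set g |
    q l (twist hu g (inner x y) - twist hu g0 (inner x y)) < e].
  move=> {}e e0.
  have x0 : 0 < pbar (q l) x + 1 by rewrite ltr_wpDl ?pbar_ge0.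
  have y0 : 0 < pbar (q l) y + 1 by rewrite ltr_wpDl ?pbar_ge0.
  have e2 : 0 < e / 2 by rewrite divr_gt0.
  have Hx := mod_orbit_continuous x g0 l (divr_gt0 e2 y0).
  have Hy := mod_orbit_continuous y g0 l (divr_gt0 e2 x0).
  apply: filterS2 Hx Hy => g /= gx gy.
  rewrite -!twist_inner.
  have -> : inner (u g x) (u g y) - inner (u g0 x) (u g0 y)
      = inner (u g x - u g0 x) (u g y) + inner (u g0 x) (u g y - u g0 y).
    by rewrite innerBl innerBr addrA subrK.
  rewrite (le_lt_trans (seminormD (hq l) _ _))//.
  have := cauchy_schwarz sE (hq l) (u g x - u g0 x) (u g y).
  have := cauchy_schwarz sE (hq l) (u g0 x) (u g y - u g0 y).
  rewrite !pbar_u; move: gx gy; rewrite !ltr_pdivlMr//.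
  have := pbar_ge0 (q l) x; have := pbar_ge0 (q l) y.
  have := pbar_ge0 (q l) (u g x - u g0 x).
  have := pbar_ge0 (q l) (u g y - u g0 y); nra.
have spn b : linear_span [set inner xy.1 xy.2 | xy in [set: E * E]] b ->
    forall e : R, 0 < e ->
    nbhs g0 [set g | q l (twist hu g b - twist hu g0 b) < e].
  move=> [n [c [v [vi ->]]]].
  elim: n c v vi => [|n IH] c v vi {}e e0.
    apply: nearW => g; rewrite /= big_ord0 !(lc_morph0 (twist_morph hu _)).
    by rewrite subrr (seminorm0 (hq l)).
  have e2 : 0 < e / 2 by rewrite divr_gt0.
  have c1 : 0 < Normc.normc (c ord_max) + 1 by rewrite ltr_wpDl ?normc_ge0.
  have [[x y] _ vxy] := vi ord_max.
  have H1 := IH (fun i => c (widen_ord (leqnSn n) i))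
    (fun i => v (widen_ord (leqnSn n) i)) (fun i => vi _) _ e2.
  apply: filterS2 H1 (inn x y _ (divr_gt0 e2 c1)) => g /= H1.
  rewrite big_ord_recr /= -vxy !(lc_morphD (twist_morph hu _)).
  rewrite !(lc_morphZ (twist_morph hu _)) opprD addrACA -scalerBr => H2.
  rewrite (le_lt_trans (seminormD (hq l) _ _))// (seminormZ (hq l)).
  rewrite [e]splitr ltrD//.
  move: H2; rewrite ltr_pdivlMr// => H2; apply: le_lt_trans H2.
  by rewrite mulrC ler_wpM2l ?(seminorm_ge0 (hq l))// lerDl.
move=> e0; have e3 : 0 < e / 3 by rewrite divr_gt0.
have [b sb ba] := full_module_dense hE a (q_csn l) e3.
apply: filterS (spn b sb _ e3) => g /= gb.
have := seminorm_tri (hq l) (twist hu g b) (twist hu g a) (twist hu g0 a).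
have := seminorm_tri (hq l) (twist hu g0 b) (twist hu g b) (twist hu g0 a).
rewrite -!(lc_morphB (twist_morph hu _)) !q_twist.
move: ba gb; rewrite (seminormBC (hq l) b a); lra.
Qed.

Let Wq' l g a :
  q l (ma_alg (@action_dsum _ _ _ _ _ hu hE g) a) = q l a.
Proof. exact: q_twist. Qed.

(** The operators with continuous orbits form a closed *-subalgebra, so that
   the generators suffice. *)
Lemma linking_orbit :
  @linking R A E `<=` continuous_orbit q (@action_dsum _ _ _ _ _ hu hE).
Proof.
move=> S LS; apply: LS; split.
  exact: (continuous_orbit_subalgebra q_csn (dsum_sos sE) Wq').
move=> _ [a [x [y [T [KT ->]]]]].
have [bT cT] := compacts_orbit KT.
split=> [l|g0 l e e0].
  have [M M0 TM] := bT l; exists (q l a + pbar (q l) x + pbar (q l) y + M).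
    by rewrite !addr_ge0 ?pbar_ge0 ?(seminorm_ge0 (hq l)).
  exact: linkop_bound.
have e4 : 0 < e / 4 by rewrite divr_gt0.
have H1 := twist_orbit a g0 l e4.
have H2 := mod_orbit_continuous x g0 l e4.
have H3 := mod_orbit_continuous y g0 l e4.
have H4 := cT g0 l _ e4.
apply: filterS2 (filterI H1 H2) (filterI H3 H4) => g [g1 g2] [g3 g4].
rewrite /mkset.
rewrite !conj_op_linkop -linkop_sub.
apply: op_boundW (linkop_bound sE (hq l) _ _ _ (ltW e4) g4).
move: g1 g2 g3 => /=; lra.
Qed.

Lemma action_linking_continuous :
  continuous_alg_action (@linking R A E) (action_linking hu hE).
Proof.
split; first exact: action_linking_action.
exact: (continuous_orbit_joint q_csn q_cofinal (dsum_sos sE) Wq' linking_orbit).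
Qed.

End ContinuousInduced.

(** * Completions are C*-algebras *)

Section CompletionCstar.
Context (R : realType) (A : starAlgType R) (p : A -> R)
  (hp : cstar_seminorm p).
Local Notation C := (completion hp).
Local Notation N := (@comp_norm _ _ _ hp).

Definition comp_normC (x : C) : R[i] := (N x)%:C.

Lemma comp_normC_D x y : comp_normC (x + y) <= comp_normC x + comp_normC y.
Proof.
by rewrite -rmorphD/= lecR; exact: seminormD (comp_norm_cstar hp) _ _.
Qed.

Lemma comp_normC_Z (c : R[i]) x : comp_normC (c *: x) = `|c| * comp_normC x.
Proof.
by rewrite /comp_normC (seminormZ (comp_norm_cstar hp)) rmorphM.
Qed.

Lemma comp_normC_eq0 x : comp_normC x = 0 -> x = 0.
Proof. by move=> /(congr1 (@complex.Re R)) /= /comp_norm_eq0. Qed.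

HB.instance Definition _ := Lmodule_isNormed.Build R[i] C
  comp_normC_D comp_normC_Z comp_normC_eq0.

Lemma comp_nbhsP (x : C) (U : set C) :
  nbhs x U <-> exists2 e : R, 0 < e & forall y, N (y - x) < e -> U y.
Proof.
split=> [/nbhs_normP[e e0 H]|[e e0 H]].
  have er : e = (complex.Re e)%:C.
    by rewrite RRe_real// ger0_real// ltW.
  exists (complex.Re e); first by rewrite -ltcR -er.
  move=> y xy; apply: H; rewrite /ball_ /= er [`|_|]/(comp_normC _) ltcR.
  by rewrite (seminormBC (comp_norm_cstar hp)).
rewrite -nbhs_nbhs_norm; exists e%:C; first by rewrite /= ltcR.
move=> y; rewrite /ball_ /= [`|_|]/(comp_normC _) ltcR => xy.
by apply: H; rewrite (seminormBC (comp_norm_cstar hp)).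
Qed.

Let hN := comp_norm_cstar hp.

Lemma comp_nbhs_ball (x : C) (e : R) : 0 < e -> nbhs x [set y | N (y - x) < e].
Proof. by move=> e0; apply/comp_nbhsP; exists e. Qed.

Lemma comp_cvgP (F : set_system C) (x : C) : Filter F ->
  (F --> x <-> forall e : R, 0 < e -> F [set y | N (y - x) < e]).
Proof.
move=> FF; split=> [Fx e e0|H U /comp_nbhsP[e e0 eU]].
  exact/Fx/comp_nbhs_ball.
exact: filterS eU (H e e0).
Qed.

Lemma comp_smul_continuous : continuous (fun ab : C * C => smul ab.1 ab.2).
Proof.
move=> [a b] U /comp_nbhsP[e e0 eU].
have e2 : 0 < e / 2 by rewrite divr_gt0.
have b1 : 0 < N b + 1 by rewrite ltr_wpDl ?(seminorm_ge0 hN).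
have a1 : 0 < N a + 1 by rewrite ltr_wpDl ?(seminorm_ge0 hN).
exists ([set x | N (x - a) < e / 2 / (N b + 1)],
  [set y | N (y - b) < Num.min 1 (e / 2 / (N a + 1))]).
  split; apply: comp_nbhs_ball; first by rewrite divr_gt0.
  by rewrite lt_min ltr01 divr_gt0.
move=> [x y] [] /=; rewrite lt_min => xa /andP[y1 yb]; apply: eU => /=.
have -> : smul x y - smul a b = smul (x - a) y + smul a (y - b).
  by rewrite smulBl smulBr addrA subrK.
rewrite (le_lt_trans (seminormD hN _ _))//.
have H1 := seminormM hN (x - a) y; have H2 := seminormM hN a (y - b).
have H3 := seminormD hN (y - b) b; rewrite subrK in H3.
move: xa yb; rewrite !ltr_pdivlMr// => xa yb.
have := seminorm_ge0 hN (x - a); have := seminorm_ge0 hN (y - b).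
have := seminorm_ge0 hN a; nra.
Qed.

Lemma comp_star_continuous : continuous (star : C -> C).
Proof.
move=> a U /comp_nbhsP[e e0 eU]; apply/comp_nbhsP; exists e => // y ye.
by apply: eU; rewrite -starB (seminorm_star hN).
Qed.

Lemma comp_hausdorff : hausdorff_space C.
Proof.
move=> x y xy; apply/eqP; rewrite -subr_eq0; apply/eqP.
apply: (seminorm_small hN (@comp_norm_eq0 _ _ _ hp)) => e e0.
have e2 : 0 < e / 2 by rewrite divr_gt0.
have [z [/= zx zy]] := xy _ _ (comp_nbhs_ball x e2) (comp_nbhs_ball y e2).
have := seminorm_tri hN z x y; rewrite (seminormBC hN x z); lra.
Qed.

(** Any two members of a Cauchy filter meet, so that one point in each of a
   sequence of members of vanishing diameter is enough. *)
Lemma comp_complete : add_complete C.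
Proof.
move=> F FF Fc.
have inv0 (n : nat) : 0 < n.+1%:R^-1 :> R by rewrite invr_gt0.
have [M HM] : {M : nat -> set C & forall n, F (M n) /\
    forall x y, M n x -> M n y -> N (x - y) < n.+1%:R^-1}.
  apply: (@choice nat (set C) (fun n M => F M /\
    forall x y, M x -> M y -> N (x - y) < n.+1%:R^-1)) => n.
  have [M FM H] := Fc _ (comp_nbhs_ball 0 (inv0 n)).
  by exists M; split=> // x y Mx My; have := H _ _ Mx My; rewrite /= subr0.
have [x Hx] : {x : nat -> C & forall n, M n (x n)}.
  by apply: (@choice nat C M) => n; have /filter_ex[y My] := (HM n).1; exists y.
have small (e : R) : 0 < e -> exists n0, forall n, (n0 <= n)%N ->
    (n.+1%:R^-1 : R) < e.
  move=> e0; have [n0 _ Hn] := near_infty_natSinv_lt (PosNum e0).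
  by exists n0 => n; exact: Hn.
have cx : cauchy_seq N x.
  move=> e e0; have [n0 Hn] := small _ (divr_gt0 e0 (ltr0n _ 2)).
  exists n0 => i j /Hn ie /Hn je.
  have Fij : F (M i `&` M j).
    by apply: filterI; [exact: (HM i).1|exact: (HM j).1].
  have [z [zi zj]] := filter_ex Fij.
  have := (HM i).2 _ _ (Hx i) zi; have := (HM j).2 _ _ zj (Hx j).
  have := seminorm_tri hN z (x i) (x j).
  move: (i.+1%:R^-1) (j.+1%:R^-1) ie je => r s; lra.
have [l xl] := completion_complete cx; exists l.
apply/comp_cvgP => e e0; have e2 : 0 < e / 2 by rewrite divr_gt0.
have [n0 Hn] := small _ e2; have [n1 Hn1] := xl _ e2.
pose n := maxn n0 n1.
apply: filterS (HM n).1 => y My /=.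
have := (HM n).2 _ _ My (Hx n); have := Hn n (leq_maxl _ _).
have := Hn1 n (leq_maxr _ _).
have := seminorm_tri hN (x n) y l; move: (n.+1%:R^-1) => r; lra.
Qed.

Lemma comp_norm_continuous : continuous (N : C -> R).
Proof.
move=> x; apply/(cvgrPdist_lt (FF := nbhs_filter x)) => e e0.
apply: (@filterS _ _ (nbhs_filter x) _ _ _ (comp_nbhs_ball x e0)) => y /= yx.
by rewrite distrC (le_lt_trans (seminorm_dist hN _ _)).
Qed.

Lemma comp_cvg0 (F : set_system C) : Filter F ->
  (F --> (0 : C) <-> N @ F --> (0 : R)).
Proof.
move=> FF; split=> [F0|/cvgrPdist_lt F0].
  rewrite -(seminorm0 hN); apply: (cvg_trans _ (@comp_norm_continuous 0)).
  by move=> U /F0.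
apply/comp_cvgP => e /F0; apply: filterS => y /=.
by rewrite subr0 sub0r normrN; exact/le_lt_trans/ler_norm.
Qed.

End CompletionCstar.

Section CompletionInstance.
Context (R : realType) (A : starAlgType R) (p : A -> R)
  (hp : cstar_seminorm p).
Local Notation C := (completion hp).
Local Notation N := (@comp_norm _ _ _ hp).

Lemma comp_norm_csn : csn C (N : C -> R).
Proof.
have [H1 H2 H3 H4] := comp_norm_cstar hp.
by split=> //; exact: comp_norm_continuous.
Qed.

Lemma comp_lc_cvg0 (F : set_system C) : Filter F ->
  (F --> (0 : C) <-> forall q : C -> R, csn C q -> q @ F --> (0 : R)).
Proof.
move=> FF; split=> [F0 q cq|H].
  have [_ _ _ _ qc] := cq; rewrite -(seminorm0 (csn_seminorm cq)).
  by apply: (cvg_trans _ (qc 0)) => U /F0.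
exact/comp_cvg0/H/comp_norm_csn.
Qed.

HB.instance Definition _ := isLocCstar.Build R C
  (@comp_smul_continuous _ _ _ hp) (@comp_star_continuous _ _ _ hp)
  (@comp_hausdorff _ _ _ hp) (@comp_complete _ _ _ hp) comp_lc_cvg0.

Lemma completion_is_cstar : is_cstar C.
Proof.
exists N; split; [exact: comp_norm_csn|exact: comp_norm_eq0|].
by move=> F; exact: comp_cvg0.
Qed.

End CompletionInstance.

(** * Functoriality of the completion *)

Section CompletionMap.
Context (R : realType) (A B : starAlgType R) (p : A -> R) (r : B -> R)
  (hp : cstar_seminorm p) (hr : cstar_seminorm r).

(** Total, so that the connecting maps of an inverse system can be written
   down for all pairs of indices; of interest when [f] is a contractive
   *-homomorphism. *)
Definition comp_map (f : A -> B) (x : completion hp) : completion hr :=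
  if pselect (cauchy_seq r (fun i => f (rep x i))) is left c
  then cls hr (CSeq c) else 0.

Definition contractive_hom (f : A -> B) : Prop :=
  [/\ {morph f : a b / a + b}, forall (c : R[i]) a, f (c *: a) = c *: f a,
      {morph f : a b / smul a b}, {morph f : a / star a} &
      forall a, r (f a) <= p a].

Context (f : A -> B) (hf : contractive_hom f).

Lemma contractive_homB a b : f (a - b) = f a - f b.
Proof.
by case: hf => fD fZ _ _ _; rewrite fD -scaleN1r fZ scaleN1r.
Qed.

Lemma contractive_cauchy u : cauchy_seq p u -> cauchy_seq r (fun i => f (u i)).
Proof.
have [_ _ _ _ fr] := hf.
by apply: (cauchy_le hp (M := 1)) => i j; rewrite -contractive_homB mul1r.
Qed.

Lemma comp_map_cls (u : cseq p) :
  comp_map f (cls hp u) = cls hr (CSeq (contractive_cauchy (cseqP u))).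
Proof.
have [_ _ _ _ fr] := hf.
rewrite /comp_map; case: pselect => [c|nc]; last first.
  by case: nc; apply: contractive_cauchy; exact: cseqP.
apply/cls_eq; move: (rep_cls hp u).
by apply: (null_seq_le hp (M := 1)) => i /=; rewrite -contractive_homB mul1r.
Qed.

Lemma comp_map_compC a : comp_map f (compC hp a) = compC hr (f a).
Proof. by rewrite comp_map_cls; exact: cls_ext. Qed.

Lemma comp_mapD x y : comp_map f (x + y) = comp_map f x + comp_map f y.
Proof.
have [fD _ _ _ _] := hf.
elim/completionW: x => u; elim/completionW: y => v.
by rewrite cls_addE !comp_map_cls cls_addE; apply: cls_ext => i /=; rewrite fD.
Qed.

Lemma comp_mapZ (c : R[i]) x : comp_map f (c *: x) = c *: comp_map f x.
Proof.
have [_ fZ _ _ _] := hf.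
elim/completionW: x => u.
by rewrite cls_scaleE !comp_map_cls cls_scaleE; apply: cls_ext => i /=;
  rewrite fZ.
Qed.

Lemma comp_mapB x y : comp_map f (x - y) = comp_map f x - comp_map f y.
Proof. by rewrite comp_mapD -scaleN1r comp_mapZ scaleN1r. Qed.

Lemma comp_mapM x y :
  comp_map f (smul x y) = smul (comp_map f x) (comp_map f y).
Proof.
have [_ _ fM _ _] := hf.
elim/completionW: x => u; elim/completionW: y => v.
by rewrite cls_mulE !comp_map_cls cls_mulE; apply: cls_ext => i /=; rewrite fM.
Qed.

Lemma comp_mapS x : comp_map f (star x) = star (comp_map f x).
Proof.
have [_ _ _ fS _] := hf.
elim/completionW: x => u.
rewrite cls_starE !comp_map_cls cls_starE.
by apply: cls_ext => i /=; rewrite fS.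
Qed.

Lemma comp_map_norm x : comp_norm (comp_map f x) <= comp_norm x.
Proof.
have [_ _ _ _ fr] := hf.
elim/completionW: x => u; rewrite comp_map_cls.
apply: (ler_cvg_to (@cls_norm_cvg _ _ _ hr _) (@cls_norm_cvg _ _ _ hp u)).
by apply: nearW => i /=.
Qed.

Lemma comp_map_morphism :
  lc_morphism [set: completion hp] [set: completion hr] (comp_map f).
Proof.
split=> //.
- by move=> x y _ _; exact: comp_mapD.
- by move=> c x _; exact: comp_mapZ.
- by move=> x y _ _; exact: comp_mapM.
- split=> [x _|]; first exact: comp_mapS.
  apply: (proj1 (continuous_subspace_setT _)) => x U /comp_nbhsP[e e0 eU].
  apply/comp_nbhsP; exists e => // y yx; apply: eU.
  by rewrite -comp_mapB (le_lt_trans (comp_map_norm _)).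
Qed.

End CompletionMap.

Section CompletionMapTheory.
Context (R : realType) (A B C : starAlgType R) (p : A -> R) (r : B -> R)
  (s : C -> R) (hp : cstar_seminorm p) (hr : cstar_seminorm r)
  (hs : cstar_seminorm s).

Lemma comp_map_comp (f : A -> B) (g : B -> C) (h : A -> C) (x : completion hp) :
  contractive_hom p r f -> contractive_hom r s g -> contractive_hom p s h ->
  (forall a, g (f a) = h a) ->
  comp_map hs g (comp_map hr f x) = comp_map hs h x.
Proof.
move=> hf hg hh gf; elim/completionW: x => u.
by rewrite !comp_map_cls; apply: cls_ext => i /=; rewrite gf.
Qed.

Lemma contractive_id (q : A -> R) :
  (forall a, q a <= p a) -> contractive_hom p q id.
Proof. by move=> qp; split. Qed.

Lemma comp_map_id (x : completion hp) : comp_map hp id x = x.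
Proof.
have hid : contractive_hom p p id by apply: contractive_id.
by elim/completionW: x => u; rewrite comp_map_cls; apply: cls_ext.
Qed.

End CompletionMapTheory.

(** * Subalgebras as types *)

Section Subalgebra.
Context (R : realType) (B : topStarAlgType R) (D : set B).
Hypothesis hD : closed_star_subalgebra D.

Record subalgebra := Subalgebra { sub_val : B; sub_valP : D sub_val }.

Lemma sub_val_inj : injective sub_val.
Proof.
move=> [x xP] [y yP] /= xy; rewrite -xy in yP *.
by congr Subalgebra; exact: Prop_irrelevance.
Qed.

Let D0 : D 0. Proof. by case: hD. Qed.
Let DD a b : D a -> D b -> D (a + b).
Proof. by case: hD => _ _ H _ _; exact: H. Qed.
Let DZ (c : R[i]) a : D a -> D (c *: a).
Proof. by case: hD => _ _ _ H _; exact: H. Qed.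
Let DM a b : D a -> D b -> D (smul a b).
Proof. by case: hD => _ _ _ _ [H _]; exact: H. Qed.
Let DS a : D a -> D (star a).
Proof. by case: hD => _ _ _ _ [_ H]; exact: H. Qed.

(** The proof of closedness is an argument of the type, so that the algebraic
   structures are found from the type alone. *)
Definition subalg_type of closed_star_subalgebra D : Type := subalgebra.
Local Notation T := (subalg_type hD).

HB.instance Definition _ := gen_eqMixin T.
HB.instance Definition _ := gen_choiceMixin T.

Definition sub0 : T := Subalgebra D0.
Definition subD (x y : T) : T := Subalgebra (DD (sub_valP x) (sub_valP y)).
Definition subZ (c : R[i]) (x : T) : T := Subalgebra (DZ c (sub_valP x)).
Definition subM (x y : T) : T := Subalgebra (DM (sub_valP x) (sub_valP y)).
Definition subS (x : T) : T := Subalgebra (DS (sub_valP x)).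

Lemma subDA : associative subD.
Proof. by move=> x y z; apply: sub_val_inj; rewrite /= addrA. Qed.
Lemma subDC : commutative subD.
Proof. by move=> x y; apply: sub_val_inj; rewrite /= addrC. Qed.
Lemma sub0D : left_id sub0 subD.
Proof. by move=> x; apply: sub_val_inj; rewrite /= add0r. Qed.
Lemma subND : left_inverse sub0 (subZ (-1)) subD.
Proof. by move=> x; apply: sub_val_inj; rewrite /= scaleN1r addNr. Qed.

HB.instance Definition _ := GRing.isZmodule.Build T subDA subDC sub0D subND.

Lemma subZA (c d : R[i]) x : subZ c (subZ d x) = subZ (c * d) x.
Proof. by apply: sub_val_inj; rewrite /= scalerA. Qed.
Lemma subZ1 : left_id (1 : R[i]) subZ.
Proof. by move=> x; apply: sub_val_inj; rewrite /= scale1r. Qed.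
Lemma subZDr : right_distributive subZ +%R.
Proof. by move=> c x y; apply: sub_val_inj; rewrite /= scalerDr. Qed.
Lemma subZDl x : {morph subZ^~ x : c d / c + d}.
Proof. by move=> c d; apply: sub_val_inj; rewrite /= scalerDl. Qed.

HB.instance Definition _ :=
  GRing.Zmodule_isLmodule.Build R[i] T subZA subZ1 subZDr subZDl.

Lemma subMA : associative subM.
Proof. by move=> x y z; apply: sub_val_inj; rewrite /= smulA. Qed.
Lemma subMDl : left_distributive subM +%R.
Proof. by move=> x y z; apply: sub_val_inj; rewrite /= smulDl. Qed.
Lemma subMDr : right_distributive subM +%R.
Proof. by move=> x y z; apply: sub_val_inj; rewrite /= smulDr. Qed.
Lemma subMZl (c : R[i]) x y : subM (c *: x) y = c *: subM x y.
Proof. by apply: sub_val_inj; rewrite /= smulZl. Qed.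
Lemma subMZr (c : R[i]) x y : subM x (c *: y) = c *: subM x y.
Proof. by apply: sub_val_inj; rewrite /= smulZr. Qed.
Lemma subSK : involutive subS.
Proof. by move=> x; apply: sub_val_inj; rewrite /= starK. Qed.
Lemma subSD : {morph subS : x y / x + y}.
Proof. by move=> x y; apply: sub_val_inj; rewrite /= starD. Qed.
Lemma subSZ (c : R[i]) x : subS (c *: x) = c^* *: subS x.
Proof. by apply: sub_val_inj; rewrite /= starZ. Qed.
Lemma subSM x y : subS (subM x y) = subM (subS y) (subS x).
Proof. by apply: sub_val_inj; rewrite /= starM. Qed.

HB.instance Definition _ := isStarAlgebra.Build R T
  subMA subMDl subMDr subMZl subMZr subSK subSD subSZ subSM.

Lemma sub_valD (x y : T) : sub_val (x + y) = sub_val x + sub_val y.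
Proof. by []. Qed.
Lemma sub_valZ (c : R[i]) (x : T) : sub_val (c *: x) = c *: sub_val x.
Proof. by []. Qed.
Lemma sub_valB (x y : T) : sub_val (x - y) = sub_val x - sub_val y.
Proof. by rewrite sub_valD -scaleN1r sub_valZ scaleN1r. Qed.

End Subalgebra.

Lemma linking_subalgebra (R : realType) (A : locCstarType R) (E : ipModType A) :
  closed_star_subalgebra (@linking R A E).
Proof.
split.
- by apply: closed_bigI => M [[cM _ _ _ _] _].
- by move=> M [[_ M0 _ _ _] _].
- move=> S T LS LT M HM; have [[_ _ MD _ _] _] := HM.
  by apply: MD; [exact: LS|exact: LT].
- move=> c T LT M HM; have [[_ _ _ MZ _] _] := HM.
  by apply: MZ; exact: LT.
- split=> [S T LS LT|T LT] M HM; have [[_ _ _ _ [MM MS]] _] := HM.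
  + by apply: MM; [exact: LS|exact: LT].
  + by apply: MS; exact: LT.
Qed.

(** * Completeness of the algebra of operators *)

Section FamilyFilters.
Context (R : realType) (A : locCstarType R) (I : Type) (le : I -> I -> Prop)
  (q : I -> A -> R).
Hypothesis dir : directed_preorder le.
Hypothesis q_mono : forall l m a, le m l -> q m a <= q l a.
Hypothesis q_csn : forall l, csn A (q l).
Hypothesis q_cofinal : forall p, csn A p -> exists l, forall a, p a <= q l a.
Let hq l : cstar_seminorm (q l) := csn_seminorm (q_csn l).

Lemma directed_ball_filter (X : Type) (n : I -> X -> R) :
  (forall l m x, le m l -> n m x <= n l x) ->
  Filter (filter_from [set ld : I * R | 0 < ld.2]
    (fun ld => [set x | n ld.1 x < ld.2])).
Proof.
move=> n_mono; have [[l0] _ _ bnd] := dir.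
apply: filter_from_filter; first by exists (l0, 1) => /=.
move=> [l d] [m e] /= d0 e0; have [k [lk mk]] := bnd l m.
exists (k, Num.min d e); first by rewrite /= lt_min d0 e0.
move=> x /=; rewrite lt_min => /andP[xd xe]; split.
  exact: le_lt_trans (n_mono _ _ _ lk) xd.
exact: le_lt_trans (n_mono _ _ _ mk) xe.
Qed.

(** The balls of the family form a basis at 0: as a filter they converge to 0,
   since every continuous C*-seminorm is small on some of them. *)
Lemma alg_nbhs0 (U : set A) : nbhs (0 : A) U ->
  exists l, exists2 d : R, 0 < d & forall a, q l a < d -> U a.
Proof.
move=> U0; have FF := directed_ball_filter q_mono.
have /(_ U U0) [[l d] /= d0 H] : filter_from [set ld : I * R | 0 < ld.2]
    (fun ld => [set a | q ld.1 a < ld.2]) --> (0 : A).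
  apply/(lc_cvg0 _ FF) => p cp; apply/cvgrPdist_lt => e e0.
  have [l pl] := q_cofinal cp; exists (l, e) => //= a.
  rewrite sub0r normrN ger0_norm ?(seminorm_ge0 (csn_seminorm cp))//.
  exact: le_lt_trans.
by exists l, d.
Qed.

Lemma ip_top_nbhs0 (E : ipModType A) (U : set (ip_top E)) : sos_inner E ->
  nbhs (0 : ip_top E) U ->
  exists l, exists2 d : R, 0 < d & forall x : E, pbar (q l) x < d -> U x.
Proof.
move=> hE U0.
have n_mono l m (x : E) : le m l -> pbar (q m) x <= pbar (q l) x.
  by move=> ml; apply: pbar_le => a; exact: q_mono.
have FF := directed_ball_filter n_mono.
have /(_ U U0) [[l d] /= d0 H] : filter_from [set ld : I * R | 0 < ld.2]
    (fun ld => [set x : ip_top E | pbar (q ld.1) (x : E) < ld.2])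
    --> (0 : ip_top E).
  apply: (@ip_top_cvg R A E _ FF) => p y e cp ye.
  have hp := csn_seminorm cp.
  have [l pl] := q_cofinal cp; pose d := pbar p ((0 : E) - y).
  have yd : d < e by exact: ye.
  exists (l, e - d) => /= [|x xe]; first by rewrite subr_gt0.
  have H : pbar (q l) (x : E) < e - d by exact: xe.
  suff : pbar p ((x : E) - y) < e by [].
  have := pbar_tri hE hp (0 : E) x y; rewrite subr0 -/d.
  have := pbar_le (x : E) pl; lra.
by exists l, d.
Qed.

Lemma family_separated (a : A) : (forall l, q l a = 0) -> a = 0.
Proof.
move=> H; apply: csn_eq0 => p cp; have [l pl] := q_cofinal cp.
apply/le_anti; rewrite (seminorm_ge0 (csn_seminorm cp)) andbT.
by rewrite (le_trans (pl a))// H.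
Qed.

(** [A (+) E] carries no topology of its own here: completeness is phrased in
   terms of its seminorms, and for filters on an arbitrary index type so that
   it applies to the values at a vector of a filter of operators. *)
Definition family_complete (F : ipModType A) : Prop :=
  forall (T : Type) (Phi : set_system T) (f : T -> F), ProperFilter Phi ->
    (forall l (e : R), 0 < e -> exists2 M, Phi M &
       forall s s', M s -> M s' -> pbar (q l) (f s - f s') < e) ->
    exists w, forall l (e : R), 0 < e -> Phi [set s | pbar (q l) (f s - w) < e].

Lemma dsum_complete (E : hilbModType A) : family_complete (dsum E).
Proof.
move=> T Phi f PF cf; have sE := @hilbert_sos R A E.
have [a Ha] : exists a : A, (fun s => (f s).1) @ Phi --> a.
  apply: (@lc_complete R A _ (fmap_proper_filter _ PF)) => U.
  move=> /alg_nbhs0[l [d d0 dU]].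
  have [M PM HM] := cf l d d0; exists [set (f s).1 | s in M].
    by apply: (@filterS _ Phi _ M) => // s Ms; exists s.
  move=> _ _ [s Ms <-] [s' Ms' <-]; apply: dU.
  exact: le_lt_trans (dsum_pbar_fst sE (hq l) (f s - f s')) (HM _ _ Ms Ms').
have [x Hx] : exists x : ip_top E, (fun s => (f s).2 : ip_top E) @ Phi --> x.
  apply: (@hilbert_complete R A E _ (fmap_proper_filter _ PF)) => U.
  move=> /(ip_top_nbhs0 sE)[l [d d0 dU]].
  have [M PM HM] := cf l d d0; exists [set ((f s).2 : ip_top E) | s in M].
    by apply: (@filterS _ Phi _ M) => // s Ms; exists s.
  move=> _ _ [s Ms <-] [s' Ms' <-]; apply: dU.
  have H := le_lt_trans (dsum_pbar_snd sE (hq l) (f s - f s')) (HM _ _ Ms Ms').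
  exact: H.
exists (a, x : E) => l e e0; have e2 : 0 < e / 2 by rewrite divr_gt0.
have H1 : Phi [set s | q l ((f s).1 - a) < e / 2].
  exact: Ha _ (csn_nbhs a (q_csn l) e2).
have H2 : Phi [set s | pbar (q l) ((f s).2 - (x : E)) < e / 2].
  have V : nbhs (x : ip_top E) [set y : E | pbar (q l) (y - (x : E)) < e / 2].
    by apply: ip_top_nbhs => //; rewrite subrr (pbar0 E (hq l)).
  exact: Hx _ V.
apply: filterS2 H1 H2 => s /= s1 s2.
rewrite (le_lt_trans (dsum_pbar_le (hq l) _))//=; lra.
Qed.

Lemma dsum_separated (E : hilbModType A) (w : dsum E) :
  (forall l, pbar (q l) w = 0) -> w = 0.
Proof.
move=> w0; have sE := @hilbert_sos R A E; apply: dsum_eq => /=.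
  apply: family_separated => l; apply/le_anti.
  by rewrite (seminorm_ge0 (hq l)) andbT -(w0 l) dsum_pbar_fst.
apply: inner_eq0; apply: family_separated => l.
rewrite -(pbar_sqr (hq l)); apply/eqP; rewrite sqrf_eq0; apply/eqP/le_anti.
by rewrite pbar_ge0 andbT -(w0 l) dsum_pbar_snd.
Qed.

Section OperatorLimit.
Context (F : ipModType A) (hF : sos_inner F) (cF : family_complete F)
  (sepF : forall w : F, (forall l, pbar (q l) w = 0) -> w = 0).
Context (T : Type) (Phi : set_system T) (PF : ProperFilter Phi)
  (S : T -> adjointable F).
Hypothesis S_cauchy : forall l (e : R), 0 < e -> exists2 M, Phi M &
  forall s s', M s -> M s' -> op_bound (q l) (S s - S s')%R e.

Let meet2 (P Q : set T) : Phi P -> Phi Q -> exists s, P s /\ Q s.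
Proof.
move=> PP PQ; have PPQ : Phi (P `&` Q) by apply: filterI.
by have [s ?] := filter_ex PPQ; exists s.
Qed.

Let approx_eq (w w' : F) : (forall l, exists C : R, forall e : R, 0 < e ->
    pbar (q l) (w - w') <= C * e) -> w = w'.
Proof.
move=> H; apply/eqP; rewrite -subr_eq0; apply/eqP/sepF => l.
have [C HC] := H l; apply/le_anti; rewrite pbar_ge0 andbT.
apply/ler_addgt0Pr => e e0; rewrite add0r.
have C0 : 0 < `|C| + 1 by rewrite ltr_wpDl.
apply: le_trans (HC _ (divr_gt0 e0 C0)) _.
rewrite mulrA ler_pdivrMr// mulrC ler_pM2l//.
by rewrite (le_trans (ler_norm _))// lerDl.
Qed.

Let pointwise_cauchy (U : T -> adjointable F) (x : F) :
  (forall l (e : R), 0 < e -> exists2 M, Phi M &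
    forall s s', M s -> M s' -> op_bound (q l) (U s - U s')%R e) ->
  exists w, forall l (e : R), 0 < e ->
    Phi [set s | pbar (q l) (U s x - w) < e].
Proof.
move=> cU; apply: (cF PF) => l e e0.
have x0 : 0 < pbar (q l) x + 1 by rewrite ltr_wpDl ?pbar_ge0.
have [M PM HM] := cU l _ (divr_gt0 e0 x0); exists M => // s s' Ms Ms'.
have := HM _ _ Ms Ms' x; rewrite adj_subE => /le_lt_trans; apply.
by rewrite mulrAC ltr_pdivrMr// ltr_pM2l// ltrDl.
Qed.

Let star_cauchy l (e : R) : 0 < e -> exists2 M, Phi M &
  forall s s', M s -> M s' -> op_bound (q l) (star (S s) - star (S s'))%R e.
Proof.
move=> e0; have [M PM HM] := S_cauchy l e0; exists M => // s s' Ms Ms'.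
by rewrite -starB; apply: op_bound_star => //; [exact: ltW|exact: HM].
Qed.

(** The limit of a Cauchy filter of operators is taken pointwise; its adjoint
   is the pointwise limit of the adjoints. *)
Theorem operator_limit : exists S0 : adjointable F,
  forall l (e : R), 0 < e -> Phi [set s | op_bound (q l) (S s - S0)%R e].
Proof.
have lim_map (U : T -> adjointable F) (f : F -> F) :
    (forall x l (e : R), 0 < e -> Phi [set s | pbar (q l) (U s x - f x) < e]) ->
    module_map f.
  move=> Hf; split.
  - move=> x y; apply: approx_eq => l; exists 3 => e e0.
    have H : Phi ([set s | pbar (q l) (U s x - f x) < e]
        `&` [set s | pbar (q l) (U s y - f y) < e]).
      by apply: filterI; exact: Hf.
    have [s /= [s1 [s2 s3]]] := meet2 (Hf (x + y) l e e0) H.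
    have -> : f (x + y) - (f x + f y)
        = (f (x + y) - U s (x + y)) + ((U s x - f x) + (U s y - f y)).
      by rewrite adj_funD opprD [X in _ = _ + X]addrACA -opprD addrA subrK.
    rewrite (le_trans (pbarD hF (hq l) _ _))//.
    have := pbarD hF (hq l) (U s x - f x) (U s y - f y).
    move: s1; rewrite (pbarBC (hq l) (U s (x + y))); lra.
  - move=> c x; apply: approx_eq => l; exists (1 + Normc.normc c) => e e0.
    have [s /= [s1 s2]] := meet2 (Hf (c *: x) l e e0) (Hf x l e e0).
    have -> : f (c *: x) - c *: f x
        = (f (c *: x) - U s (c *: x)) + c *: (U s x - f x).
      by rewrite adj_funZ scalerBr addrA subrK.
    rewrite (le_trans (pbarD hF (hq l) _ _))// (pbarZ (hq l)) mulrDl mul1r.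
    rewrite lerD//; first by rewrite (pbarBC (hq l)) ltW.
    by rewrite ler_wpM2l ?normc_ge0// ltW.
  - move=> x a; apply: approx_eq => l; exists (1 + q l a) => e e0.
    have [s /= [s1 s2]] := meet2 (Hf (ract x a) l e e0) (Hf x l e e0).
    have -> : f (ract x a) - ract (f x) a
        = (f (ract x a) - U s (ract x a)) + ract (U s x - f x) a.
      rewrite adj_fun_ract ractDl addrA subrK; congr (_ + _).
      by rewrite -[in RHS]scaleN1r ractZl scaleN1r.
    rewrite (le_trans (pbarD hF (hq l) _ _))// mulrDl mul1r lerD//.
      by rewrite (pbarBC (hq l)) ltW.
    rewrite (le_trans (pbar_ract (hq l) _ _))// mulrC.
    by rewrite ler_wpM2l ?(seminorm_ge0 (hq l))// ltW.
have [f Hf] : {f : F -> F & forall x l (e : R), 0 < e ->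
    Phi [set s | pbar (q l) (S s x - f x) < e]}.
  apply: (@choice F F (fun x w => forall l (e : R), 0 < e ->
    Phi [set s | pbar (q l) (S s x - w) < e])) => x.
  exact: pointwise_cauchy.
have [g Hg] : {g : F -> F & forall x l (e : R), 0 < e ->
    Phi [set s | pbar (q l) (star (S s) x - g x) < e]}.
  apply: (@choice F F (fun x w => forall l (e : R), 0 < e ->
    Phi [set s | pbar (q l) (star (S s) x - w) < e])) => x.
  exact: pointwise_cauchy.
have fg x y : inner (f x) y = inner x (g y).
  apply/eqP; rewrite -subr_eq0; apply/eqP/family_separated => l.
  apply/le_anti; rewrite (seminorm_ge0 (hq l)) andbT.
  apply/ler_addgt0Pr => e e0; rewrite add0r.
  pose K := pbar (q l) x + pbar (q l) y + 1.
  have x0 := pbar_ge0 (q l) x; have y0 := pbar_ge0 (q l) y.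
  have K0 : 0 < K by rewrite /K; lra.
  have d0 : 0 < e / K by rewrite divr_gt0.
  have [s /= [s1 s2]] := meet2 (Hf x l _ d0) (Hg y l _ d0).
  have -> : inner (f x) y - inner x (g y)
      = inner (f x - S s x) y + inner x (star (S s) y - g y).
    by rewrite innerBl innerBr [X in _ + (X - _)]/= -adjP addrA subrK.
  rewrite (le_trans (seminormD (hq l) _ _))//.
  have H1 := cauchy_schwarz hF (hq l) (f x - S s x) y.
  have H2 := cauchy_schwarz hF (hq l) x (star (S s) y - g y).
  rewrite (pbarBC (hq l)) in H1.
  have eK : e / K * K = e by rewrite divfK// gt_eqF.
  rewrite /K in eK d0 *; move: s1 s2 H1 H2 eK d0.
  move: (pbar _ (S s x - f x)) (pbar _ (star (S s) y - g y)) (e / _).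
  move=> a b d; nra.
exists (Adjointable (lim_map _ _ Hf) (lim_map _ _ Hg) fg) => l e e0.
have [M PM HM] := S_cauchy l e0.
apply: (filterS _ (PM)) => s Ms.
suff H x : pbar (q l) (S s x - f x) <= e * pbar (q l) x.
  by move=> x; rewrite adj_subE.
apply/ler_addgt0Pr => d d0.
have [s' /= [Ms' s's]] := meet2 PM (Hf x l d d0).
have := pbar_tri hF (hq l) (S s' x) (S s x) (f x).
have := HM _ _ Ms Ms' x; rewrite adj_subE; move: s's; lra.
Qed.

End OperatorLimit.

End FamilyFilters.

(** * The linking algebra as an inverse limit *)

Section LinkingLimit.
Context (R : realType) (G : topGroupType) (A : locCstarType R)
  (E : hilbModType A) (u : G -> E -> E) (hu : mod_action u).
Hypothesis hE : full_module E.
Context (I : Type) (le : I -> I -> Prop) (q : I -> A -> R).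
Hypothesis dir : directed_preorder le.
Hypothesis q_mono : forall l m a, le m l -> q m a <= q l a.
Hypothesis q_csn : forall l, csn A (q l).
Hypothesis q_cofinal : forall p, csn A p -> exists l, forall a, p a <= q l a.
Hypothesis q_twist : forall l g a, q l (twist hu g a) = q l a.
Hypothesis linking_bounded : forall S : adjointable (dsum E), linking S ->
  forall l, exists2 M : R, 0 <= M & op_bound (q l) S M.
Let hq l : cstar_seminorm (q l) := csn_seminorm (q_csn l).
Let sF := dsum_sos (@hilbert_sos R A E).

Local Notation D := (@linking R A E).
Local Notation L := (subalg_type (linking_subalgebra E)).
Local Notation opv S := (sub_val (S : L) : adjointable (dsum E)).
Local Notation gamma := (action_linking hu hE).

Definition link_norm (l : I) (S : L) : R := fine (ptilde (q l) (opv S)).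

Let link_norm_fin l (S : L) : ptilde (q l) (opv S) \is a fin_num.
Proof.
have [M M0 SM] := linking_bounded (sub_valP S) l.
rewrite ge0_fin_numE; last exact: ptilde_ge0.
by apply: le_lt_trans (ltry M); apply/ptilde_leP.
Qed.

Lemma link_norm_ge0 l (S : L) : 0 <= link_norm l S.
Proof. by rewrite fine_ge0// ptilde_ge0. Qed.

Lemma link_norm_bound l (S : L) : op_bound (q l) (opv S) (link_norm l S).
Proof. by apply/(ptilde_leP (hq l)); rewrite ?link_norm_ge0// fineK. Qed.

Lemma link_norm_le l (S : L) (M : R) : 0 <= M -> op_bound (q l) (opv S) M ->
  link_norm l S <= M.
Proof.
by move=> M0 SM; rewrite -lee_fin fineK//; apply/ptilde_leP.
Qed.

Lemma link_norm_cstar l : cstar_seminorm (link_norm l).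
Proof.
apply: cstar_seminormP.
- exact: link_norm_ge0.
- move=> S T; apply: link_norm_le; first by rewrite addr_ge0 ?link_norm_ge0.
  by apply: op_boundD => //; exact: link_norm_bound.
- move=> c S; apply: link_norm_le.
    by rewrite mulr_ge0 ?link_norm_ge0 ?normc_ge0.
  by apply: op_boundZ => //; exact: link_norm_bound.
- move=> S T; apply: link_norm_le; first by rewrite mulr_ge0 ?link_norm_ge0.
  by apply: op_boundM; [exact: link_norm_ge0|exact: link_norm_bound..].
- move=> S; rewrite -[leRHS]sqr_sqrtr ?link_norm_ge0//.
  rewrite ler_pXn2r ?nnegrE ?sqrtr_ge0 ?link_norm_ge0//.
  apply: link_norm_le; first exact: sqrtr_ge0.
  apply: (op_bound_star_square sF) => //; first exact: link_norm_ge0.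
  exact: (@link_norm_bound l (smul (star S) S)).
Qed.

Lemma link_norm_mono l m (S : L) : le m l -> link_norm m S <= link_norm l S.
Proof.
move=> ml; apply: link_norm_le; first exact: link_norm_ge0.
apply: (op_bound_le sF (hq m) (hq l)) => [a||].
- exact: q_mono.
- exact: link_norm_ge0.
- exact: link_norm_bound.
Qed.

Definition link_gamma (g : G) (S : L) : L :=
  Subalgebra (@conj_op_linking R A E (@action_aut _ _ _ _ _ hu hE g)
    (twist_morph hu g) _ (sub_valP S)).

Lemma link_gamma_norm l g (S : L) :
  link_norm l (link_gamma g S) <= link_norm l S.
Proof.
apply: link_norm_le; first exact: link_norm_ge0.
apply: (op_bound_conj (W := @action_dsum _ _ _ _ _ hu hE)).
  by move=> k h a; exact: q_twist.
exact: link_norm_bound.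
Qed.

Lemma link_gamma_contractive l m g : le m l ->
  contractive_hom (link_norm l) (link_norm m) (link_gamma g).
Proof.
move=> ml; split.
- by move=> S T; apply: sub_val_inj; exact: conj_opD.
- by move=> c S; apply: sub_val_inj; exact: conj_opZ.
- by move=> S T; apply: sub_val_inj; exact: conj_opM.
- by move=> S; apply: sub_val_inj; exact: conj_opS.
- by move=> S; rewrite (le_trans (link_gamma_norm m g S))// link_norm_mono.
Qed.

Lemma link_id_contractive l m : le m l ->
  contractive_hom (link_norm l) (link_norm m) id.
Proof. by move=> ml; apply: contractive_id => S; exact: link_norm_mono. Qed.

Let le_refl l : le l l. Proof. by case: dir. Qed.
Let le_tr l m n : le m l -> le n m -> le n l.
Proof. by move=> ml nm; case: dir => _ _ tr _; exact: tr nm ml. Qed.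

Local Notation link_alg l := (completion (link_norm_cstar l)).

Definition link_map (l m : I) : link_alg l -> link_alg m :=
  comp_map (link_norm_cstar m) id.

Lemma link_map_id l a : @link_map l l a = a.
Proof. exact: comp_map_id. Qed.

Lemma link_map_comp l m n a : le m l -> le n m ->
  @link_map m n (@link_map l m a) = @link_map l n a.
Proof.
move=> ml nm; have nl := le_tr ml nm.
by apply: comp_map_comp => //; exact: link_id_contractive.
Qed.

(** At level [l] stands the completion of the linking algebra for the operator
   seminorm attached to [q l]; the connecting maps extend the identity. *)
Definition link_system : inv_system R := InvSystem R I le
  (fun l => link_alg l : locCstarType R) link_map dir
  (fun l => completion_is_cstar (link_norm_cstar l))
  (fun l m ml => comp_map_morphism _ _ (link_id_contractive ml))
  link_map_id link_map_comp.

Definition link_lift (S : adjointable (dsum E)) : L :=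
  if pselect (D S) is left h then Subalgebra h else 0.

Lemma link_liftK S : D S -> sub_val (link_lift S) = S.
Proof. by move=> DS; rewrite /link_lift; case: pselect. Qed.

Definition link_chi (l : I) (S : adjointable (dsum E)) : link_alg l :=
  compC (link_norm_cstar l) (link_lift S).

Definition link_action (l : I) (g : G) : link_alg l -> link_alg l :=
  comp_map (link_norm_cstar l) (link_gamma g).

Lemma link_chi_dist l S T : D S -> D T ->
  comp_norm (link_chi l S - link_chi l T)
  = link_norm l (link_lift S - link_lift T).
Proof. by move=> DS DT; rewrite -compC_sub comp_norm_compC. Qed.

Lemma link_lift_sub_bound l S T : D S -> D T ->
  op_bound (q l) (S - T)%R (link_norm l (link_lift S - link_lift T)).
Proof.
move=> DS DT; have := link_norm_bound l (link_lift S - link_lift T).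
by rewrite sub_valB !link_liftK.
Qed.

Lemma link_chi_morphism l : lc_morphism D [set: link_alg l] (link_chi l).
Proof.
have [_ _ DD DZ [DM DS]] := linking_subalgebra E.
split=> //.
- move=> S T HS HT; rewrite -compC_add; congr compC; apply: sub_val_inj.
  by rewrite sub_valD !link_liftK//; exact: DD.
- move=> c S HS; rewrite -compC_scale; congr compC; apply: sub_val_inj.
  by rewrite sub_valZ !link_liftK//; exact: DZ.
- move=> S T HS HT; rewrite -compC_mul; congr compC; apply: sub_val_inj.
  by rewrite /= !link_liftK//; exact: DM.
- split=> [S HS|].
    rewrite -compC_star; congr compC; apply: sub_val_inj.
    by rewrite /= !link_liftK//; exact: DS.
  apply/subspace_continuousP => S HS U /comp_nbhsP[e e0 eU].
  have e2 : 0 < e / 2 by rewrite divr_gt0.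
  apply: (@filterS _ (nbhs S) (nbhs_filter S) _ _ _
    (adj_ball_nbhs q_csn l S e2)).
  move=> T TS DT; apply: eU; rewrite link_chi_dist//.
  apply: (@le_lt_trans _ _ (e / 2)); last by lra.
  by apply: link_norm_le; rewrite ?(ltW e2)// sub_valB !link_liftK.
Qed.

(** The sets of elements of the linking algebra that are close to the thread
   at a given level generate a Cauchy filter of operators; it converges, and
   the linking algebra is closed. *)
Lemma link_thread (t : forall l, link_alg l) :
  (forall l m, le m l -> @link_map l m (t l) = t m) ->
  exists2 S, D S & forall l, link_chi l S = t l.
Proof.
move=> ht; pose n l (S : L) := comp_norm (t l - compC (link_norm_cstar l) S).
have n_mono l m S : le m l -> n m S <= n l S.
  move=> ml; have hc := link_id_contractive ml.
  have -> : n m S = comp_norm (comp_map (link_norm_cstar m) id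
      (t l - compC (link_norm_cstar l) S)).
    rewrite (comp_mapB _ hc) (comp_map_compC _ _ hc).
    by rewrite -[comp_map _ _ (t l)]/(link_map m (t l)) ht.
  exact: (comp_map_norm _ hc).
have FF := directed_ball_filter dir n_mono.
set Phi := filter_from _ _ in FF.
have PF : ProperFilter Phi.
  apply: filter_from_proper => -[l e] /= e0.
  by have [S] := compC_dense (t l) e0; exists S.
have S_cauchy l (e : R) : 0 < e -> exists2 M, Phi M &
    forall S S' : L, M S -> M S' -> op_bound (q l) (opv S - opv S')%R e.
  move=> e0; have e2 : 0 < e / 2 by rewrite divr_gt0.
  exists [set S | n l S < e / 2]; first by exists (l, e / 2).
  move=> S S' nS nS'; rewrite /mkset in nS nS'.
  rewrite -(sub_valB (S : L) (S' : L)).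
  apply: op_boundW (link_norm_bound l (S - S')).
  rewrite -(comp_norm_compC (link_norm_cstar l)) compC_sub.
  apply: le_trans
    (seminorm_tri (comp_norm_cstar (link_norm_cstar l)) (t l) _ _) _.
  rewrite (seminormBC (comp_norm_cstar (link_norm_cstar l)) _ (t l)).
  by rewrite [leRHS]splitr ltW// (ltrD nS nS').
have [S0 HS0] := operator_limit q_csn q_cofinal sF
  (dsum_complete dir q_mono q_csn q_cofinal (E := E))
  (dsum_separated q_csn q_cofinal (E := E)) PF S_cauchy.
have DS0 : D S0.
  have [cD _ _ _ _] := linking_subalgebra E; apply: cD => U US0.
  pose v (S : L) := opv S.
  have FS : Filter (v @ Phi) by exact: fmap_filter.
  have H : v @ Phi --> S0.
    by apply: (adj_ball_cvg q_csn q_cofinal sF) => l e; exact: HS0.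
  have PU : Phi (v @^-1` U) by exact: H.
  have [S US] := filter_ex PU.
  by exists (v S); split=> //; exact: sub_valP.
exists S0 => // l; apply/eqP; rewrite -subr_eq0; apply/eqP.
have hN := comp_norm_cstar (link_norm_cstar l).
apply: (seminorm_small hN (@comp_norm_eq0 _ _ _ (link_norm_cstar l))) => e e0.
have e2 : 0 < e / 2 by rewrite divr_gt0.
have PP : Phi ([set S | n l S < e / 2]
    `&` [set S | op_bound (q l) (opv S - S0)%R (e / 2)]).
  by apply: filterI; [exists (l, e / 2)|exact: HS0].
have [S [nS SS0]] := filter_ex PP.
have H : link_norm l (link_lift S0 - S) <= e / 2.
  apply: link_norm_le; first exact: ltW.
  by rewrite sub_valB link_liftK//; exact: op_boundBC.
apply: le_lt_trans (seminorm_tri hN (compC (link_norm_cstar l) S) _ _) _.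
rewrite (seminormBC hN _ (t l)) -compC_sub comp_norm_compC.
by rewrite [ltRHS]splitr (ler_ltD H nS).
Qed.

Theorem linking_limit : is_alg_limit D (S := link_system) link_chi.
Proof.
split.
- exact: link_chi_morphism.
- move=> l m S ml DS; exact: (comp_map_compC _ _ (link_id_contractive ml)).
- move=> S T DS DT ST; apply: adjointable_eq (@dsum_nondegenerate _ _ _) _ _ _.
  move=> z; apply/eqP; rewrite -subr_eq0; apply/eqP.
  apply: (dsum_separated q_csn q_cofinal) => l; apply/le_anti.
  rewrite pbar_ge0 andbT -adj_subE.
  have := link_lift_sub_bound l DS DT z.
  by rewrite -link_chi_dist// ST subrr (seminorm0 (comp_norm_cstar _)) mul0r.
- exact: link_thread.
- move=> F S FF FD DS Fchi; apply: (adj_ball_cvg q_csn q_cofinal sF) => l e e0.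
  have H : F [set T | comp_norm (link_chi l T - link_chi l S) < e].
    exact: Fchi l _ (comp_nbhs_ball (link_chi l S) e0).
  apply: filterS2 H FD => T TS DT; rewrite /mkset in TS *.
  apply: op_boundW (link_lift_sub_bound l DT DS).
  by rewrite -link_chi_dist//; exact: ltW.
Qed.

Lemma link_action_alg_action l :
  alg_action [set: link_alg l] (@link_action l).
Proof.
have hc g := link_gamma_contractive g (le_refl l).
apply: alg_action_of_group => [g|x _|g h x _].
- exact: comp_map_morphism.
- have g1 : link_gamma 1%g = id.
    by apply/funext => S; apply: sub_val_inj; exact: action_linking1.
  by rewrite /link_action g1; exact: comp_map_id.
- apply/esym/(comp_map_comp _ _ _ (hc h) (hc g) (hc (g * h)%g)) => S.
  by apply: sub_val_inj; apply/esym; exact: action_linkingM.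
Qed.

Lemma link_action_compat l m g a : le m l ->
  @link_map l m (@link_action l g a) = @link_action m g (@link_map l m a).
Proof.
move=> ml; have hid := link_id_contractive ml.
have hl := link_gamma_contractive g (le_refl l).
have hm := link_gamma_contractive g (le_refl m).
have hlm := link_gamma_contractive g ml.
rewrite /link_map /link_action (comp_map_comp _ _ _ hl hid hlm)//.
by rewrite (comp_map_comp _ _ _ hid hm hlm).
Qed.

Lemma link_chi_action l g S : D S ->
  link_chi l (gamma g S) = @link_action l g (link_chi l S).
Proof.
move=> DS; have hc := link_gamma_contractive g (le_refl l).
rewrite /link_action /link_chi (comp_map_compC _ _ hc); congr compC.
apply: sub_val_inj; rewrite /= !link_liftK//.
exact: conj_op_linking.
Qed.

Lemma linking_inverse_limit :
  continuous_alg_action D gamma -> inverse_limit_alg_action D gamma.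
Proof.
move=> cg; split=> //; exists link_system, link_chi, link_action; split.
- exact: linking_limit.
- exact: link_action_alg_action.
- exact: link_action_compat.
- exact: link_chi_action.
Qed.

End LinkingLimit.

(** * The action induced on the linking algebra *)

Theorem proposition3p1 (R : realType) (G : topGroupType)
    (hG : locally_compact_group G)
    (A : locCstarType R) (E : hilbModType A) (hE : full_module E)
    (u : G -> E -> E) (hu : mod_action u) :
  exists (alpha : G -> A -> A) (beta : G -> adjointable E -> adjointable E)
         (gamma : G -> adjointable (dsum E) -> adjointable (dsum E)),
    [/\ induced_on_alg u alpha,
        induced_on_compacts u beta,
        alg_action (@linking R A E) gamma,
        forall (g : G) (a : A) (x y : E) (T : adjointable E), compacts T ->
          gamma g (linkop a x y T)
          = linkop (alpha g a) (u g x) (u g y) (beta g T) &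
        continuous_mod_action u -> inverse_limit_mod_action u ->
          inverse_limit_alg_action (@linking R A E) gamma].
Proof.
exists (twist hu), (action_compacts hu hE), (action_linking hu hE); split.
- exact: twist_action.
- exact: action_compacts_action.
- exact: action_linking_action.
- by move=> g a x y T _; exact: action_linking_linkop.
move=> [_ u_cont] [_ [S [chi [sigma [ul [lim ul_action _ sigma_u]]]]]].
pose q := level_seminorm chi.
have q_csn := level_seminorm_csn lim.
have q_cofinal := level_seminorm_cofinal lim.
have q_twist := level_seminorm_twist hu hE lim ul_action sigma_u.
apply: (linking_inverse_limit (sys_directed R S) (level_seminorm_mono lim)
  q_csn q_cofinal q_twist).
- move=> T LT; have [bT _] := linking_orbit hE q_csn q_twist u_cont LT.
  exact: bT.
- exact: (action_linking_continuous hE q_csn q_cofinal q_twist u_cont).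
Qed.
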